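(* Let $n\ge2$, $s\ge2$, and let $\varphi=\varphi(x,z)\in\mathcal S(\mathbb R^{2n+s})$. Let $P(x)=\sum_{j=1}^n(x_j^2-x_{n+j}^2)$ on $\mathbb R^{2n}$ and let $K_{0,s}^{1,0}\in\mathcal S'(\mathbb R^{2n+s})$ be the tempered distribution $K^{1,0}_{0,s}(\varphi)=\int_{\mathbb R^{2n+s}}q(\xi,\vartheta)[\mathcal F\varphi](\xi,\vartheta)\,d\xi\,d\vartheta$ with $$q(\xi,\vartheta)=\frac{i}{(2\pi)^{n+\frac s2}}\int_0^\infty \frac{1}{|\vartheta|\cosh^n t}\exp\Big\{ i\,\frac{\tanh t}{|\vartheta|}\,P(\xi)\Big\}\,dt .$$ Then $$K_{0,s}^{1,0}(\varphi)=\Big(\frac{2}{i}\Big)^{n-2}\frac{1}{(2\pi)^{n+\frac s2}}\int_0^\infty\frac{1}{\sinh t\,\cosh^{n-1}t}\;\frac{1}{P^{n-1}}[\varphi_t]\,dt,$$ where $$\varphi_t(x)=\int_0^\infty\frac{d^{n-1}}{dr^{n-1}}\Big[r^{n+s-2}\,\widetilde\varphi(x,r)\Big]e^{-\frac{ir}{4}P(x)\coth t}\,dr\ \in\mathcal S(\mathbb R^{2n}).$$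
   Context: Fourier transform on $\mathbb R^d$: $[\mathcal F\varphi](\xi)=(2\pi)^{-d/2}\int\varphi(x)e^{-ix\cdot\xi}dx$; $\mathcal F_{z\to\vartheta}$ is the (same normalized) partial Fourier transform in $z\in\mathbb R^s$ only. $\widetilde\varphi(x,r)=\int_{\mathbb S^{s-1}}[\mathcal F_{z\to\vartheta}\varphi](x,r\omega)\,d\sigma(\omega)$ for $r>0$, with $\sigma$ the standard surface measure on the Euclidean unit sphere $\mathbb S^{s-1}\subset\mathbb R^s$. For $\psi\in\mathcal S(\mathbb R^{2n})$, $$\frac1{P^{n-1}}[\psi]:=\lim_{\varepsilon\downarrow0}\int_{\mathbb R^{2n}}\frac{\psi(x)}{[P(x)-i\varepsilon]^{n-1}}\,dx,$$ a limit which exists. ($K_{0,s}^{1,0}$ is a fundamental solution of the ultra-hyperbolic operator $\Delta_{0,s}$ on the pseudo $H$-type group $G_{0,s}$; this is not needed to parse the statement.) *)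

(* Defs.v *)
From HB Require Import structures.
From mathcomp Require Import all_boot all_order all_algebra.
From mathcomp Require Import all_classical all_reals all_analysis.
From mathcomp Require Import measurable_realfun.
From mathcomp Require Export complex.

Set Implicit Arguments.
Unset Strict Implicit.
Unset Printing Implicit Defensive.
Import Order.TTheory GRing.Theory Num.Theory.
Import numFieldNormedType.Exports.
Local Open Scope classical_set_scope.
Local Open Scope ring_scope.
Local Open Scope complex_scope.

Lemma sigma_finite_product d1 d2 (T1 : measurableType d1)
    (T2 : measurableType d2) (R : realType)
    (m1 : {sigma_finite_measure set T1 -> \bar R})
    (m2 : {sigma_finite_measure set T2 -> \bar R}) :
  sigma_finite setT (m1 \x m2)%E.
Proof.
have /sigma_finiteP[F [TF ndF Foo]] := sigma_finiteT m1.
have /sigma_finiteP[G [TG ndG Goo]] := sigma_finiteT m2.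
exists (fun n => F n `*` G n) => [|k].
  rewrite -setXTT TF TG predeqE => -[x y]; split.
    move=> [/= [n _ Fnx] [k _ Gky]]; exists (maxn n k) => //; split.
    - by move: x Fnx; exact/subsetPset/ndF/leq_maxl.
    - by move: y Gky; exact/subsetPset/ndG/leq_maxr.
  by move=> [n _ []/= ? ?]; split; exists n.
have [? ?] := Foo k; have [? ?] := Goo k; split; first exact: measurableX.
by rewrite product_measure1E// lte_mul_pinfty// ge0_fin_numE.
Qed.

(* R with its Borel sigma-algebra, as carrier of lebesgue_measure, is
   measurableTypeR R; it is convertible to R. *)
Notation tupleR R m := (m.-tuple (measurableTypeR R)).

Section lebesgue_tuple_step.
Variables (R : realType) (m : nat).
Variable mu : {sigma_finite_measure set (tupleR R m) -> \bar R}.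

Definition cons_pair (p : measurableTypeR R * tupleR R m) : tupleR R m.+1 :=
  [tuple of p.1 :: p.2].

Lemma measurable_cons_pair :
  measurable_fun [set: measurableTypeR R * tupleR R m] cons_pair.
Proof. exact: measurable_cons. Qed.

Definition lebesgue_tuple_step : set (tupleR R m.+1) -> \bar R :=
  pushforward (lebesgue_measure \x mu)%E cons_pair.

Let step0 : lebesgue_tuple_step set0 = 0%E.
Proof. by rewrite /lebesgue_tuple_step /pushforward preimage_set0 measure0. Qed.

Let step_ge0 A : (0 <= lebesgue_tuple_step A)%E.
Proof. by rewrite /lebesgue_tuple_step /pushforward; exact: measure_ge0. Qed.

Let step_additive : semi_sigma_additive lebesgue_tuple_step.
Proof.
move=> F mF tF mUF; rewrite /lebesgue_tuple_step /pushforward preimage_bigcup.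
have mc B : measurable B -> measurable (cons_pair @^-1` B).
  by move=> mB; rewrite -[X in measurable X]setTI; exact: measurable_cons_pair.
apply: measure_semi_sigma_additive.
- by move=> n; exact: mc.
- apply/trivIsetP => /= i j _ _ ij; rewrite -preimage_setI.
  by move/trivIsetP : tF => /(_ _ _ _ _ ij) ->//; rewrite preimage_set0.
- by rewrite -preimage_bigcup; exact: mc.
Qed.

HB.instance Definition _ := isMeasure.Build _ _ _ lebesgue_tuple_step
  step0 step_ge0 step_additive.

Let step_sigma_finite : sigma_finite setT lebesgue_tuple_step.
Proof.
have [F UF mF] := sigma_finite_product (@lebesgue_measure R) mu.
pose uncons (t : tupleR R m.+1) := (thead t, [tuple of behead t]).
have unconsK : cancel cons_pair uncons.
  by move=> [x t]; rewrite /uncons /cons_pair/=; congr pair; exact: val_inj.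
have mun : measurable_fun setT uncons.
  apply/measurable_fun_pairP; split; last exact: measurable_behead.
  exact: measurable_tnth.
exists (fun i => uncons @^-1` F i).
  by rewrite -preimage_bigcup -UF preimage_setT.
move=> i; have [mFi Fi] := mF i; split.
  by rewrite -[X in measurable X]setTI; exact: mun.
rewrite /lebesgue_tuple_step /pushforward (_ : _ @^-1` _ = F i)//.
by apply/seteqP; split => p; rewrite /preimage/= unconsK.
Qed.

HB.instance Definition _ := Measure_isSigmaFinite.Build _ _ _
  lebesgue_tuple_step step_sigma_finite.

End lebesgue_tuple_step.

Fixpoint lebesgue_tuple (R : realType) (m : nat) :
    {sigma_finite_measure set (tupleR R m) -> \bar R} :=
  match m with
  | 0 => \d_[tuple]
  | m'.+1 => lebesgue_tuple_step (lebesgue_tuple R m')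
  end.

Definition rV_of (R : realType) (m : nat) (t : tupleR R m) : 'rV[R]_m :=
  \row_i tnth t i.

Definition tuple_of_rV (R : realType) (m : nat) (x : 'rV[R]_m) : tupleR R m :=
  [tuple x 0 i | i < m].

Definition dotr (R : realType) (m : nat) (x y : 'rV[R]_m) : R :=
  \sum_(i < m) x 0 i * y 0 i.

(* The library norm on 'rV[R]_m is the sup norm, hence this one. *)
Definition enorm (R : realType) (m : nat) (x : 'rV[R]_m) : R :=
  Num.sqrt (dotr x x).

Section sphere_measure.
Variables (R : realType) (s : nat).

Definition unit_vector (t : tupleR R s) : tupleR R s :=
  tuple_of_rV ((enorm (rV_of t))^-1 *: rV_of t).

Definition punctured_ball : set (tupleR R s) :=
  [set t | 0 < enorm (rV_of t) <= 1].

(* Surface measure on the unit sphere of R^s, seen as a measure on R^s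
   concentrated on the sphere: sigma(A) = s * Leb{x : 0 < |x| <= 1, x/|x| in A},
   the normalization given by integration in polar coordinates
   dx = r^(s-1) dr dsigma. *)
Definition sphere_measure (A : set (tupleR R s)) : \bar R :=
  (s%:R%:E * lebesgue_tuple R s (punctured_ball `&` unit_vector @^-1` A))%E.

Lemma measurable_enorm :
  measurable_fun [set: tupleR R s] (fun t => enorm (rV_of t)).
Proof.
rewrite (_ : (fun _ => _) = fun t : tupleR R s =>
    (\sum_(i < s) (tnth t i : R) * tnth t i) `^ (2^-1)); last first.
  apply/funext => t; rewrite /enorm /dotr powR12_sqrt; last first.
    by apply: sumr_ge0 => i _; rewrite -expr2 sqr_ge0.
  by congr Num.sqrt; apply: eq_bigr => i _; rewrite !mxE.
apply: (@measurableT_comp _ _ _ _ _ _ (fun x : R => x `^ (2^-1))).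
  exact: measurable_powR.
by apply: measurable_sum => i; apply: measurable_funM; exact: measurable_tnth.
Qed.

Lemma measurable_unit_vector : measurable_fun [set: tupleR R s] unit_vector.
Proof.
apply/measurable_fun_tnthP => i.
rewrite (_ : _ \o _ = fun t : tupleR R s =>
    enorm (rV_of t) `^ (-1) * tnth t i); last first.
  by apply/funext => t; rewrite /= tnth_mktuple !mxE powR_inv1// sqrtr_ge0.
apply: measurable_funM; last exact: measurable_tnth.
apply: (@measurableT_comp _ _ _ _ _ _ (fun x : R => x `^ (-1))).
  exact: measurable_powR.
exact: measurable_enorm.
Qed.

Lemma measurable_punctured_ball : measurable punctured_ball.
Proof.
rewrite (_ : punctured_ball =
    (fun t => enorm (rV_of t)) @^-1` `]0, 1]); last first.
  by apply/seteqP; split => t; rewrite /punctured_ball/= in_itv.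
by rewrite -[X in measurable X]setTI; exact: measurable_enorm.
Qed.

Let measurable_cone A : measurable A ->
  measurable (punctured_ball `&` unit_vector @^-1` A).
Proof.
move=> mA; apply: measurableI; first exact: measurable_punctured_ball.
by rewrite -[X in measurable X]setTI; exact: measurable_unit_vector.
Qed.

Let sphere0 : sphere_measure set0 = 0%E.
Proof. by rewrite /sphere_measure preimage_set0 setI0 measure0 mule0. Qed.

Let sphere_ge0 A : (0 <= sphere_measure A)%E.
Proof. by rewrite /sphere_measure mule_ge0 ?lee_fin. Qed.

Let sphere_additive : semi_sigma_additive sphere_measure.
Proof.
move=> F mF tF mUF; rewrite /sphere_measure preimage_bigcup setI_bigcupr.
rewrite [X in X @ _ --> _](_ : _ = (fun n => s%:R%:E *
  \sum_(0 <= i < n)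
    lebesgue_tuple R s (punctured_ball `&` unit_vector @^-1` F i))%E); last first.
  by apply/funext => n; rewrite ge0_sume_distrr.
apply: cvgeZl => //.
apply: measure_semi_sigma_additive.
- by move=> i; exact: measurable_cone.
- apply/trivIsetP => i j _ _ ij; rewrite setIACA setIid -preimage_setI.
  by move/trivIsetP : tF => /(_ _ _ _ _ ij) ->//; rewrite preimage_set0 setI0.
- by rewrite -setI_bigcupr -preimage_bigcup; exact: measurable_cone.
Qed.

HB.instance Definition _ := isMeasure.Build _ _ _ sphere_measure
  sphere0 sphere_ge0 sphere_additive.

End sphere_measure.

Section complex_calculus.
Variable R : realType.

Definition cexpi (a : R) : R[i] := cos a +i* sin a.

Definition cintegral d (T : measurableType d) (mu : {measure set T -> \bar R})
    (D : set T) (f : T -> R[i]) : R[i] :=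
  (\int[mu]_(x in D) complex.Re (f x)) +i* (\int[mu]_(x in D) complex.Im (f x)).

Definition cintegrable d (T : measurableType d)
    (mu : {measure set T -> \bar R}) (D : set T) (f : T -> R[i]) : Prop :=
  mu.-integrable D (fun x => (complex.Re (f x))%:E) /\
  mu.-integrable D (fun x => (complex.Im (f x))%:E).

Definition integral_Rn (m : nat) (f : 'rV[R]_m -> R[i]) : R[i] :=
  cintegral (lebesgue_tuple R m) setT (fun t => f (rV_of t)).

Definition integral_sphere (s : nat) (f : 'rV[R]_s -> R[i]) : R[i] :=
  cintegral (@sphere_measure R s) setT (fun t => f (rV_of t)).

Definition integral_pos (f : R -> R[i]) : R[i] :=
  cintegral (@lebesgue_measure R) `]0, +oo[ f.

Definition cderive1n (k : nat) (g : R -> R[i]) (r : R) : R[i] :=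
  derive1n k (fun u => complex.Re (g u)) r +i*
  derive1n k (fun u => complex.Im (g u)) r.

End complex_calculus.

Section schwartz.
Variables (R : realType) (m : nat).

Definition partials (l : seq 'I_m) (f : 'rV[R]_m -> R) : 'rV[R]_m -> R :=
  foldr (fun i g x => 'D_(delta_mx 0 i) g x) f l.

Definition smooth (f : 'rV[R]_m -> R) : Prop :=
  forall (l : seq 'I_m) (x : 'rV[R]_m), differentiable (partials l f) x.

Definition schwartz_real (f : 'rV[R]_m -> R) : Prop :=
  smooth f /\
  forall (a : 'I_m -> nat) (l : seq 'I_m), exists C : R, forall x : 'rV[R]_m,
    `|(\prod_(i < m) x 0 i ^+ a i) * partials l f x| <= C.

Definition schwartz (f : 'rV[R]_m -> R[i]) : Prop :=
  schwartz_real (fun x => complex.Re (f x)) /\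
  schwartz_real (fun x => complex.Im (f x)).

End schwartz.

Section hyperbolic.
Variable R : realType.
Definition cosh (t : R) : R := (expR t + expR (- t)) / 2.
Definition sinh (t : R) : R := (expR t - expR (- t)) / 2.
Definition tanh (t : R) : R := sinh t / cosh t.
Definition coth (t : R) : R := cosh t / sinh t.
End hyperbolic.

Section fourier.
Variable R : realType.

Definition fourier (m : nat) (f : 'rV[R]_m -> R[i]) (xi : 'rV[R]_m) : R[i] :=
  ((2 * pi) `^ (- (m%:R / 2)))%:C *
  integral_Rn (fun x => f x * cexpi (- dotr x xi)).

Definition partial_fourier (k s : nat) (phi : 'rV[R]_(k + s) -> R[i])
    (x : 'rV[R]_k) (theta : 'rV[R]_s) : R[i] :=
  fourier (fun z => phi (row_mx x z)) theta.

Definition sphere_mean (k s : nat) (phi : 'rV[R]_(k + s) -> R[i])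
    (x : 'rV[R]_k) (r : R) : R[i] :=
  integral_sphere (fun omega => partial_fourier phi x (r *: omega)).

End fourier.

Section kernel.
Variables (R : realType) (n s : nat).

Definition Pform (x : 'rV[R]_(n + n)) : R :=
  \sum_(j < n) (x 0 (lshift n j) ^+ 2 - x 0 (rshift n j) ^+ 2).

Definition qsymbol (xi : 'rV[R]_(n + n)) (theta : 'rV[R]_s) : R[i] :=
  'i%C / ((2 * pi) `^ (n%:R + s%:R / 2))%:C *
  integral_pos (fun t => (1 / (enorm theta * cosh t ^+ n))%:C *
                         cexpi (tanh t / enorm theta * Pform xi)).

Definition K10 (phi : 'rV[R]_(n + n + s) -> R[i]) : R[i] :=
  integral_Rn (fun zeta : 'rV[R]_(n + n + s) =>
    qsymbol (lsubmx zeta) (rsubmx zeta) * fourier phi zeta).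

(* R[i]^o carries the topology of the modulus on R[i]. *)
Definition Pinv_reg (psi : 'rV[R]_(n + n) -> R[i]) (eps : R) : R[i]^o :=
  integral_Rn (fun x => psi x / ((Pform x)%:C - 'i%C * eps%:C) ^+ (n - 1)).

Definition Pinv (psi : 'rV[R]_(n + n) -> R[i]) : R[i] :=
  lim (Pinv_reg psi eps @[eps --> 0^'+]).

Definition phi_t (phi : 'rV[R]_(n + n + s) -> R[i]) (t : R)
    (x : 'rV[R]_(n + n)) : R[i] :=
  integral_pos (fun r =>
    cderive1n (n - 1)
      (fun u => (u ^+ (n + s - 2))%:C * sphere_mean phi x u) r *
    cexpi (- (r / 4 * Pform x * coth t))).

End kernel.

(* Main.v *)
Require Import Defs.
From HB Require Import structures.
From mathcomp Require Import all_boot all_order all_algebra.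
From mathcomp Require Import all_classical all_reals all_analysis.
From mathcomp Require Import measurable_realfun.
From mathcomp Require Import complex zify ring lra.
Import Order.TTheory GRing.Theory Num.Theory.
Import numFieldNormedType.Exports.
Local Open Scope classical_set_scope.
Local Open Scope ring_scope.
Local Open Scope complex_scope.

(** Write l = (coth t)/4, let T phi(x, theta) be the partial Fourier transform
    and chi_t(x) = int_(R^s) |theta|^(n-1) T phi(x, theta) e^(-i l |theta| P(x)) dtheta,
    a Schwartz function. For fixed x, n - 1 integrations by parts in r, followed by polar
    coordinates in R^s, give phi_t = (i l P)^(n-1) chi_t. The factor P^(n-1) cancels the
    singularity of P^-(n-1), so dominated convergence gives
    P^-(n-1)[phi_t] = (i l)^(n-1) int chi_t.
    On the other side, at fixed theta <> 0 and a = (tanh t)/|theta|, Parseval's formula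
      int e^(iaP) F psi = (2a)^-n int e^(-iP/(4a)) psi,
    obtained by damping with e^(-delta |xi|^2) and letting delta tend to 0, is applied to
    psi = T phi(., theta); after Fubini K(phi) becomes
    (i / (2 pi)^(n+s/2)) int_0^oo (2 sinh t)^-n (int chi_t) dt,
    and the two expressions agree. *)

Set Implicit Arguments.
Unset Strict Implicit.

(** * Complex-valued integrals *)

(** Since [|theta|] is not smooth at the origin, chi_t is not the restriction of a Fourier transform
    of a Schwartz function of all variables. It is Schwartz in x all the same: differentiating the
    phase in x only brings down powers of [|theta|], absorbed by the rapid decay of T phi in theta.
    Such facts are proved by exhibiting a class of bounded functions closed under first derivatives
    and multiplication by coordinates, never by estimating iterated derivatives.

    In Parseval's formula P has n positive and n negative squares. The one-dimensional damped
    Gaussians therefore occur in conjugate pairs, only the modulus of their integral enters, and no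
    branch of the square root of [delta - i a] has to be chosen. A quantity conserved in a gives
    that modulus.

    On the right-hand side the integrand in t carries a factor sinh^(-n) t, so its integrability
    near t = 0 is not visible. It is inherited from the other side, where the integrand of the
    symbol is at most cosh^(-n) t / |theta|, integrable against a rapidly decreasing function
    because s >= 2; the two integrands in t are proportional. *)

Section complex_basics.
Variable R : realType.
Implicit Types (z w : R[i]) (a b : R).
Local Notation Re := complex.Re.
Local Notation Im := complex.Im.

(* An R-valued norm: the modulus on R[i] takes its values in R[i]. *)
Definition norm1c z : R := `|Re z| + `|Im z|.

Lemma cReD z w : Re (z + w) = Re z + Re w. Proof. by case: z; case: w. Qed.
Lemma cImD z w : Im (z + w) = Im z + Im w. Proof. by case: z; case: w. Qed.
Lemma cReM z w : Re (z * w) = Re z * Re w - Im z * Im w.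
Proof. by case: z; case: w. Qed.
Lemma cImM z w : Im (z * w) = Re z * Im w + Im z * Re w.
Proof. by case: z => a b; case: w. Qed.
Lemma cReN z : Re (- z) = - Re z. Proof. by case: z. Qed.
Lemma cImN z : Im (- z) = - Im z. Proof. by case: z. Qed.
Lemma cReZ a z : Re (a%:C * z) = a * Re z.
Proof. by rewrite cReM /= mul0r subr0. Qed.
Lemma cImZ a z : Im (a%:C * z) = a * Im z.
Proof. by rewrite cImM /= mul0r addr0. Qed.

Lemma complex_ext z w : Re z = Re w -> Im z = Im w -> z = w.
Proof. by case: z; case: w => a b c d /= -> ->. Qed.

Lemma norm1c_ge0 z : 0 <= norm1c z.
Proof. by rewrite addr_ge0. Qed.
Lemma norm1c0 : norm1c 0 = 0. Proof. by rewrite /norm1c /= normr0 addr0. Qed.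
Lemma norm1cD z w : norm1c (z + w) <= norm1c z + norm1c w.
Proof. by rewrite /norm1c cReD cImD addrACA lerD// ler_normD. Qed.
Lemma norm1cM z w : norm1c (z * w) <= norm1c z * norm1c w.
Proof.
rewrite /norm1c cReM cImM mulrDl !mulrDr -!normrM.
have := ler_normB (Re z * Re w) (Im z * Im w).
have := ler_normD (Re z * Im w) (Im z * Re w).
lra.
Qed.
Lemma norm1cZ a z : norm1c (a%:C * z) = `|a| * norm1c z.
Proof. by rewrite /norm1c cReZ cImZ !normrM mulrDr. Qed.
Lemma Re_le_norm1c z : `|Re z| <= norm1c z. Proof. by rewrite lerDl. Qed.
Lemma Im_le_norm1c z : `|Im z| <= norm1c z. Proof. by rewrite lerDr. Qed.
Lemma norm1cX z n : norm1c (z ^+ n) <= norm1c z ^+ n.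
Proof.
elim: n => [|n IH]; first by rewrite !expr0 /norm1c /= normr0 normr1 addr0.
rewrite !exprS; apply: le_trans (norm1cM _ _) _.
by rewrite ler_wpM2l ?norm1c_ge0.
Qed.
Lemma norm1c_cexpi a : norm1c (cexpi a) <= 2.
Proof.
rewrite /norm1c /=.
have := @cos2Dsin2 _ a; set c := cos a; set s := sin a => cs.
have : `|c| <= 1.
  by rewrite -(@expr_le1 _ 2)// -normrX ger0_norm ?sqr_ge0// -cs lerDl sqr_ge0.
have : `|s| <= 1.
  by rewrite -(@expr_le1 _ 2)// -normrX ger0_norm ?sqr_ge0// -cs lerDr sqr_ge0.
lra.
Qed.

Lemma cexpiD a b : cexpi (a + b) = cexpi a * cexpi b.
Proof. by apply: complex_ext; rewrite /= ?cosD ?sinD//; lra. Qed.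
Lemma cexpi0 : cexpi (0 : R) = 1.
Proof. by apply: complex_ext; rewrite /= ?cos0 ?sin0. Qed.
Lemma cexpi_sum (I : Type) (r : seq I) (P : pred I) (F : I -> R) :
  cexpi (\sum_(i <- r | P i) F i) = \prod_(i <- r | P i) cexpi (F i).
Proof. exact: (big_morph _ cexpiD cexpi0). Qed.

Lemma realC_M a b : (a * b)%:C = a%:C * b%:C. Proof. by rewrite rmorphM. Qed.
Lemma realC_D a b : (a + b)%:C = a%:C + b%:C. Proof. by rewrite rmorphD. Qed.
Lemma realC_X a n : (a ^+ n)%:C = a%:C ^+ n. Proof. by rewrite rmorphXn. Qed.
Lemma realC_V a : (a^-1)%:C = a%:C^-1. Proof. by rewrite fmorphV. Qed.
End complex_basics.

Section cmeasurable.
Variables (R : realType) (d : measure_display) (T : measurableType d).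
Local Notation Re := complex.Re.
Local Notation Im := complex.Im.
Implicit Types (f g : T -> R[i]) (h : T -> R).

Definition cmeasurable f : Prop :=
  measurable_fun setT (fun x => Re (f x)) /\
  measurable_fun setT (fun x => Im (f x)).

Lemma cmeasurable_cst c : cmeasurable (fun=> c).
Proof. by split; exact: measurable_cst. Qed.

Lemma cmeasurableD f g : cmeasurable f -> cmeasurable g ->
  cmeasurable (fun x => f x + g x).
Proof.
move=> [fr fi] [gr gi]; split.
- by under eq_fun do rewrite cReD; exact: measurable_funD.
- by under eq_fun do rewrite cImD; exact: measurable_funD.
Qed.

Lemma cmeasurableM f g : cmeasurable f -> cmeasurable g ->
  cmeasurable (fun x => f x * g x).
Proof.
move=> [fr fi] [gr gi]; split.
- under eq_fun do rewrite cReM.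
  by apply: measurable_funB; exact: measurable_funM.
- under eq_fun do rewrite cImM.
  by apply: measurable_funD; exact: measurable_funM.
Qed.

Lemma cmeasurable_real h : measurable_fun setT h ->
  cmeasurable (fun x => (h x)%:C).
Proof. by move=> mh; split => //=; exact: measurable_cst. Qed.

Lemma cmeasurable_cexpi h : measurable_fun setT h ->
  cmeasurable (fun x => cexpi (h x)).
Proof.
move=> mh; split => /=.
- apply: (@measurableT_comp _ _ _ _ _ _ (@cos R)) => //.
  by apply: continuous_measurable_fun; exact: continuous_cos.
- apply: (@measurableT_comp _ _ _ _ _ _ (@sin R)) => //.
  by apply: continuous_measurable_fun; exact: continuous_sin.
Qed.

Lemma measurable_norm1c f : cmeasurable f ->
  measurable_fun setT (fun x => norm1c (f x)).
Proof.
by move=> [fr fi]; apply: measurable_funD; exact: measurableT_comp.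
Qed.

End cmeasurable.

Lemma cmeasurable_comp (R : realType) d1 d2 (T1 : measurableType d1)
  (T2 : measurableType d2) (f : T2 -> R[i]) (g : T1 -> T2) :
  cmeasurable f -> measurable_fun setT g -> cmeasurable (fun x => f (g x)).
Proof.
move=> [fr fi] mg; split.
- exact: (measurableT_comp fr mg).
- exact: (measurableT_comp fi mg).
Qed.

(** * Dominated real integrals *)

Section real_integral.
Variables (R : realType) (d : measure_display) (T : measurableType d).
Variable mu : {measure set T -> \bar R}.
Implicit Types (f g h : T -> R).

Lemma integrable_dom f g : measurable_fun setT f ->
  mu.-integrable setT (EFin \o g) -> (forall x, `|f x| <= g x) ->
  mu.-integrable setT (EFin \o f).
Proof.
move=> mf ig fg; apply: le_integrable ig => //; first exact/measurable_EFinP.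
by move=> x _ /=; rewrite lee_fin (le_trans (fg x))// ler_norm.
Qed.

Lemma Rintegral_dom f g : measurable_fun setT f ->
  mu.-integrable setT (EFin \o g) -> (forall x, `|f x| <= g x) ->
  `|\int[mu]_x f x| <= \int[mu]_x g x.
Proof.
move=> mf ig fg; have If := integrable_dom mf ig fg.
apply: le_trans (le_normr_Rintegral measurableT If) _.
apply: le_Rintegral => //.
exact: integrable_norm.
Qed.

Lemma dominated_cvg_Rintegral (F : nat -> T -> R) f g :
  (forall n, measurable_fun setT (F n)) -> measurable_fun setT f ->
  {ae mu, forall x, F n x @[n --> \oo] --> f x} ->
  mu.-integrable setT (EFin \o g) ->
  (forall n x, `|F n x| <= g x) ->
  (\int[mu]_x F n x) @[n --> \oo] --> \int[mu]_x f x.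
Proof.
move=> mF mf cF ig Fg.
have c1 : {ae mu, forall x, [set: T] x -> (F n x)%:E @[n --> \oo] --> (f x)%:E}.
  by apply: filterS cF => x cx _; apply: cvg_EFin cx; exact: nearW.
have c2 : {ae mu, forall x n, [set: T] x -> (`|(F n x)%:E| <= (EFin \o g) x)%E}.
  by apply: aeW => x n _; rewrite lee_fin.
have [If _ cvgF] := dominated_convergence measurableT
  (fun n => (measurable_EFinP _ _).2 (mF n)) ((measurable_EFinP _ _).2 mf)
  c1 ig c2.
apply: fine_cvg.
rewrite /Rintegral fineK//.
exact: integrable_fin_num.
Qed.

Lemma is_derive_Rintegral (f df : R -> T -> R) (G : T -> R) (r : R) :
  (forall x, mu.-integrable setT (EFin \o f x)) ->
  (forall (x : R) (y : T), is_derive x 1 (f ^~ y) (df x y)) ->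
  mu.-integrable setT (EFin \o G) ->
  (forall (x : R) (y : T), `|df x y| <= G y) ->
  is_derive r 1 (fun r => \int[mu]_y f r y) (\int[mu]_y df r y).
Proof.
move=> If dfE IG dfG.
(* Any open interval around [r] would do, since the bound [G] is uniform in the parameter. *)
have I_r : `]r - 1, r + 1[%classic r by rewrite /= in_itv /=; lra.
have G0 y : 0 <= G y by apply: le_trans (normr_ge0 _) (dfG r y).
have pE x y : partial1of2 f x y = df x y.
  by rewrite /partial1of2 derive1E; have := dfE x y; move/@derive_val.
have Gub x y : `|partial1of2 f x y| <= G y by rewrite pE.
have der : derivable (fun r => \int[mu]_y f r y) r 1.
  apply: (derivable_under_integral measurableT I_r _ _ G0 IG) => // x y _ _.
apply: DeriveDef => //.
rewrite -derive1E (differentiation_under_integral measurableT I_r _ _ G0 IG)//.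
by apply: eq_Rintegral => y _; rewrite pE.
Qed.

End real_integral.

(** * Fubini for functions dominated by a product *)

Section real_fubini.
Variables (R : realType) (d1 d2 : measure_display).
Variables (T1 : measurableType d1) (T2 : measurableType d2).
Variable m1 : {sigma_finite_measure set T1 -> \bar R}.
Variable m2 : {sigma_finite_measure set T2 -> \bar R}.
Implicit Types f : T1 * T2 -> R.

(** Tonelli applies to the positive and to the negative part, so no integrability is involved:
    [fine] keeps the difference measurable even where the inner integral is infinite. *)
Lemma measurable_Rintegral f : measurable_fun setT f ->
  measurable_fun setT (fun x => \int[m2]_y f (x, y)).
Proof.
move=> mf; have mEf : measurable_fun setT (EFin \o f) by exact/measurable_EFinP.
apply: (@measurableT_comp _ _ _ _ _ _ (@fine R)) => //.
under eq_fun do rewrite integralE.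
apply: emeasurable_funB.
- have := @measurable_fun_fubini_tonelli_F _ _ T1 T2 R m2 ((EFin \o f)^\+)%E
    (measurable_funepos mEf) (funepos_ge0 _).
  set u := fubini_F _ _; rewrite (_ : u = fun x => (\int[m2]_y
    (fun y => (f (x, y))%:E)^\+ y)%E)//.
  by apply/funext => x; apply: eq_integral => y _; rewrite !funeposE.
- have := @measurable_fun_fubini_tonelli_F _ _ T1 T2 R m2 ((EFin \o f)^\-)%E
    (measurable_funeneg mEf) (funeneg_ge0 _).
  set u := fubini_F _ _; rewrite (_ : u = fun x => (\int[m2]_y
    (fun y => (f (x, y))%:E)^\- y)%E)//.
  by apply/funext => x; apply: eq_integral => y _; rewrite !funenegE.
Qed.

Variables (f : T1 * T2 -> R) (g1 : T1 -> R) (g2 : T2 -> R).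
Hypothesis mf : measurable_fun setT f.
Hypothesis ig1 : m1.-integrable setT (EFin \o g1).
Hypothesis ig2 : m2.-integrable setT (EFin \o g2).
Hypothesis fg : forall x y, `|f (x, y)| <= g1 x * g2 y.

Let mf1 x : measurable_fun setT (fun y => f (x, y)).
Proof. by apply: measurableT_comp. Qed.
Let mf2 y : measurable_fun setT (fun x => f (x, y)).
Proof. by apply: measurableT_comp. Qed.

Lemma integrable_section1 x : m2.-integrable setT (EFin \o (fun y => f (x, y))).
Proof.
apply: (@integrable_dom _ _ _ _ _ (fun y => g1 x * g2 y)) => //.
exact: (integrableZl measurableT (g1 x) ig2).
Qed.

Lemma integrable_section2 y : m1.-integrable setT (EFin \o (fun x => f (x, y))).
Proof.
apply: (@integrable_dom _ _ _ _ _ (fun x => g1 x * g2 y)) => //.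
exact: (integrableZr measurableT (g2 y) ig1).
Qed.

Lemma integrable_Rintegral1 :
  m1.-integrable setT (EFin \o (fun x => \int[m2]_y f (x, y))).
Proof.
apply: (@integrable_dom _ _ _ _ _ (fun x => g1 x * \int[m2]_y g2 y)).
- exact: measurable_Rintegral.
- exact: (integrableZr measurableT (\int[m2]_y g2 y) ig1).
- move=> x; rewrite -RintegralZl//; apply: Rintegral_dom => //.
  exact: (integrableZl measurableT (g1 x) ig2).
Qed.

(** Tonelli for [|f|]: the inner integral is at most [g1 x] times the integral of [g2], and this is
    integrable in [x]. *)
Lemma integrable_product : (m1 \x m2)%E.-integrable setT (EFin \o f).
Proof.
have mEf : measurable_fun setT (EFin \o f) by exact/measurable_EFinP.
apply/(integrable12ltyP m1 m2 mEf).
apply: (@le_lt_trans _ _ (\int[m1]_x (g1 x * \int[m2]_y g2 y)%:E)%E).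
  apply: ge0_le_integral => //.
  - by move=> x _; apply: integral_ge0.
  - have := @measurable_fun_fubini_tonelli_F _ _ T1 T2 R m2
      (fun z => `|(f z)%:E|%E) (measurableT_comp (@abse_measurable _ _) mEf).
    by apply => x; rewrite abse_ge0.
  - apply/measurable_EFinP; apply: measurable_funM => //.
    by have /integrableP[/measurable_EFinP] := ig1.
  - move=> x _.
    rewrite -RintegralZl// /Rintegral fineK; last first.
      apply: integrable_fin_num => //.
      exact: (integrableZl measurableT (g1 x) ig2).
    apply: ge0_le_integral => //.
    + by apply: measurableT_comp => //; apply/measurable_EFinP.
    + apply/measurable_EFinP; apply: measurable_funM => //.
      by have /integrableP[/measurable_EFinP] := ig2.
    + by move=> y _; rewrite lee_fin.
have := integrableZr measurableT (\int[m2]_y g2 y) ig1.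
move=> /(integrable_fin_num measurableT) h.
by rewrite ltey_eq (_ : _ \is a fin_num).
Qed.

Lemma Rintegral_product12 :
  \int[(m1 \x m2)%E]_z f z = \int[m1]_x \int[m2]_y f (x, y).
Proof.
rewrite /Rintegral; congr fine.
rewrite -(integral12_prod_meas1 integrable_product).
apply: eq_integral => x _; rewrite /= fineK//.
by apply: (integrable_fin_num measurableT); exact: integrable_section1.
Qed.

Lemma Rintegral_product21 :
  \int[(m1 \x m2)%E]_z f z = \int[m2]_y \int[m1]_x f (x, y).
Proof.
rewrite /Rintegral; congr fine.
rewrite -(integral21_prod_meas1 integrable_product).
apply: eq_integral => y _; rewrite /= fineK//.
by apply: (integrable_fin_num measurableT); exact: integrable_section2.
Qed.

End real_fubini.

(** * Derivatives of functions of one real variable *)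

Section real_derivative.
Variable R : realType.
Implicit Types (f g : R -> R) (r : R).

Lemma is_derive_add f g r (df dg : R) : is_derive r (1 : R) f df ->
  is_derive r (1 : R) g dg -> is_derive r (1 : R) (fun x => f x + g x) (df + dg).
Proof. by move=> *; exact: is_deriveD. Qed.

Lemma is_derive_sub f g r (df dg : R) : is_derive r (1 : R) f df ->
  is_derive r (1 : R) g dg -> is_derive r (1 : R) (fun x => f x - g x) (df - dg).
Proof. by move=> *; exact: is_deriveB. Qed.

Lemma is_derive_mul f g r (df dg : R) : is_derive r (1 : R) f df ->
  is_derive r (1 : R) g dg ->
  is_derive r (1 : R) (fun x => f x * g x) (df * g r + f r * dg).
Proof.
move=> Hf Hg; have H := is_deriveM Hf Hg.
apply: (is_derive_eq (f := f * g) H).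
by rewrite /GRing.scale /=; lra.
Qed.

Lemma is_derive_chain f g r (df dg : R) : is_derive (g r) (1 : R) f df ->
  is_derive r (1 : R) g dg ->
  is_derive r (1 : R) (fun x => f (g x)) (df * dg).
Proof. by move=> Hf Hg; exact: (is_derive1_comp Hf Hg). Qed.

Lemma is_derive_exp n r :
  is_derive r (1 : R) (fun x => x ^+ n) (n%:R * r ^+ n.-1).
Proof.
have H := is_deriveX n (is_derive_id r (1 : R)).
rewrite (_ : (fun _ => _) = (id : R -> R) ^+ n).
  by apply: (is_derive_eq H); rewrite /GRing.scale /= mulr1.
by apply/funext => x; rewrite exprfctE.
Qed.

End real_derivative.

Section complex_derivative.
Variable R : realType.
Local Notation Re := complex.Re.
Local Notation Im := complex.Im.
Implicit Types (f g : R -> R[i]) (h : R -> R).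

Definition is_cderive f (r : R) (v : R[i]) : Prop :=
  is_derive r (1 : R) (fun x => Re (f x)) (Re v) /\
  is_derive r (1 : R) (fun x => Im (f x)) (Im v).

Lemma is_cderive_real h (r dh : R) : is_derive r (1 : R) h dh ->
  is_cderive (fun x => (h x)%:C) r dh%:C.
Proof. by move=> H; split => //=; exact: is_derive_cst. Qed.

Lemma is_cderive_cst (c : R[i]) (r : R) : is_cderive (fun=> c) r 0.
Proof. by split; exact: is_derive_cst. Qed.

Lemma is_cderiveD f g (r : R) (df dg : R[i]) :
  is_cderive f r df -> is_cderive g r dg ->
  is_cderive (fun x => f x + g x) r (df + dg).
Proof.
move=> [f1 f2] [g1 g2]; split.
- by under eq_fun do rewrite cReD; rewrite cReD; exact: is_deriveD.
- by under eq_fun do rewrite cImD; rewrite cImD; exact: is_deriveD.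
Qed.

Lemma is_cderiveM f g (r : R) (df dg : R[i]) :
  is_cderive f r df -> is_cderive g r dg ->
  is_cderive (fun x => f x * g x) r (df * g r + f r * dg).
Proof.
move=> [f1 f2] [g1 g2]; split.
- under eq_fun do rewrite cReM.
  apply: (is_derive_eq (is_derive_sub (is_derive_mul f1 g1) (is_derive_mul f2 g2))).
  by rewrite cReD !cReM /= /GRing.scale/=; lra.
- under eq_fun do rewrite cImM.
  apply: (is_derive_eq (is_derive_add (is_derive_mul f1 g2) (is_derive_mul f2 g1))).
  by rewrite cImD !cImM /= /GRing.scale/=; lra.
Qed.

Lemma is_cderive_cexpi h (r dh : R) : is_derive r (1 : R) h dh ->
  is_cderive (fun x => cexpi (h x)) r ('i%C * dh%:C * cexpi (h r)).
Proof.
move=> H; split => /=.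
- apply: (is_derive_eq (is_derive_chain (is_derive_cos _) H)).
  by rewrite /= mul0r mul1r; lra.
- apply: (is_derive_eq (is_derive_chain (is_derive_sin _) H)).
  by rewrite /= mul0r mul1r; lra.
Qed.

Lemma is_cderive_eq f (r : R) (u v : R[i]) :
  is_cderive f r u -> u = v -> is_cderive f r v.
Proof. by move=> ? <-. Qed.

Lemma is_cderive_cexpi_linear (a : R) (r : R) :
  is_cderive (fun x => cexpi (x * a)) r ('i%C * a%:C * cexpi (r * a)).
Proof.
apply: is_cderive_cexpi.
apply: (is_derive_eq (is_derive_mul (is_derive_id _ _) (is_derive_cst _ _ _))).
by rewrite mulr0 addr0 mul1r.
Qed.

End complex_derivative.

(** * Linearity, estimates and limits of complex integrals *)

Section complex_integral.
Variables (R : realType) (d : measure_display) (T : measurableType d).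
Variable mu : {measure set T -> \bar R}.
Local Notation Re := complex.Re.
Local Notation Im := complex.Im.
Implicit Types (f g : T -> R[i]) (h : T -> R).

Lemma cintegrable_dom f h : cmeasurable f ->
  mu.-integrable setT (EFin \o h) -> (forall x, norm1c (f x) <= h x) ->
  cintegrable mu setT f.
Proof.
move=> [fr fi] ih fh; split.
- apply: (integrable_dom fr ih) => x.
  exact: le_trans (Re_le_norm1c _) (fh x).
- apply: (integrable_dom fi ih) => x.
  exact: le_trans (Im_le_norm1c _) (fh x).
Qed.

Lemma cintegrable_cmeasurable f : cintegrable mu setT f -> cmeasurable f.
Proof.
move=> [/integrableP[/measurable_EFinP m1 _] /integrableP[/measurable_EFinP m2 _]].
by split.
Qed.

Lemma cintegrable_norm1c f : cintegrable mu setT f ->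
  mu.-integrable setT (EFin \o (fun x => norm1c (f x))).
Proof.
move=> [f1 f2].
have := integrableD measurableT (integrable_norm f1)
  (integrable_norm f2).
exact.
Qed.

Lemma cintegralD f g : cintegrable mu setT f -> cintegrable mu setT g ->
  cintegral mu setT (fun x => f x + g x) =
  cintegral mu setT f + cintegral mu setT g.
Proof.
move=> [f1 f2] [g1 g2]; apply: complex_ext; rewrite ?cReD ?cImD /=.
- by rewrite -RintegralD//; apply: eq_Rintegral => x _; rewrite cReD.
- by rewrite -RintegralD//; apply: eq_Rintegral => x _; rewrite cImD.
Qed.

Lemma cintegrableD f g : cintegrable mu setT f -> cintegrable mu setT g ->
  cintegrable mu setT (fun x => f x + g x).
Proof.
move=> [f1 f2] [g1 g2]; split.
- by under eq_fun do rewrite cReD; exact: (integrableD measurableT f1 g1).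
- by under eq_fun do rewrite cImD; exact: (integrableD measurableT f2 g2).
Qed.

Lemma cintegrableZ (c : R[i]) f : cintegrable mu setT f ->
  cintegrable mu setT (fun x => c * f x).
Proof.
move=> [f1 f2]; split.
- under eq_fun do rewrite cReM.
  exact: (integrableB measurableT (integrableZl measurableT (Re c) f1)
    (integrableZl measurableT (Im c) f2)).
- under eq_fun do rewrite cImM.
  exact: (integrableD measurableT (integrableZl measurableT (Re c) f2)
    (integrableZl measurableT (Im c) f1)).
Qed.

Lemma cintegralZ (c : R[i]) f : cintegrable mu setT f ->
  cintegral mu setT (fun x => c * f x) = c * cintegral mu setT f.
Proof.
move=> [f1 f2]; apply: complex_ext; rewrite ?cReM ?cImM /=.
- rewrite -!RintegralZl// -RintegralB//.
  + by apply: eq_Rintegral => x _; rewrite cReM.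
  + exact: (integrableZl measurableT (Re c) f1).
  + exact: (integrableZl measurableT (Im c) f2).
- rewrite -!RintegralZl// -RintegralD//.
  + by apply: eq_Rintegral => x _; rewrite cImM.
  + exact: (integrableZl measurableT (Re c) f2).
  + exact: (integrableZl measurableT (Im c) f1).
Qed.

Lemma cintegral0 : cintegral mu setT (fun=> 0) = 0.
Proof. by rewrite /cintegral /= /Rintegral integral0. Qed.

Lemma cintegrable0 : cintegrable mu setT (fun=> 0).
Proof. by split; exact: integrable0. Qed.

Lemma cintegral_sum (I : Type) (s : seq I) (F : I -> T -> R[i]) :
  (forall i, cintegrable mu setT (F i)) ->
  cintegral mu setT (fun x => \sum_(i <- s) F i x) =
  \sum_(i <- s) cintegral mu setT (F i) /\
  cintegrable mu setT (fun x => \sum_(i <- s) F i x).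
Proof.
move=> iF; elim: s => [|i s [IH1 IH2]].
  under eq_fun do rewrite big_nil.
  by rewrite cintegral0 big_nil; split => //; exact: cintegrable0.
under eq_fun do rewrite big_cons.
rewrite cintegralD// IH1 big_cons; split => //.
exact: cintegrableD.
Qed.

(** For the sum of the absolute values of the two components this is the real triangle inequality
    applied twice; the modulus would call for a rotation of the integral. *)
Lemma norm1c_cintegral f h : cmeasurable f ->
  mu.-integrable setT (EFin \o h) -> (forall x, norm1c (f x) <= h x) ->
  norm1c (cintegral mu setT f) <= \int[mu]_x h x.
Proof.
move=> mf ih fh.
have [i1 i2] := cintegrable_dom mf ih fh.
apply: (@le_trans _ _ (\int[mu]_x norm1c (f x))); last first.
  apply: le_Rintegral => //.
  exact: cintegrable_norm1c.
rewrite /norm1c /=.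
rewrite RintegralD//; [|exact: integrable_norm|exact: integrable_norm].
by apply: lerD; apply: le_normr_Rintegral.
Qed.

Lemma is_cderive_cintegral (f df : R -> T -> R[i]) h (r : R) :
  (forall x, cintegrable mu setT (f x)) ->
  (forall (x : R) (y : T), is_cderive (f ^~ y) x (df x y)) ->
  mu.-integrable setT (EFin \o h) ->
  (forall (x : R) (y : T), norm1c (df x y) <= h y) ->
  is_cderive (fun r => cintegral mu setT (f r)) r (cintegral mu setT (df r)).
Proof.
move=> If dfE Ih dfh; split => /=.
- apply: (is_derive_Rintegral (f := fun x y => Re (f x y))
    (df := fun x y => Re (df x y)) r _ _ Ih).
  + by move=> x; have [] := If x.
  + by move=> x y; have [] := dfE x y.
  + by move=> x y; apply: le_trans (dfh x y); exact: Re_le_norm1c.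
- apply: (is_derive_Rintegral (f := fun x y => Im (f x y))
    (df := fun x y => Im (df x y)) r _ _ Ih).
  + by move=> x; have [] := If x.
  + by move=> x y; have [] := dfE x y.
  + by move=> x y; apply: le_trans (dfh x y); exact: Im_le_norm1c.
Qed.

(** Working by components keeps real dominated convergence directly applicable; [cvg_complex] makes
    the passage to the topology of the modulus. *)
Definition ccvg (u : nat -> R[i]) (l : R[i]) : Prop :=
  (Re (u n) @[n --> \oo] --> Re l) /\ (Im (u n) @[n --> \oo] --> Im l).

Lemma dominated_ccvg (F : nat -> T -> R[i]) f h :
  (forall n, cmeasurable (F n)) -> cmeasurable f ->
  {ae mu, forall x, ccvg (F ^~ x) (f x)} ->
  mu.-integrable setT (EFin \o h) ->
  (forall n x, norm1c (F n x) <= h x) ->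
  ccvg (fun n => cintegral mu setT (F n)) (cintegral mu setT f).
Proof.
move=> mF [f1 f2] cF ih Fh; split => /=.
- apply: (@dominated_cvg_Rintegral _ _ _ _ (fun n x => Re (F n x)) _ h) => //.
  + by move=> n; have [] := mF n.
  + by apply: filterS cF => x [].
  + by move=> n x; apply: le_trans (Fh n x); exact: Re_le_norm1c.
- apply: (@dominated_cvg_Rintegral _ _ _ _ (fun n x => Im (F n x)) _ h) => //.
  + by move=> n; have [] := mF n.
  + by apply: filterS cF => x [].
  + by move=> n x; apply: le_trans (Fh n x); exact: Im_le_norm1c.
Qed.

End complex_integral.

Lemma cintegral_mkcond (R : realType) d (T : measurableType d)
    (mu : {measure set T -> \bar R}) (D : set T) (f : T -> R[i]) :
  cintegral mu D f =
  cintegral mu setT (fun x => if x \in D then f x else 0).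
Proof.
by apply: complex_ext => /=; rewrite Rintegral_mkcond; apply: eq_Rintegral => x _;
  rewrite patchE; case: ifP.
Qed.

Lemma cintegrable_mkcond (R : realType) d (T : measurableType d)
    (mu : {measure set T -> \bar R}) (D : set T) (f : T -> R[i]) :
  measurable D ->
  cintegrable mu setT (fun x => if x \in D then f x else 0) ->
  cintegrable mu D f.
Proof.
move=> mD [H1 H2]; split.
- apply/(integrable_mkcond _ mD); move: H1; congr (mu.-integrable _ _).
  by apply/funext => x; rewrite patchE; case: ifP.
- apply/(integrable_mkcond _ mD); move: H2; congr (mu.-integrable _ _).
  by apply/funext => x; rewrite patchE; case: ifP.
Qed.

Section complex_fubini.
Variables (R : realType) (d1 d2 : measure_display).
Variables (T1 : measurableType d1) (T2 : measurableType d2).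
Variable m1 : {sigma_finite_measure set T1 -> \bar R}.
Variable m2 : {sigma_finite_measure set T2 -> \bar R}.

Lemma cmeasurable_cintegral (f : T1 * T2 -> R[i]) : cmeasurable f ->
  cmeasurable (fun x => cintegral m2 setT (fun y => f (x, y))).
Proof.
move=> [f1 f2]; split => /=.
- exact: (measurable_Rintegral m2 f1).
- exact: (measurable_Rintegral m2 f2).
Qed.

Variables (f : T1 * T2 -> R[i]) (g1 : T1 -> R) (g2 : T2 -> R).
Hypothesis mf : cmeasurable f.
Hypothesis ig1 : m1.-integrable setT (EFin \o g1).
Hypothesis ig2 : m2.-integrable setT (EFin \o g2).
Hypothesis fg : forall x y, norm1c (f (x, y)) <= g1 x * g2 y.

Let fg1 x y : `|complex.Re (f (x, y))| <= g1 x * g2 y.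
Proof. exact: le_trans (Re_le_norm1c _) (fg x y). Qed.
Let fg2 x y : `|complex.Im (f (x, y))| <= g1 x * g2 y.
Proof. exact: le_trans (Im_le_norm1c _) (fg x y). Qed.

Lemma cintegrable_cintegral1 :
  cintegrable m1 setT (fun x => cintegral m2 setT (fun y => f (x, y))).
Proof.
by split; [exact: (integrable_Rintegral1 mf.1 ig1 ig2 fg1)
          |exact: (integrable_Rintegral1 mf.2 ig1 ig2 fg2)].
Qed.

Lemma cintegral_product12 : cintegral (m1 \x m2)%E setT f =
  cintegral m1 setT (fun x => cintegral m2 setT (fun y => f (x, y))).
Proof.
apply: complex_ext => /=.
- exact: (Rintegral_product12 mf.1 ig1 ig2 fg1).
- exact: (Rintegral_product12 mf.2 ig1 ig2 fg2).
Qed.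

Lemma cFubini :
  cintegral m1 setT (fun x => cintegral m2 setT (fun y => f (x, y))) =
  cintegral m2 setT (fun y => cintegral m1 setT (fun x => f (x, y))).
Proof.
rewrite -cintegral_product12; apply: complex_ext => /=.
- exact: (Rintegral_product21 mf.1 ig1 ig2 fg1).
- exact: (Rintegral_product21 mf.2 ig1 ig2 fg2).
Qed.

End complex_fubini.

(** * Lebesgue measure on R^m *)

Section pushforward_integral.
Variables (R : realType) (d1 d2 : measure_display).
Variables (X : measurableType d1) (Y : measurableType d2).
Variables (phi : X -> Y) (mphi : measurable_fun setT phi).
Variables (mu : {measure set X -> \bar R}) (nu : {measure set Y -> \bar R}).
Hypothesis nuE : forall A, measurable A -> nu A = pushforward mu phi A.

Lemma ge0_integral_pushforwardT (f : Y -> \bar R) : measurable_fun setT f ->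
  (forall y, 0 <= f y)%E ->
  (\int[nu]_y f y = \int[mu]_x f (phi x))%E.
Proof.
move=> mf f0.
transitivity (\int[pushforward mu phi]_y f y)%E; last first.
  by rewrite (ge0_integral_pushforward mphi)//= preimage_setT.
have mphi' := mphi.
by apply: (eq_measure_integral (m1 := nu) (pushforward mu phi)) => A mA _; exact: nuE.
Qed.

Lemma integral_pushforwardT (f : Y -> \bar R) : measurable_fun setT f ->
  (\int[nu]_y f y = \int[mu]_x f (phi x))%E.
Proof.
move=> mf; rewrite [LHS]integralE [RHS]integralE.
rewrite (ge0_integral_pushforwardT (measurable_funepos mf) (funepos_ge0 _)).
rewrite (ge0_integral_pushforwardT (measurable_funeneg mf) (funeneg_ge0 _)).
by congr (_ - _)%E; apply: eq_integral => x _; rewrite ?funeposE ?funenegE.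
Qed.

Lemma integrable_pushforwardE (f : Y -> \bar R) : measurable_fun setT f ->
  nu.-integrable setT f = mu.-integrable setT (f \o phi).
Proof.
move=> mf; apply/idP/idP => /integrableP[_ H]; apply/integrableP; split => //.
- exact: measurableT_comp.
- by move: H; rewrite ge0_integral_pushforwardT//; exact: measurableT_comp.
- by rewrite ge0_integral_pushforwardT//; exact: measurableT_comp.
Qed.

Lemma cintegral_pushforward (f : Y -> R[i]) : cmeasurable f ->
  cintegral nu setT f = cintegral mu setT (f \o phi).
Proof.
move=> [f1 f2]; rewrite /cintegral /Rintegral.
by rewrite !integral_pushforwardT//; exact/measurable_EFinP.
Qed.

End pushforward_integral.

(** * Lebesgue measure on tuples as a product *)

Section tuple_measure.
Variable R : realType.
Local Notation leb := (@lebesgue_measure R).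
Local Notation lebt := (lebesgue_tuple R).

Lemma integral_tupleS m (f : tupleR R m.+1 -> \bar R) : measurable_fun setT f ->
  (forall t, 0 <= f t)%E ->
  (\int[lebt m.+1]_t f t = \int[leb]_x \int[lebt m]_t f (cons_pair (x, t)))%E.
Proof.
move=> mf f0.
rewrite (ge0_integral_pushforwardT (@measurable_cons_pair R m)
  (mu := (leb \x lebt m)%E))//.
rewrite fubini_tonelli1//.
by apply: (measurableT_comp mf); exact: measurable_cons_pair.
Qed.

Lemma integrable_tupleS m (f : tupleR R m.+1 -> R) : measurable_fun setT f ->
  (leb \x lebt m)%E.-integrable setT (EFin \o (f \o @cons_pair R m)) ->
  (lebt m.+1).-integrable setT (EFin \o f).
Proof.
move=> mf H; rewrite (integrable_pushforwardE (@measurable_cons_pair R m)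
  (mu := (leb \x lebt m)%E))//.
exact/measurable_EFinP.
Qed.

Lemma cintegral_tupleS m (f : tupleR R m.+1 -> R[i]) : cmeasurable f ->
  cintegral (lebt m.+1) setT f =
  cintegral (leb \x lebt m)%E setT (fun p => f (cons_pair p)).
Proof.
by move=> mf; rewrite (cintegral_pushforward (@measurable_cons_pair R m)
  (mu := (leb \x lebt m)%E)).
Qed.

Lemma integral_tuple0 (f : tupleR R 0 -> \bar R) : measurable_fun setT f ->
  (\int[lebt 0]_t f t = f [tuple])%E.
Proof. by move=> mf; rewrite integral_dirac// diracT mul1e. Qed.

Definition cat_pair k s (p : tupleR R k * tupleR R s) : tupleR R (k + s) :=
  [tuple of p.1 ++ p.2].

Lemma measurable_cat_pair k s : measurable_fun setT (@cat_pair k s).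
Proof.
apply/measurable_fun_tnthP => i; have [j|j] := split_ordP i => ->.
- rewrite (_ : _ \o _ = (fun p => tnth p.1 j)).
    exact: (measurableT_comp (measurable_tnth j) measurable_fst).
  apply/funext => p /=; rewrite /cat_pair.
  by rewrite (tnth_nth 0) /= nth_cat size_tuple ltn_ord -tnth_nth.
- rewrite (_ : _ \o _ = (fun p => tnth p.2 j)).
    exact: (measurableT_comp (measurable_tnth j) measurable_snd).
  apply/funext => p /=; rewrite /cat_pair.
  by rewrite (tnth_nth 0) /= nth_cat size_tuple ltnNge leq_addr /= addKn -tnth_nth.
Qed.

(** Tonelli comes first, peeling off one coordinate at a time. Applied to indicators it identifies
    the two measures in [lebesgue_tuple_cat], and complex integrals then transfer by pushforward. *)
Lemma integral_tuple_cat k s (f : tupleR R (k + s) -> \bar R) :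
  measurable_fun setT f -> (forall t, 0 <= f t)%E ->
  (\int[lebt (k + s)]_t f t =
   \int[lebt k]_a \int[lebt s]_b f (cat_pair (a, b)))%E.
Proof.
elim: k f => [|k IH] f mf f0.
  rewrite integral_tuple0; last first.
    apply: (@measurable_fun_fubini_tonelli_F _ _ _ _ R (lebt s)
      (fun p => f (@cat_pair 0 s p))) => //.
    by apply: (measurableT_comp mf); exact: measurable_cat_pair.
  apply: eq_integral => t _; congr f; exact: val_inj.
have mfc : measurable_fun setT (fun p => f (@cat_pair k.+1 s p)).
  by apply: (measurableT_comp mf); exact: measurable_cat_pair.
rewrite (@integral_tupleS (k + s))// [RHS]integral_tupleS//; first last.
- by move=> t; apply: integral_ge0.
- exact: (@measurable_fun_fubini_tonelli_F _ _ _ _ R (lebt s)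
      (fun p => f (@cat_pair k.+1 s p))).
apply: eq_integral => x _; rewrite IH//.
- apply: eq_integral => a _; apply: eq_integral => b _; congr f; exact: val_inj.
- apply: (measurableT_comp mf); apply: (measurableT_comp (@measurable_cons_pair R _)).
  exact: measurable_fun_pair.
Qed.

Lemma lebesgue_tuple_cat k s (A : set (tupleR R (k + s))) : measurable A ->
  lebt (k + s) A = pushforward (lebt k \x lebt s)%E (@cat_pair k s) A.
Proof.
move=> mA; have mcA : measurable (@cat_pair k s @^-1` A).
  by rewrite -[X in measurable X]setTI; exact: measurable_cat_pair.
transitivity (\int[lebt (k + s)]_t (\1_A t)%:E)%E.
  by rewrite integral_indic// setIT.
transitivity (\int[(lebt k \x lebt s)%E]_p (\1_(@cat_pair k s @^-1` A) p)%:E)%E;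
  last by rewrite integral_indic// setIT.
rewrite integral_tuple_cat//; last exact/measurable_EFinP.
by rewrite fubini_tonelli1//=; exact/measurable_EFinP.
Qed.

Lemma cintegral_tuple_cat k s (f : tupleR R (k + s) -> R[i]) : cmeasurable f ->
  cintegral (lebt (k + s)) setT f =
  cintegral (lebt k \x lebt s)%E setT (fun p => f (cat_pair p)).
Proof.
move=> mf; rewrite (cintegral_pushforward (@measurable_cat_pair k s)
  (mu := (lebt k \x lebt s)%E))//.
by move=> A mA; exact: lebesgue_tuple_cat.
Qed.

(* The weight makes absolute integrability over R^m a product of one-dimensional statements. *)
Definition weight m (t : tupleR R m) : R := \prod_(i < m) (oneDsqr (tnth t i))^-1.

Lemma weight_gt0 m (t : tupleR R m) : 0 < weight t.
Proof.
apply: prodr_gt0 => i _; rewrite invr_gt0.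
exact: lt_le_trans ltr01 (oneDsqr_ge1 _).
Qed.

Lemma weight_cons m x (t : tupleR R m) :
  weight (cons_pair (x, t)) = (oneDsqr x)^-1 * weight t.
Proof.
rewrite /weight big_ord_recl /= ; congr ((oneDsqr _)^-1 * _).
by apply: eq_bigr => i _; rewrite tnthS.
Qed.

Lemma measurable_oneDsqrV : measurable_fun setT (fun x : R => (oneDsqr x)^-1).
Proof. by apply: continuous_measurable_fun; exact: continuous_oneDsqrV. Qed.

Lemma measurable_weight m : measurable_fun setT (@weight m).
Proof.
apply: measurable_prod => i _.
exact: (measurableT_comp measurable_oneDsqrV (measurable_tnth i)).
Qed.

Lemma integrable_oneDsqrV : leb.-integrable setT (EFin \o (fun x : R => (oneDsqr x)^-1)).
Proof.
apply/integrableP; split; first by apply/measurable_EFinP; exact: measurable_oneDsqrV.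
under eq_integral => x _.
  rewrite gee0_abs; last by rewrite lee_fin invr_ge0 (le_trans ler01)// oneDsqr_ge1.
  over.
rewrite ge0_symfun_integralT.
- rewrite (_ : [set x | _] = `[0, +oo[%classic); last first.
    by apply/seteqP; split => x/=; rewrite in_itv/= andbT.
  by rewrite integral0y_oneDsqr -EFinM ltry.
- by move=> x; rewrite invr_ge0 (le_trans ler01)// oneDsqr_ge1.
- exact: continuous_oneDsqrV.
- by move=> x /=; rewrite /oneDsqr sqrrN.
Qed.

Lemma integrable_weight m : (lebt m).-integrable setT (EFin \o @weight m).
Proof.
elim: m => [|m IH].
  apply/integrableP; split; first by apply/measurable_EFinP; exact: measurable_weight.
  rewrite integral_tuple0 ?ltry//.
  apply: measurableT_comp => //; apply/measurable_EFinP; exact: measurable_weight.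
apply: integrable_tupleS; first exact: measurable_weight.
apply: (integrable_product _ integrable_oneDsqrV IH).
  apply: (measurableT_comp (@measurable_weight _)); exact: measurable_cons_pair.
by move=> x t /=; rewrite weight_cons ger0_norm// mulr_ge0 ?ltW ?weight_gt0//
  invr_gt0 (lt_le_trans ltr01)// oneDsqr_ge1.
Qed.

End tuple_measure.

(** * Measurability of continuous functions of a row vector *)

Section row_vectors.
Variable R : realType.

Lemma rV_norm_le m (x : 'rV[R]_m) (e : R) : 0 <= e ->
  (`|x| <= e) = [forall i, `|x 0 i| <= e].
Proof.
move=> e0; rewrite [`|x|]/Num.norm /= mx_normrE; apply/idP/forallP.
  by move=> /bigmax_leP[_ H] i; exact: (H (0, i)).
by move=> H; apply/bigmax_leP; split => // -[i j] _ /=; rewrite ord1.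
Qed.

Lemma rV_entry_le m (x : 'rV[R]_m) i : `|x 0 i| <= `|x|.
Proof. by have := lexx `|x|; rewrite rV_norm_le// => /forallP. Qed.

Lemma rV_ofE m (t : tupleR R m) i : rV_of t 0 i = tnth t i.
Proof. by rewrite mxE. Qed.

Lemma rV_of_surj m (x : 'rV[R]_m) : rV_of (tuple_of_rV x) = x.
Proof. by apply/rowP => i; rewrite rV_ofE tnth_mktuple. Qed.

Lemma measurable_box m (A : 'I_m -> set R) : (forall i, measurable (A i)) ->
  measurable [set t : tupleR R m | forall i, A i (tnth t i)].
Proof.
move=> mA.
rewrite (_ : [set t | _] = \bigcap_(i in [set: 'I_m])
    ((fun t : tupleR R m => tnth t i) @^-1` A i)).
  apply: fin_bigcap_measurable => // i _.
  rewrite -[X in measurable X]setTI.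
  exact: (@measurable_tnth _ (measurableTypeR R) m i measurableT (A i) (mA i)).
by apply/seteqP; split => t /= H i; [move=> _; exact: H|exact: H].
Qed.

Lemma measurable_countable_range d (T : measurableType d) (I : countType)
    (N : T -> I) (G : I -> R) :
  (forall z, measurable (N @^-1` [set z])) -> measurable_fun setT (G \o N).
Proof.
move=> mN _ B mB; rewrite setTI.
rewrite (_ : _ @^-1` _ = \bigcup_(z in [set: I])
    (if z \in [set z | B (G z)] then N @^-1` [set z] else set0)).
  apply: countable_bigcupT_measurable; first exact: countableP.
  by move=> z; case: ifP => _; [exact: mN|exact: measurable0].
apply/seteqP; split => t /=.
  by move=> Bt; exists (N t) => //; rewrite mem_set.
by move=> [z _]; case: ifPn => //; rewrite inE /preimage /= => Bz ->.
Qed.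

(** Continuity refers to the sup norm on rows, measurability to the sigma-algebra generated by the
    coordinates of tuples. Rounding each coordinate down to a multiple of [1/(k+1)] links them: the
    rounded function has countable range with boxes as fibres, and it converges pointwise to [f]. *)
Lemma continuous_measurable_rV m (f : 'rV[R]_m -> R) : continuous f ->
  measurable_fun setT (fun t : tupleR R m => f (rV_of t)).
Proof.
move=> cf.
pose N (k : nat) (t : tupleR R m) : {ffun 'I_m -> int} :=
  [ffun i => Num.floor ((tnth t i : R) * k.+1%:R)].
pose Q (k : nat) (z : {ffun 'I_m -> int}) : 'rV[R]_m :=
  \row_i ((z i)%:~R / k.+1%:R).
have k0 k : (0 : R) < k.+1%:R by [].
apply: (measurable_fun_cvg (h := fun k => (f \o Q k) \o N k)).
  move=> k; apply: measurable_countable_range => z.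
  rewrite (_ : _ @^-1` _ = [set t : tupleR R m | forall i,
      `[(z i)%:~R / k.+1%:R, (z i + 1)%:~R / k.+1%:R[%classic (tnth t i)]).
    by apply: (measurable_box (A := fun i =>
      `[(z i)%:~R / k.+1%:R, (z i + 1)%:~R / k.+1%:R[%classic)) => i.
  apply/seteqP; split => t /=.
    move=> <- i; rewrite ffunE in_itv /= ler_pdivrMr// ltr_pdivlMr//.
    exact: floor_itv.
  move=> H; apply/ffunP => i; rewrite ffunE; have := H i; rewrite in_itv /=.
  rewrite ler_pdivrMr// ltr_pdivlMr// => /floor_def.
  exact.
move=> t _.
suff H : Q k (N k t) @[k --> \oo] --> rV_of t.
  exact: (cvg_comp (fun k => Q k (N k t)) f H (cf (rV_of t))).
apply/cvgrPdist_le => /= e e0.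
near=> k; rewrite rV_norm_le ?ltW//; apply/forallP => i.
rewrite !mxE ffunE.
have /andP[h1 h2] := floor_itv ((tnth t i : R) * k.+1%:R).
set u := (_%:~R / _).
have hu : u <= tnth t i by rewrite ler_pdivrMr.
have hu2 : tnth t i < u + k.+1%:R^-1.
  by rewrite /u -[X in _ + X]mul1r -mulrDl ltr_pdivlMr// -intrD1.
have : k.+1%:R^-1 < e by near: k; exact: (near_infty_natSinv_lt (PosNum e0)).
move=> H; rewrite ger0_norm ?subr_ge0//.
by apply: ltW; rewrite ltrBlDl (lt_trans hu2)// ltrD2l.
Unshelve. all: by end_near. Qed.

End row_vectors.

(** * Lebesgue measure under dilations *)

Section scaling.
Variable R : realType.
Local Notation leb := (@lebesgue_measure R).
Local Notation lebt := (lebesgue_tuple R).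

(** By uniqueness of Lebesgue measure it suffices to compare the two sides on half-open
    intervals. *)
Lemma lebesgue_measure_scale (c : R) (A : set R) : 0 < c -> measurable A ->
  (leb A = c%:E * leb ((fun x => c * x)%R @^-1` A))%E.
Proof.
move=> c0 mA.
have mc : measurable_fun setT (( *%R c) : measurableTypeR R -> measurableTypeR R).
  by apply: continuous_measurable_fun; exact: mulrl_continuous.
pose mu : {measure set (measurableTypeR R) -> \bar R} :=
  mscale (NngNum (ltW c0)) (pushforward leb
   ((fun x => c * x) : measurableTypeR R -> measurableTypeR R)).
rewrite (@lebesgue_measure_unique R (mu mc))// => _ [[a b]] _ <-.
transitivity (c%:E * leb ((fun x => c * x)%R @^-1` `]a, b]%classic))%E; last by [].
rewrite (_ : _ @^-1` _ = `]a / c, b / c]%classic); last first.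
  apply/seteqP; split => x /=; rewrite !in_itv /=.
    by rewrite ltr_pdivrMr// ler_pdivlMr// mulrC.
  by rewrite ltr_pdivrMr// ler_pdivlMr// mulrC.
rewrite !lebesgue_measure_itv /= !lte_fin ltr_pM2r ?invr_gt0//.
case: ifP => _; last by rewrite mule0.
by rewrite -!EFinB -EFinM -mulrBl mulrC divfK// gt_eqF.
Qed.

Lemma ge0_integral_scale (c : R) (f : R -> \bar R) : 0 < c ->
  measurable_fun setT f -> (forall x, 0 <= f x)%E ->
  (\int[leb]_x f x = c%:E * \int[leb]_x f (c * x)%R)%E.
Proof.
move=> c0 mf f0.
have mc : measurable_fun setT (( *%R c) : measurableTypeR R -> measurableTypeR R).
  by apply: continuous_measurable_fun; exact: mulrl_continuous.
pose mu : {measure set (measurableTypeR R) -> \bar R} :=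
  mscale (NngNum (ltW c0)) (pushforward leb
   ((fun x => c * x) : measurableTypeR R -> measurableTypeR R)).
transitivity (\int[mu mc]_x f x)%E.
  by apply: eq_measure_integral => A mA _ /=; rewrite (lebesgue_measure_scale c0 mA).
rewrite /mu ge0_integral_mscale//; congr (_ * _)%E.
by rewrite (ge0_integral_pushforward mc)//= preimage_setT.
Qed.

Definition scale_tuple m (c : R) (t : tupleR R m) : tupleR R m :=
  [tuple c * tnth t i | i < m].

Lemma rV_of_scale m c (t : tupleR R m) : rV_of (scale_tuple c t) = c *: rV_of t.
Proof. by apply/rowP => i; rewrite !mxE tnth_mktuple. Qed.

Lemma measurable_scale_tuple m : measurable_fun setT
  (fun p : measurableTypeR R * tupleR R m => scale_tuple p.1 p.2).
Proof.
apply/measurable_fun_tnthP => i.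
rewrite (_ : _ \o _ = (fun p : measurableTypeR R * tupleR R m => (p.1 : R) * tnth p.2 i)).
  apply: measurable_funM; first exact: measurable_fst.
  exact: (measurableT_comp (measurable_tnth i) measurable_snd).
by apply/funext => p /=; rewrite tnth_mktuple.
Qed.

Lemma measurable_scale_tuple_cst m c : measurable_fun setT (@scale_tuple m c).
Proof.
apply/measurable_fun_tnthP => i.
rewrite (_ : _ \o _ = (fun t : tupleR R m => c * tnth t i)).
  by apply: measurable_funM => //; exact: measurable_tnth.
by apply/funext => p /=; rewrite tnth_mktuple.
Qed.

Lemma ge0_integral_tuple_scale m (c : R) (f : tupleR R m -> \bar R) : 0 < c ->
  measurable_fun setT f -> (forall x, 0 <= f x)%E ->
  (\int[lebt m]_t f t = (c ^+ m)%:E * \int[lebt m]_t f (scale_tuple c t))%E.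
Proof.
move=> c0; elim: m f => [|m IH] f mf f0.
  have ms : measurable_fun setT (fun t : tupleR R 0 => f (scale_tuple c t)).
    exact: (measurableT_comp mf (@measurable_scale_tuple_cst 0 c)).
  rewrite !integral_tuple0// expr0 mul1e; congr f.
  by apply: eq_from_tnth => -[].
have ms : measurable_fun setT (fun t : tupleR R m.+1 => f (scale_tuple c t)).
  exact: (measurableT_comp mf (@measurable_scale_tuple_cst _ c)).
have mfx x : measurable_fun setT (fun t => f (@cons_pair R m (x, t))).
  exact: (measurableT_comp (measurableT_comp mf (@measurable_cons_pair R m))
    (pair1_measurable x)).
rewrite integral_tupleS// [in RHS]integral_tupleS//.
have m1 : measurable_fun setT (fun x => \int[lebt m]_t f (@cons_pair R m (x, t)))%E.
  apply: (@measurable_fun_fubini_tonelli_F _ _ _ _ R (lebt m)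
    (fun p => f (@cons_pair R m p))) => //.
  by apply: (measurableT_comp mf); exact: measurable_cons_pair.
have m2 : measurable_fun setT
    (fun x => \int[lebt m]_t f (scale_tuple c (@cons_pair R m (x, t))))%E.
  apply: (@measurable_fun_fubini_tonelli_F _ _ _ _ R (lebt m)
    (fun p => f (scale_tuple c (@cons_pair R m p)))) => //.
  by apply: (measurableT_comp ms); exact: measurable_cons_pair.
rewrite (ge0_integral_scale c0 m1); last by move=> x; exact: integral_ge0.
rewrite exprS EFinM -muleA; congr (_ * _)%E.
rewrite -(ge0_integralZl _ measurableT m2)//; [|by move=> x _; exact: integral_ge0
  |by rewrite lee_fin exprn_ge0// ltW].
apply: eq_integral => x _; rewrite IH//; congr (_ * _)%E.
apply: eq_integral => t _; congr f; apply: eq_from_tnth => i.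
rewrite tnth_mktuple; have [j|] := unliftP ord0 i => ->.
  by rewrite !tnthS tnth_mktuple.
by rewrite !tnth0.
Qed.

End scaling.

(** * The fundamental theorem of calculus on unbounded intervals *)

Section half_line.
Variable R : realType.
Local Notation leb := (@lebesgue_measure R).
Implicit Types g dg : R -> R.

Lemma derive_continuous g dg :
  (forall x : R, is_derive x (1 : R) g (dg x)) -> continuous g.
Proof.
move=> H x; apply: differentiable_continuous.
by apply/derivable1_diffP; have [] := H x.
Qed.

Lemma FTC2_segment g dg (a b : R) : a < b ->
  (forall x : R, is_derive x (1 : R) g (dg x)) -> continuous dg ->
  (\int[leb]_(x in `[a, b]) (dg x)%:E = (g b - g a)%:E)%E.
Proof.
move=> ab H cdg; rewrite EFinB; apply: continuous_FTC2 => //.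
- exact: continuous_subspaceT.
- have cg := derive_continuous H; split.
  + by move=> x _; have [] := H x.
  + exact/cvg_at_right_filter/cg.
  + exact/cvg_at_left_filter/cg.
- by move=> x _; rewrite derive1E; have H' := H x; rewrite derive_val.
Qed.

Lemma cvg_oneDsqrV (C : R) : C / oneDsqr (n.+1%:R : R) @[n --> \oo] --> (0 : R).
Proof.
rewrite -(mulr0 C); apply: cvgMr.
apply: (@squeeze_cvgr _ _ _ _ (cst 0) (fun n => n.+1%:R^-1)).
- apply: nearW => n; rewrite invr_ge0 (le_trans ler01 (oneDsqr_ge1 _)) /=.
  have h0 : 0 < oneDsqr (n.+1%:R : R) by apply: (lt_le_trans ltr01); exact: oneDsqr_ge1.
  rewrite lef_pV2 ?posrE//.
  rewrite /oneDsqr (@le_trans _ _ (n.+1%:R ^+ 2))//; last by rewrite lerDr.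
  by rewrite expr2 ler_peMl// ler1n.
- exact: cvg_cst.
- exact: cvg_harmonic.
Qed.

Lemma decay_cvg0 (g : R -> R) (C : R) (u : nat -> R) :
  (forall x, `|g x| <= C / oneDsqr x) -> (forall n, `|u n| = n.+1%:R) ->
  g (u n) @[n --> \oo] --> (0 : R).
Proof.
move=> gC uE; apply: norm_cvg0.
apply: (@squeeze_cvgr _ _ _ _ (cst 0) (fun n => C / oneDsqr (n.+1%:R : R))).
- apply: nearW => n; rewrite normr_ge0 /=; apply: le_trans (gC _) _.
  by rewrite /oneDsqr -(uE n) real_normK// num_real.
- exact: cvg_cst.
- exact: cvg_oneDsqrV.
Qed.

Lemma integrable_decay (dg : R -> R) (C : R) : measurable_fun setT dg ->
  (forall x, `|dg x| <= C / oneDsqr x) -> leb.-integrable setT (EFin \o dg).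
Proof.
move=> mdg dgC.
apply: (@integrable_dom R _ _ leb dg (fun x => C * (oneDsqr x)^-1)) => //.
exact: (integrableZl measurableT C (@integrable_oneDsqrV R)).
Qed.

Lemma cvg_Rintegral_indic (dg : R -> R) (D : set R) (A : nat -> set R) :
  leb.-integrable setT (EFin \o dg) -> measurable D ->
  (forall n, measurable (A n)) ->
  (forall x, \forall n \near \oo, (x \in A n) = (x \in D)) ->
  \int[leb]_(x in A n) dg x @[n --> \oo] --> \int[leb]_(x in D) dg x.
Proof.
move=> idg mD mA AD.
have /integrableP[/measurable_EFinP mdg _] := idg.
under eq_fun do rewrite Rintegral_mkcond; rewrite Rintegral_mkcond.
have mr B : measurable B -> measurable_fun setT (dg \_ B).
  by move=> mB; apply/(measurable_restrictT _ mB); exact: measurable_funTS.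
apply: (@dominated_cvg_Rintegral R _ _ leb (fun n => dg \_ (A n)) (dg \_ D) (fun x => `|dg x|)).
- by move=> n; exact: mr.
- exact: mr.
- apply: aeW => x; apply: cvg_near_cst.
  by near=> n; rewrite !patchE; congr (if _ then _ else _); near: n; exact: AD.
- exact: integrable_norm.
- by move=> n x; rewrite patchE; case: ifP => _ //; rewrite normr0.
Unshelve. all: by end_near. Qed.

(** The decay of [g] kills both boundary terms on [[-(n+1), n+1]], and the decay of [dg] lets these
    segments exhaust the line by dominated convergence. *)
Lemma Rintegral_derive_line g dg (C : R) :
  (forall x : R, is_derive x (1 : R) g (dg x)) -> continuous dg ->
  (forall x, `|g x| <= C / oneDsqr x) ->
  (forall x, `|dg x| <= C / oneDsqr x) ->
  \int[leb]_x dg x = 0.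
Proof.
move=> H cdg gC dgC.
have idg := integrable_decay (continuous_measurable_fun cdg) dgC.
pose A n : set R := `[- n.+1%:R, n.+1%:R]%classic.
have c1 : \int[leb]_(x in A n) dg x @[n --> \oo] --> \int[leb]_x dg x.
  apply: cvg_Rintegral_indic => //; first by move=> n; exact: measurable_itv.
  move=> x; near=> n; rewrite in_setT mem_set// /A /= in_itv /= -ler_norml.
  apply: ltW; apply: lt_trans (unstable.ltr_norm_bound x) _; rewrite ltr_nat ltnS.
  by near: n; exact: nbhs_infty_ge.
have c2 : \int[leb]_(x in A n) dg x @[n --> \oo] --> (0 : R) - 0.
  rewrite (_ : (fun n => \int[leb]_(x in A n) dg x) =
    (fun n => g n.+1%:R - g (- n.+1%:R))).
    apply: cvgB; apply: (decay_cvg0 gC) => n; rewrite ?normrN ger0_norm//.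
  apply/funext => n; rewrite /Rintegral (FTC2_segment _ H cdg)//.
  by rewrite -subr_gt0 opprK -natrD.
by rewrite -[RHS](subr0 0); exact: (cvg_unique _ c1 c2).
Unshelve. all: by end_near. Qed.

Lemma Rintegral_derive_pos g dg (C : R) :
  (forall x : R, is_derive x (1 : R) g (dg x)) -> continuous dg ->
  (forall x, `|g x| <= C / oneDsqr x) ->
  (forall x, `|dg x| <= C / oneDsqr x) ->
  \int[leb]_(x in `]0, +oo[) dg x = - g 0.
Proof.
move=> H cdg gC dgC.
have idg := integrable_decay (continuous_measurable_fun cdg) dgC.
(* The fundamental theorem is used on closed segments; adding the endpoint 0 does not change the
   integral. *)
rewrite Rintegral_itv_obnd_cbnd; last exact: (integrableS measurableT).
pose A n : set R := `[0, n.+1%:R]%classic.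
have c1 : \int[leb]_(x in A n) dg x @[n --> \oo] --> \int[leb]_(x in `[0, +oo[) dg x.
  apply: cvg_Rintegral_indic => //; first by move=> n; exact: measurable_itv.
  move=> x; near=> n; apply/idP/idP; rewrite !inE /A /= !in_itv /= andbT.
    by case/andP.
  move=> -> /=.
  apply: ltW; apply: le_lt_trans (ler_norm _) _.
  apply: lt_trans (unstable.ltr_norm_bound x) _; rewrite ltr_nat ltnS.
  by near: n; exact: nbhs_infty_ge.
have c2 : \int[leb]_(x in A n) dg x @[n --> \oo] --> (0 : R) - g 0.
  rewrite (_ : (fun n => \int[leb]_(x in A n) dg x) =
    (fun n => g n.+1%:R - g 0)).
    apply: cvgB; last exact: cvg_cst.
    by apply: (decay_cvg0 gC) => n; rewrite ger0_norm.
  by apply/funext => n; rewrite /Rintegral (FTC2_segment _ H cdg).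
by rewrite -[RHS]sub0r; exact: (cvg_unique _ c1 c2).
Unshelve. all: by end_near. Qed.

End half_line.

(** * Integration along one coordinate *)

Section coordinate_derivative.
Variable R : realType.
Local Notation leb := (@lebesgue_measure R).
Local Notation lebt := (lebesgue_tuple R).

Definition tset m (t : tupleR R m) (j : 'I_m) (y : R) : tupleR R m :=
  [tuple if i == j then y else tnth t i | i < m].

Lemma tset_cons0 m (t : tupleR R m) x y :
  tset (cons_pair (x, t)) ord0 y = cons_pair (y, t).
Proof.
apply: eq_from_tnth => i; rewrite tnth_mktuple.
have [j|] := unliftP ord0 i => ->; last by rewrite eqxx tnth0.
by rewrite !tnthS eq_sym (negPf (neq_lift _ _)).
Qed.

Lemma tset_consS m (t : tupleR R m) x y j :
  tset (cons_pair (x, t)) (lift ord0 j) y = cons_pair (x, tset t j y).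
Proof.
apply: eq_from_tnth => i; rewrite tnth_mktuple.
have [k|] := unliftP ord0 i => ->.
  by rewrite !tnthS tnth_mktuple (inj_eq lift_inj).
by rewrite (negPf (neq_lift _ _)) !tnth0.
Qed.

(** Fubini separates the first coordinate. If it is the differentiated one, its integral vanishes by
    [Rintegral_derive_line]; otherwise the induction hypothesis applies to each slice. The weight is
    a product over coordinates, so the bounds restrict to slices. *)
Lemma Rintegral_partial_derive m (F dF : tupleR R m -> R) (j : 'I_m) (C : R) :
  measurable_fun setT dF ->
  (forall t (y : R), is_derive y (1 : R) (fun y => F (tset t j y)) (dF (tset t j y))) ->
  (forall t, continuous (fun y => dF (tset t j y))) ->
  (forall t, `|F t| <= C * weight t) -> (forall t, `|dF t| <= C * weight t) ->
  \int[lebt m]_t dF t = 0.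
Proof.
elim: m F dF j C => [|m IH] F dF j C mdF FdF cdF FC dFC; first by have := ltn_ord j.
have mcons : measurable_fun setT (fun p => dF (@cons_pair R m p)).
  exact: (measurableT_comp mdF (@measurable_cons_pair R m)).
have C0 : 0 <= C.
  have := le_trans (normr_ge0 _) (FC [tuple 0 | i < m.+1]).
  by rewrite pmulr_lge0// weight_gt0.
have dom x t : `|dF (@cons_pair R m (x, t))| <= (C * (oneDsqr x)^-1) * weight t.
  by apply: le_trans (dFC _) _; rewrite weight_cons mulrA.
have iC : leb.-integrable setT (EFin \o (fun x : R => C * (oneDsqr x)^-1)).
  exact: (integrableZl measurableT C (@integrable_oneDsqrV R)).
have -> : \int[lebt m.+1]_t dF t = \int[(leb \x lebt m)%E]_p dF (cons_pair p).
  rewrite /Rintegral (integral_pushforwardT (@measurable_cons_pair R m)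
    (mu := (leb \x lebt m)%E))//.
  exact/measurable_EFinP.
have [k jE|jE] := unliftP ord0 j; last first.
  rewrite (Rintegral_product21 mcons iC (@integrable_weight R m) dom).
  rewrite /Rintegral integral0_eq// => t _; congr EFin.
  have der y : is_derive y (1 : R) (fun y => F (cons_pair (y, t))) (dF (cons_pair (y, t))).
    have := FdF (cons_pair (0, t)) y; rewrite jE tset_cons0.
    by under eq_fun do rewrite tset_cons0.
  apply: (Rintegral_derive_line (C := C * weight t) der).
  - have := cdF (cons_pair (0, t)); rewrite jE.
    by under eq_fun do rewrite tset_cons0.
  - by move=> x; apply: le_trans (FC _) _; rewrite weight_cons mulrAC mulrA.
  - by move=> x; apply: le_trans (dFC _) _; rewrite weight_cons mulrAC mulrA.
rewrite (Rintegral_product12 mcons iC (@integrable_weight R m) dom).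
rewrite /Rintegral integral0_eq// => x _; congr EFin.
apply: (IH (fun t => F (cons_pair (x, t))) _ k (C * (oneDsqr x)^-1)).
- exact: (measurableT_comp mcons (pair1_measurable x)).
- move=> t y; have := FdF (cons_pair (x, t)) y; rewrite jE tset_consS.
  by under eq_fun do rewrite tset_consS.
- move=> t; have := cdF (cons_pair (x, t)); rewrite jE.
  by under eq_fun do rewrite tset_consS.
- by move=> t; apply: le_trans (FC _) _; rewrite weight_cons mulrA.
- by move=> t; apply: le_trans (dFC _) _; rewrite weight_cons mulrA.
Qed.

(** Meant for the zero set of P, which every line parallel to the first axis meets in at most two
    points. *)
Lemma null_of_finite_sections m (A : set (tupleR R m.+1)) : measurable A ->
  (forall t, finite_set [set x : R | A (cons_pair (x, t))]) -> lebt m.+1 A = 0%E.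
Proof.
move=> mA fA; rewrite -[A]setIT -(integral_indic _ measurableT mA).
have mi : measurable_fun setT (fun p => (\1_A (@cons_pair R m p) : R)%:E).
  apply/measurable_EFinP.
  by apply: (measurableT_comp _ (@measurable_cons_pair R m)).
rewrite (ge0_integral_pushforwardT (@measurable_cons_pair R m)
  (mu := (leb \x lebt m)%E))//; last exact/measurable_EFinP.
rewrite fubini_tonelli2//.
rewrite integral0_eq// => t _; rewrite /fubini_G.
transitivity (leb [set x | A (cons_pair (x, t))]).
  rewrite -[X in leb X]setIT -integral_indic//.
  by apply: countable_measurable; [exact: measurable_set1|exact: finite_set_countable].
by apply: countable_lebesgue_measure0; exact: finite_set_countable.
Qed.

End coordinate_derivative.

(** * Schwartz functions *)

Section coordinate_calculus.
Variables (R : realType) (m : nat).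
Local Notation V := 'rV[R]_m.
Local Notation e_ i := (delta_mx 0 i : V).
Implicit Types (f g : V -> R) (x y h : V).

(** Directional derivatives become one-variable derivatives along lines, to which the mean value
    theorem and differentiation under the integral sign apply. *)
Lemma is_derive_line f (g : V -> R) (v : V) :
  (forall x, is_derive x v f (g x)) <->
  (forall x (s : R), is_derive s (1 : R) (fun s : R => f (x + s *: v)) (g (x + s *: v))).
Proof.
have E x (s : R) : (fun k : R => k^-1 *: (((fun s : R => f (x + s *: v)) \o shift s) (k *: (1 : R)) - f (x + s *: v))) =
    (fun k : R => k^-1 *: ((f \o shift (x + s *: v)) (k *: v) - f (x + s *: v))).
  apply/funext => k /=; congr (_ *: (f _ - _)).
  by rewrite [k *: 1]mulr1 scalerDl addrCA.
split => [H x s|H x].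
  have [d1 d2] := H (x + s *: v); split.
    by rewrite /derivable E.
  by rewrite -d2 /derive E.
have [d1 d2] := H x 0; rewrite !scale0r !addr0 in d2; split.
  by move: d1; rewrite /derivable E scale0r addr0.
by rewrite -d2 /derive E scale0r addr0.
Qed.

(** Walk from [x] to [x + h] one coordinate at a time and use the mean value theorem on each step;
    in the sup norm all intermediate points stay within [|h|] of [x]. With [q = 0] this is a
    Lipschitz bound, with [q i = p i x] it is differentiability. *)
Lemma partial_increment f (p : 'I_m -> V -> R) (q : 'I_m -> R) (e : R) x h :
  (forall i x, is_derive x (e_ i) f (p i x)) ->
  (forall i y, `|y - x| <= `|h| -> `|p i y - q i| <= e) ->
  `|f (x + h) - f x - \sum_i q i * h 0 i| <= m%:R * (e * `|h|).
Proof.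
move=> pE pq.
pose z (k : nat) : V := x + \row_i (if (i < k)%N then h 0 i else 0).
have z0 : z 0%N = x.
  by rewrite /z (_ : \row_i _ = 0) ?addr0//; apply/rowP => i; rewrite !mxE.
have zm : z m = x + h.
  by congr (_ + _); apply/rowP => i; rewrite !mxE ltn_ord.
have zS (k : 'I_m) : z k.+1 = z k + h 0 k *: e_ k.
  rewrite /z -addrA; congr (_ + _); apply/rowP => i; rewrite !mxE eqxx /= ltnS.
  rewrite leq_eqVlt (inj_eq val_inj); have [->|ik] := eqVneq i k.
    by rewrite ltnn mulr1 add0r.
  by rewrite orFb mulr0 addr0.
have e0 : forall i : 'I_m, 0 <= e.
  by move=> i; apply: le_trans (normr_ge0 _) (pq i x _); rewrite subrr normr0.
have step (k : 'I_m) : `|f (z k.+1) - f (z k) - q k * h 0 k| <= e * `|h|.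
  have dl := (is_derive_line f (p k) (e_ k)).1 (pE k) (z k).
  pose F (s : R) := f (z k + s *: e_ k); pose dF (s : R) := p k (z k + s *: e_ k).
  have cF : continuous F by exact: (derive_continuous dl).
  have near_z (s : R) : `|s| <= `|h 0 k| -> `|z k + s *: e_ k - x| <= `|h|.
    move=> sh; rewrite rV_norm_le//; apply/forallP => i.
    have -> : (z k + s *: e_ k - x) 0 i =
        (if (i < k)%N then h 0 i else 0) + s * (i == k)%:R.
      rewrite !mxE eqxx /=; set u := if _ then _ else _; set v := _ * _.
      by rewrite -[x 0 i + u + v]addrA addrAC subrr add0r.
    have [->|ik] := eqVneq i k.
      by rewrite ltnn add0r mulr1 (le_trans sh)// rV_entry_le.
    rewrite mulr0 addr0; case: ifP => _; first exact: rV_entry_le.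
    by rewrite normr0.
  have [s sh EF] : exists2 s : R, `|s| <= `|h 0 k| &
      F (h 0 k) - F 0 = dF s * (h 0 k).
    have [hk|hk|hk] := ltgtP (h 0 k) 0.
    - have [s] := MVT hk (fun s _ => dl s) (continuous_subspaceT cF).
      rewrite in_itv /= => /andP[s1 s2] E; exists s.
        by rewrite !ler0_norm ?lerN2 ?ltW.
      by rewrite -opprB E sub0r mulrN opprK.
    - have [s] := MVT hk (fun s _ => dl s) (continuous_subspaceT cF).
      rewrite in_itv /= => /andP[s1 s2] E; exists s.
        by rewrite !ger0_norm ?ltW.
      by rewrite E subr0.
    - by exists 0; rewrite ?hk ?normr0// subrr mulr0.
  have -> : f (z k.+1) - f (z k) = F (h 0 k) - F 0.
    by rewrite /F -zS scale0r addr0.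
  rewrite EF -mulrBl normrM ler_pM// ?rV_entry_le//.
  by apply: pq; exact: near_z.
have tel : f (x + h) - f x = \sum_(k < m) (f (z k.+1) - f (z k)).
  by rewrite -(big_mkord xpredT (fun k => f (z k.+1) - f (z k))) telescope_sumr// z0 zm.
rewrite tel -sumrB; apply: le_trans (ler_norm_sum _ _ _) _.
apply: (@le_trans _ _ (\sum_(k < m) e * `|h|)); first by apply: ler_sum => k _.
by rewrite sumr_const card_ord mulr_natl.
Qed.

Lemma partials_lipschitz f (p : 'I_m -> V -> R) (M : R) :
  (forall i x, is_derive x (e_ i) f (p i x)) -> (forall i x, `|p i x| <= M) ->
  forall x y, `|f y - f x| <= (m%:R * M) * `|y - x|.
Proof.
move=> pE pM x y.
have := @partial_increment f p (fun=> 0) M x (y - x) pE.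
rewrite subrKC big1 ?subr0//; last by move=> i _; rewrite mul0r.
by rewrite mulrA; apply => i z _; rewrite subr0.
Qed.

Lemma differentiable_of_partials f (p : 'I_m -> V -> R) (L : R) :
  (forall i x, is_derive x (e_ i) f (p i x)) ->
  (forall i x y, `|p i y - p i x| <= L * `|y - x|) ->
  forall x, differentiable f x.
Proof.
move=> pE pL x.
pose c : 'cV[R]_m := \col_i p i x.
pose df0 (h : V) : R := \sum_i p i x * h 0 i.
have lin_df : linear df0.
  move=> a u v; rewrite /df0 scaler_sumr -big_split /=; apply: eq_bigr => i _.
  by rewrite !mxE mulrDr /GRing.scale /= mulrCA.
pose df : {linear V -> R} := HB.pack df0 (GRing.isLinear.Build _ _ _ _ _ lin_df).
have cdf : continuous df.
  move=> h; apply: differentiable_continuous.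
  rewrite (_ : (df : V -> R) = \sum_(i < m) (p i x *: (fun M : V => M 0 i : R))).
    apply: differentiable_sum => i; apply: differentiableZ.
    exact: differentiable_coord.
  by apply/funext => y; rewrite fct_sumE.
have Hf : f \o shift x = cst (f x) + df +o_ (0 : V) id.
  apply/eqaddoP => e e0.
  have [C [C0 CL]] : exists C, 0 < C /\ m%:R * L <= C.
    by exists (`|m%:R * L| + 1); split; [rewrite ltr_wpDl|rewrite ler_wpDr// ler_norm].
  near=> h.
  have -> : (f \o shift x - (cst (f x) + df)) h = f (x + h) - f x - df0 h.
    by rewrite -addrA -opprD [x + h]addrC.
  (* [L] carries no sign hypothesis. An instance of [pL] supplies nonnegativity, and an index [i]
     guarantees that there is one. *)
  have Lp : forall i : 'I_m, 0 <= L * `|h|.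
    by move=> i; have := le_trans (normr_ge0 _) (pL i x (x + h)); rewrite addrC addKr.
  apply: le_trans (@partial_increment f p (fun i => p i x) (L * `|h|) x h pE _) _.
    move=> i y yh; apply: le_trans (pL i x y) _.
    have [y0|y0] := eqVneq y x; first by rewrite y0 subrr normr0 mulr0 Lp.
    have L0 : 0 <= L.
      have := le_trans (normr_ge0 _) (pL i x y).
      by rewrite pmulr_lge0// normr_gt0 subr_eq0.
    exact: ler_wpM2l.
  rewrite !mulrA; apply: ler_wpM2r => //.
  apply: (@le_trans _ _ (C * `|h|)); first exact: ler_wpM2r.
  rewrite -ler_pdivlMl//.
  by near: h; apply: (@nbhs0_le _ V); rewrite mulr_gt0// invr_gt0.
apply/diff_locallyP; rewrite (diff_unique cdf Hf); split => //.
Unshelve. all: by end_near. Qed.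

End coordinate_calculus.

Lemma is_derive_affine (R : realType) (a b s : R) :
  is_derive s (1 : R) (fun x : R => a + x * b) b.
Proof.
have H := is_derive_add (is_derive_cst a s (1 : R))
    (is_derive_mul (is_derive_id s (1 : R)) (is_derive_cst b s (1 : R))).
by apply: (is_derive_eq H); rewrite add0r mul1r mulr0 addr0.
Qed.

(** * Schwartz functions through closure classes *)

Section schwartz_classes.
Variables (R : realType) (m : nat).
Local Notation V := 'rV[R]_m.
Local Notation e_ i := (delta_mx 0 i : V).
Implicit Types (f g : V -> R) (x : V).

Definition mulX (i : 'I_m) f : V -> R := fun x => x 0 i * f x.

(** A coinductive form of the Schwartz condition: a function belonging to some such class is
    Schwartz ([schwartz_class_schwartz]). Three closure checks then stand in for bounds on all
    iterated derivatives. *)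
Definition schwartz_class (C : (V -> R) -> Prop) : Prop := forall f, C f ->
  [/\ exists M, forall x, `|f x| <= M,
      forall i, exists2 g, C g & forall x, is_derive x (e_ i) f (g x) &
      forall i, C (mulX i f)].

Lemma is_derive_coord (i j : 'I_m) x :
  is_derive x (e_ i) (fun y : V => y 0 j) (j == i)%:R.
Proof.
move: x; apply: (is_derive_line _ (fun=> (j == i)%:R) _).2 => x s.
rewrite (_ : (fun _ => _) = (fun s : R => x 0 j + s * (j == i)%:R)).
  exact: is_derive_affine.
by apply/funext => u; rewrite !mxE eqxx.
Qed.

Lemma is_derive_mulX (i j : 'I_m) f x (df : R) : is_derive x (e_ i) f df ->
  is_derive x (e_ i) (mulX j f) ((j == i)%:R * f x + x 0 j * df).
Proof.
move=> H; have H' := is_deriveM (is_derive_coord i j x) H.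
apply: (is_derive_eq (f := (fun y : V => y 0 j : R) * f) H').
by rewrite addrC /GRing.scale /= [f x * _]mulrC.
Qed.

Lemma uniform_bound (C : (V -> R) -> Prop) : schwartz_class C ->
  forall p : 'I_m -> V -> R, (forall i, C (p i)) ->
  exists M, forall i x, `|p i x| <= M.
Proof.
move=> SC p Cp.
have /choice[M MP] : forall i, exists b, forall x, `|p i x| <= b.
  by move=> i; have [b _ _] := SC _ (Cp i).
exists (\sum_i `|M i|) => i x; apply: le_trans (MP i x) _.
by rewrite (bigD1 i)//= (le_trans (ler_norm _))// lerDl sumr_ge0.
Qed.

Lemma schwartz_class_partials (C : (V -> R) -> Prop) : schwartz_class C ->
  forall f, C f -> {p : 'I_m -> V -> R | forall i, C (p i) /\
    forall x, is_derive x (e_ i) f (p i x)}.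
Proof.
move=> SC f Cf; have [_ H _] := SC f Cf.
have /choice[p Hp] : forall i, exists g, C g /\ forall x, is_derive x (e_ i) f (g x).
  by move=> i; have [g] := H i; exists g.
by exists p.
Qed.

Lemma schwartz_class_lipschitz (C : (V -> R) -> Prop) : schwartz_class C ->
  forall f, C f -> exists L, forall x y, `|f y - f x| <= L * `|y - x|.
Proof.
move=> SC f Cf; have [p Hp] := schwartz_class_partials SC Cf.
have [M HM] := uniform_bound SC (fun i => (Hp i).1).
by exists (m%:R * M); apply: (@partials_lipschitz _ _ _ p) => // i x; have [] := Hp i.
Qed.

Lemma schwartz_class_differentiable (C : (V -> R) -> Prop) : schwartz_class C ->
  forall f, C f -> forall x, differentiable f x.
Proof.
move=> SC f Cf; have [p Hp] := schwartz_class_partials SC Cf.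
have /choice[L LP] : forall i, exists c, forall x y, `|p i y - p i x| <= c * `|y - x|.
  by move=> i; exact: (schwartz_class_lipschitz SC (Hp i).1).
apply: (@differentiable_of_partials _ _ _ p (\sum_i `|L i|)) => [i x|i x y].
  by have [] := Hp i.
apply: le_trans (LP i x y) _; apply: ler_wpM2r => //.
by rewrite (bigD1 i)//= (le_trans (ler_norm _))// lerDl sumr_ge0.
Qed.

(** Closure keeps every monomial times every iterated partial inside the class, hence bounded.
    Differentiability in the full sense holds because the first partials of a member are Lipschitz,
    their own partials being bounded. *)
Lemma schwartz_class_schwartz (C : (V -> R) -> Prop) f :
  schwartz_class C -> C f -> schwartz_real f.
Proof.
move=> SC Cf.
have Cpart l : C (partials l f).
  elim: l => [//|i l IH] /=.
  have [p Hp] := schwartz_class_partials SC IH; have [Cp Dp] := Hp i.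
  by rewrite (_ : (fun _ => _) = p i)//; apply/funext => x; rewrite (@derive_val _ _ _ _ _ _ _ (Dp x)).
split; first by move=> l x; exact: (schwartz_class_differentiable SC (Cpart l)).
move=> a l.
have Cmul (r : seq 'I_m) : C (fun x => (\prod_(i <- r) x 0 i ^+ a i) * partials l f x).
  elim: r => [|i r IH].
    by rewrite (_ : (fun _ => _) = partials l f)//; apply/funext => x; rewrite big_nil mul1r.
  rewrite (_ : (fun _ => _) = iter (a i) (mulX i)
     (fun x => (\prod_(j <- r) x 0 j ^+ a j) * partials l f x)).
    elim: (a i) => [//|k IHk] /=.
    by have [_ _] := SC _ IHk; exact.
  apply/funext => x; rewrite big_cons -mulrA.
  elim: (a i) => [|k IHk]; first by rewrite expr0 mul1r.
  by rewrite exprS -mulrA IHk.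
have [+ _ _] := SC _ (Cmul (index_enum 'I_m)).
exact.
Qed.

(** The smallest class containing [f]. Multiplications stand outside differentiations;
    differentiating a monomial factor yields two terms, whence the closure under sums and
    scalars. *)
Inductive schwartz_span f : (V -> R) -> Prop :=
| span_base s l : schwartz_span f (foldr mulX (partials l f) s)
| span_add g h : schwartz_span f g -> schwartz_span f h ->
    schwartz_span f (fun x => g x + h x)
| span_scale c g : schwartz_span f g -> schwartz_span f (fun x => c * g x).

Lemma foldr_mulXE f (s : seq 'I_m) x :
  foldr mulX f s x = (\prod_(i < m) x 0 i ^+ count_mem i s) * f x.
Proof.
elim: s => [|j s IH] /=.
  by rewrite big1 ?mul1r// => i _; rewrite expr0.
rewrite /mulX IH mulrA; congr (_ * _).
rewrite [RHS](bigD1 j)//= eqxx add1n exprS -mulrA; congr (_ * _).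
rewrite (bigD1 j)//=; congr (_ * _); apply: eq_bigr => i ij.
by rewrite eq_sym (negPf ij).
Qed.

Lemma is_derive_diff f x (i : 'I_m) : differentiable f x ->
  is_derive x (e_ i) f ('D_(e_ i) f x).
Proof. by move=> df; apply: derivableP; exact: diff_derivable. Qed.

Lemma schwartz_span_mulX f g j : schwartz_span f g -> schwartz_span f (mulX j g).
Proof.
elim=> [s l|g1 g2 _ IH1 _ IH2|c g1 _ IH].
- exact: (span_base f (j :: s) l).
- rewrite (_ : mulX j _ = fun x => mulX j g1 x + mulX j g2 x); first exact: span_add.
  by apply/funext => x; rewrite /mulX mulrDr.
- rewrite (_ : mulX j _ = fun x => c * mulX j g1 x); first exact: span_scale.
  by apply/funext => x; rewrite /mulX mulrCA.
Qed.

Lemma schwartz_span_class f : schwartz_real f -> schwartz_class (schwartz_span f).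
Proof.
move=> [sf bf] g Hg; split; last by move=> i; exact: schwartz_span_mulX.
- elim: Hg => [s l|g1 g2 _ [M1 H1] _ [M2 H2]|c g1 _ [M H]].
  + have [M HM] := bf (fun i => count_mem i s) l.
    by exists M => x; rewrite foldr_mulXE.
  + by exists (M1 + M2) => x; apply: le_trans (ler_normD _ _) _; exact: lerD.
  + by exists (`|c| * M) => x; rewrite normrM ler_wpM2l.
- move=> i; elim: Hg => [s l|g1 g2 _ [p1 C1 H1] _ [p2 C2 H2]|c g1 _ [p C1 H1]].
  + elim: s => [|j s [p Cp IH]] /=.
      exists (partials (i :: l) f); first exact: (span_base f [::]).
      by move=> x; exact: is_derive_diff.
    exists (fun x => (j == i)%:R * foldr mulX (partials l f) s x + mulX j p x).
      apply: span_add; first by apply: span_scale; exact: span_base.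
      exact: schwartz_span_mulX.
    by move=> x; exact: is_derive_mulX.
  + exists (fun x => p1 x + p2 x); first exact: span_add.
    by move=> x; exact: (is_deriveD (H1 x) (H2 x)).
  + exists (fun x => c * p x); first exact: span_scale.
    by move=> x; exact: (is_deriveZ c (H1 x)).
Qed.

Lemma schwartz_span_self f : schwartz_span f f.
Proof. exact: (span_base f [::] [::]). Qed.

Lemma schwartz_real_mulX f i : schwartz_real f -> schwartz_real (mulX i f).
Proof.
move=> sf; apply: (schwartz_class_schwartz (schwartz_span_class sf)).
by apply: schwartz_span_mulX; exact: schwartz_span_self.
Qed.

Lemma schwartz_real_scale f (c : R) : schwartz_real f -> schwartz_real (fun x => c * f x).
Proof.
move=> sf; apply: (schwartz_class_schwartz (schwartz_span_class sf)).
by apply: span_scale; exact: schwartz_span_self.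
Qed.

Lemma schwartz_real_partial f i : schwartz_real f ->
  schwartz_real (fun x => 'D_(e_ i) f x).
Proof.
move=> sf; apply: (schwartz_class_schwartz (schwartz_span_class sf)).
exact: (span_base f [::] [:: i]).
Qed.

(** Schwartz functions are themselves such a class, hence the largest one. *)
Lemma schwartz_real_class : schwartz_class (@schwartz_real R m).
Proof.
move=> f sf; split.
- have [_ /(_ (fun=> 0%N) [::]) [M HM]] := sf; exists M => x.
  by have := HM x; rewrite big1 ?mul1r// => i _; rewrite expr0.
- move=> i; exists (fun x => 'D_(e_ i) f x); first exact: schwartz_real_partial.
  by move=> x; apply: is_derive_diff; exact: (sf.1 [::]).
- by move=> i; exact: schwartz_real_mulX.
Qed.

Lemma schwartz_realD f g : schwartz_real f -> schwartz_real g ->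
  schwartz_real (fun x => f x + g x).
Proof.
move=> sf sg.
pose C h := exists f g, [/\ schwartz_real f, schwartz_real g & h = fun x => f x + g x].
apply: (@schwartz_class_schwartz C); last by exists f, g.
move=> _ [f1 [g1 [sf1 sg1 ->]]].
have [[M1 b1] d1 m1] := schwartz_real_class sf1.
have [[M2 b2] d2 m2] := schwartz_real_class sg1.
split.
- by exists (M1 + M2) => x; apply: le_trans (ler_normD _ _) _; exact: lerD.
- move=> i; have [p1 sp1 H1] := d1 i; have [p2 sp2 H2] := d2 i.
  exists (fun x => p1 x + p2 x); first by exists p1, p2.
  by move=> x; exact: (is_deriveD (H1 x) (H2 x)).
- move=> i; exists (mulX i f1), (mulX i g1); split => //.
  by apply/funext => x; rewrite /mulX mulrDr.
Qed.

End schwartz_classes.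

(** * Complex Schwartz functions and their decay *)

Section complex_schwartz.
Variables (R : realType) (m : nat).
Local Notation V := 'rV[R]_m.
Local Notation e_ i := (delta_mx 0 i : V).
Local Notation Re := complex.Re.
Local Notation Im := complex.Im.
Implicit Types (f g : V -> R[i]) (x : V).

Definition cpartial (i : 'I_m) f x : R[i] :=
  'D_(e_ i) (fun y => Re (f y)) x +i* 'D_(e_ i) (fun y => Im (f y)) x.

Definition cmulX (i : 'I_m) f x : R[i] := (x 0 i)%:C * f x.

Definition is_cpartial (i : 'I_m) f x (v : R[i]) : Prop :=
  is_derive x (e_ i) (fun y => Re (f y)) (Re v) /\
  is_derive x (e_ i) (fun y => Im (f y)) (Im v).

Lemma schwartz_cpartial f i : schwartz f -> schwartz (cpartial i f).
Proof. by move=> [sr si]; split; exact: schwartz_real_partial. Qed.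

Lemma schwartz_cmulX f i : schwartz f -> schwartz (cmulX i f).
Proof.
move=> [sr si]; split.
- rewrite (_ : (fun _ => _) = mulX i (fun y => Re (f y))).
    exact: schwartz_real_mulX.
  by apply/funext => x; rewrite cReZ.
- rewrite (_ : (fun _ => _) = mulX i (fun y => Im (f y))).
    exact: schwartz_real_mulX.
  by apply/funext => x; rewrite cImZ.
Qed.

Lemma schwartzD f g : schwartz f -> schwartz g -> schwartz (fun x => f x + g x).
Proof.
move=> [fr fi] [gr gi]; split.
- by under eq_fun do rewrite cReD; exact: schwartz_realD.
- by under eq_fun do rewrite cImD; exact: schwartz_realD.
Qed.

Lemma schwartzZ (c : R[i]) f : schwartz f -> schwartz (fun x => c * f x).
Proof.
move=> [fr fi]; split.
- under eq_fun do rewrite cReM -mulNr.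
  by apply: schwartz_realD; exact: schwartz_real_scale.
- under eq_fun do rewrite cImM.
  by apply: schwartz_realD; exact: schwartz_real_scale.
Qed.

Lemma schwartz_zero : schwartz ((fun=> 0) : V -> R[i]).
Proof.
pose C (h : V -> R) := h = fun=> 0.
suff s0 : schwartz_real ((fun=> 0) : V -> R) by split.
apply: (@schwartz_class_schwartz _ _ C) => // _ ->; split.
- by exists 0 => x; rewrite normr0.
- by move=> i; exists (fun=> 0) => // x; exact: is_derive_cst.
- by move=> i; apply/funext => x; rewrite /mulX mulr0.
Qed.

Lemma schwartz_sum (I : Type) (r : seq I) (F : I -> V -> R[i]) :
  (forall i, schwartz (F i)) -> schwartz (fun x => \sum_(i <- r) F i x).
Proof.
move=> sF; elim: r => [|i r IH].
  by under eq_fun do rewrite big_nil; exact: schwartz_zero.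
by under eq_fun do rewrite big_cons; exact: schwartzD.
Qed.

Lemma schwartz_is_cpartial f i x : schwartz f ->
  is_cpartial i f x (cpartial i f x).
Proof.
by move=> [fr fi]; split; apply: is_derive_diff; [exact: (fr.1 [::])|exact: (fi.1 [::])].
Qed.

Lemma schwartz_bounded f : schwartz f -> exists M, forall x, norm1c (f x) <= M.
Proof.
move=> [fr fi].
have [[M1 b1] _ _] := schwartz_real_class fr.
have [[M2 b2] _ _] := schwartz_real_class fi.
by exists (M1 + M2) => x; exact: lerD.
Qed.

Lemma schwartz_continuous f : schwartz f ->
  continuous (fun x => Re (f x)) /\ continuous (fun x => Im (f x)).
Proof.
by move=> [[fr _] [fi _]]; split => x; apply: differentiable_continuous;
  [exact: (fr [::])|exact: (fi [::])].
Qed.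

Lemma schwartz_cmeasurable f : schwartz f ->
  cmeasurable (fun t : tupleR R m => f (rV_of t)).
Proof.
by move=> /schwartz_continuous[cr ci]; split; [exact: (continuous_measurable_rV cr)|exact: (continuous_measurable_rV ci)].
Qed.

Definition cschwartz_class (C : (V -> R[i]) -> Prop) : Prop := forall f, C f ->
  [/\ exists M, forall x, norm1c (f x) <= M,
      forall i, exists2 g, C g & forall x, is_cpartial i f x (g x) &
      forall i, C (cmulX i f)].

(** The real and imaginary parts of the members of [C] together form a real class. *)
Lemma cschwartz_class_schwartz (C : (V -> R[i]) -> Prop) f :
  cschwartz_class C -> C f -> schwartz f.
Proof.
move=> SC Cf.
pose D h := exists2 f, C f & h = (fun x => Re (f x)) \/ h = (fun x => Im (f x)).
have SD : schwartz_class D.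
  move=> h [g Cg gh]; have [[M b] d mu] := SC g Cg; case: gh => ->; split.
  - by exists M => x; apply: le_trans (b x); exact: Re_le_norm1c.
  - move=> i; have [p Cp Hp] := d i; exists (fun x => Re (p x)).
      by exists p => //; left.
    by move=> x; have [] := Hp x.
  - move=> i; exists (cmulX i g) => //; left.
    by apply/funext => x; rewrite /mulX cReZ.
  - by exists M => x; apply: le_trans (b x); exact: Im_le_norm1c.
  - move=> i; have [p Cp Hp] := d i; exists (fun x => Im (p x)).
      by exists p => //; right.
    by move=> x; have [] := Hp x.
  - move=> i; exists (cmulX i g) => //; right.
    by apply/funext => x; rewrite /mulX cImZ.
split; apply: (schwartz_class_schwartz SD); exists f => //; [by left|by right].
Qed.

(** The square of the Japanese bracket. Being a polynomial, it and its powers preserve Schwartz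
    functions under multiplication. *)
Definition jb x : R := 1 + dotr x x.

Lemma dotr_ge0 x : 0 <= dotr x x.
Proof. by apply: sumr_ge0 => i _; rewrite -expr2 sqr_ge0. Qed.

Lemma jb_ge1 x : 1 <= jb x. Proof. by rewrite lerDl dotr_ge0. Qed.
Lemma jb_gt0 x : 0 < jb x. Proof. exact: lt_le_trans ltr01 (jb_ge1 x). Qed.

Lemma schwartz_jb f N : schwartz f -> schwartz (fun x => (jb x ^+ N)%:C * f x).
Proof.
move=> sf; elim: N => [|N IH].
  by under eq_fun do rewrite expr0 mul1r.
rewrite (_ : (fun _ => _) = (fun x => (jb x ^+ N)%:C * f x +
    \sum_i cmulX i (cmulX i (fun x => (jb x ^+ N)%:C * f x)) x)).
  apply: schwartzD => //.
  apply: (@schwartz_sum _ _ (fun i => cmulX i (cmulX i (fun x => (jb x ^+ N)%:C * f x)))) => i.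
  exact/schwartz_cmulX/schwartz_cmulX.
apply/funext => x; set u := (_ ^+ N)%:C * f x.
rewrite exprS realC_M -mulrA -/u {1}/jb realC_D mulrDl mul1r; congr (_ + _).
rewrite /dotr rmorph_sum mulr_suml; apply: eq_bigr => i _.
by rewrite /cmulX -/u rmorphM mulrA.
Qed.

Lemma schwartz_decay f N : schwartz f ->
  exists2 C, 0 <= C & forall x, norm1c (f x) <= C / jb x ^+ N.
Proof.
move=> /(schwartz_jb N)/schwartz_bounded[M HM]; exists `|M| => // x.
rewrite ler_pdivlMr ?exprn_gt0 ?jb_gt0// mulrC.
have h : 0 <= jb x ^+ N by rewrite exprn_ge0// ltW// jb_gt0.
have := HM x; rewrite norm1cZ (ger0_norm h) => /le_trans; apply.
exact: ler_norm.
Qed.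

(** Each of the [m] factors [1 + x_i^2] is at most [jb x], so the exponent [m] is enough for
    integrability over R^m. *)
Lemma jb_weight (t : tupleR R m) N : (m <= N)%N -> (jb (rV_of t) ^+ N)^-1 <= weight t.
Proof.
move=> mN; rewrite /weight prodfV lef_pV2 ?posrE ?exprn_gt0 ?jb_gt0//; last first.
  by apply: prodr_gt0 => i _; apply: (lt_le_trans ltr01); exact: oneDsqr_ge1.
apply: (@le_trans _ _ (jb (rV_of t) ^+ m)); last by apply: ler_weXn2l => //; exact: jb_ge1.
have -> : jb (rV_of t) ^+ m = \prod_(i < m) jb (rV_of t) by rewrite prodr_const card_ord.
apply: ler_prod => i _; rewrite (le_trans ler01 (oneDsqr_ge1 _)) /=.
rewrite /oneDsqr /jb lerD2l /dotr (bigD1 i)//= !rV_ofE expr2 lerDl.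
by apply: sumr_ge0 => j _; rewrite -expr2 sqr_ge0.
Qed.

Lemma measurable_dotr (k : nat) : measurable_fun setT
  (fun p : tupleR R k * tupleR R k => dotr (rV_of p.1) (rV_of p.2)).
Proof.
rewrite (_ : (fun _ => _) = fun p : tupleR R k * tupleR R k =>
    \sum_(i < k) (tnth p.1 i : R) * tnth p.2 i); last first.
  by apply/funext => p; apply: eq_bigr => i _; rewrite !rV_ofE.
apply: measurable_sum => i; apply: measurable_funM.
- exact: (measurableT_comp (measurable_tnth i) measurable_fst).
- exact: (measurableT_comp (measurable_tnth i) measurable_snd).
Qed.

Lemma measurable_jb : measurable_fun setT (fun t : tupleR R m => jb (rV_of t)).
Proof.
apply: measurable_funD => //.
have mp : measurable_fun setT (fun t : tupleR R m => (t, t)).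
  exact: measurable_fun_pair.
exact: (measurableT_comp (@measurable_dotr m) mp).
Qed.

Lemma measurable_jbV N : measurable_fun setT
  (fun t : tupleR R m => (jb (rV_of t) ^+ N)^-1).
Proof.
(* The reciprocal is written as a real power of exponent -1, which is measurable on the whole line;
   the two agree on nonnegative numbers. *)
rewrite (_ : (fun _ => _) = fun t : tupleR R m => (jb (rV_of t) ^+ N) `^ (-1)).
  apply: (@measurableT_comp _ _ _ _ _ _ (fun x : R => x `^ (-1))).
    exact: measurable_powR.
  by apply: measurable_funX; exact: measurable_jb.
by apply/funext => t; rewrite powR_inv1// exprn_ge0// ltW// jb_gt0.
Qed.

Lemma integrable_jb N : (m <= N)%N ->
  (lebesgue_tuple R m).-integrable setT (EFin \o (fun t => (jb (rV_of t) ^+ N)^-1)).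
Proof.
move=> mN.
apply: (@integrable_dom R _ _ (lebesgue_tuple R m) _ (@weight R m)).
- exact: measurable_jbV.
- exact: integrable_weight.
- move=> t; rewrite ger0_norm; first exact: jb_weight.
  by rewrite invr_ge0 exprn_ge0// ltW// jb_gt0.
Qed.

End complex_schwartz.

(** * Fourier transforms of Schwartz functions *)

Section partial_fourier_schwartz.
Variables (R : realType) (k s : nat).
Local Notation Re := complex.Re.
Local Notation Im := complex.Im.
Local Notation V := 'rV[R]_(k + s).
Local Notation lebs := (lebesgue_tuple R s).
Implicit Types (phi psi : V -> R[i]) (x : 'rV[R]_k) (z theta : 'rV[R]_s).

Lemma rV_of_cat (a : tupleR R k) (b : tupleR R s) :
  rV_of (cat_pair (a, b)) = row_mx (rV_of a) (rV_of b).
Proof.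
apply/rowP => i; rewrite rV_ofE; have [j|j] := split_ordP i => ->.
- by rewrite row_mxEl rV_ofE (tnth_nth 0) /= nth_cat size_tuple ltn_ord -tnth_nth.
- rewrite row_mxEr rV_ofE (tnth_nth 0) /= nth_cat size_tuple ltnNge leq_addr /=.
  by rewrite addKn -tnth_nth.
Qed.

Lemma dotr_row (a c : 'rV[R]_k) (b d : 'rV[R]_s) :
  dotr (row_mx a b) (row_mx c d) = dotr a c + dotr b d.
Proof.
rewrite /dotr big_split_ord /=; congr (_ + _); apply: eq_bigr => i _.
- by rewrite !row_mxEl.
- by rewrite !row_mxEr.
Qed.

(** Both [jb x] and [jb z] are at most [jb (row_mx x z)]. Joint decay thus becomes a product of
    decays, the form that Fubini asks for. *)
Lemma jb_row_ge x z N M : jb x ^+ N * jb z ^+ M <= jb (row_mx x z) ^+ (N + M).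
Proof.
have hx : jb x <= jb (row_mx x z) by rewrite /jb dotr_row addrA lerDl dotr_ge0.
have hz : jb z <= jb (row_mx x z).
  by rewrite /jb dotr_row addrCA lerDr dotr_ge0.
rewrite exprD ler_pM ?exprn_ge0 ?(ltW (jb_gt0 _))//.
- by rewrite lerXn2r ?nnegrE ?(ltW (jb_gt0 _)).
- by rewrite lerXn2r ?nnegrE ?(ltW (jb_gt0 _)).
Qed.

Lemma schwartz_decay_row phi N M : schwartz phi -> exists2 C, 0 <= C &
  forall x z, norm1c (phi (row_mx x z)) <= C / jb x ^+ N / jb z ^+ M.
Proof.
move=> /(schwartz_decay (N + M))[C C0 HC]; exists C => // x z.
apply: le_trans (HC _) _; rewrite -mulrA -invfM ler_wpM2l//.
rewrite lef_pV2 ?posrE ?mulr_gt0 ?exprn_gt0 ?jb_gt0//.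
by rewrite mulrC; rewrite mulrC; exact: jb_row_ge.
Qed.

Lemma row_mx_line_l x z i (u : R) :
  row_mx (x + u *: delta_mx 0 i) z = row_mx x z + u *: (delta_mx 0 (lshift s i) : V).
Proof.
apply/rowP => j; have [l|l] := split_ordP j => ->; rewrite [RHS]mxE.
- by rewrite !row_mxEl !mxE (inj_eq (@lshift_inj _ _)).
- by rewrite !row_mxEr !mxE eq_rlshift mulr0 addr0.
Qed.

Lemma row_mx_line_r x z j (u : R) :
  row_mx x (z + u *: delta_mx 0 j) = row_mx x z + u *: (delta_mx 0 (rshift k j) : V).
Proof.
apply/rowP => i; have [l|l] := split_ordP i => ->; rewrite [RHS]mxE.
- by rewrite !row_mxEl !mxE eq_lrshift mulr0 addr0.
- by rewrite !row_mxEr !mxE (inj_eq (@rshift_inj _ _)).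
Qed.

Lemma schwartz_row_cmeasurable phi : schwartz phi ->
  cmeasurable (fun p : tupleR R k * tupleR R s => phi (row_mx (rV_of p.1) (rV_of p.2))).
Proof.
move=> /schwartz_cmeasurable sf.
have := cmeasurable_comp sf (@measurable_cat_pair R k s).
rewrite (_ : (fun _ => _) = (fun p : tupleR R k * tupleR R s => phi (row_mx (rV_of p.1) (rV_of p.2))))//.
by apply/funext => -[a b]; rewrite rV_of_cat.
Qed.

Definition pf_kernel phi x theta (t : tupleR R s) : R[i] :=
  phi (row_mx x (rV_of t)) * cexpi (- dotr (rV_of t) theta).

(** Joint measurability in the two parameters and the integration variable; measurability of the
    transform itself follows by integrating out the last one. *)
Lemma pf_kernel_cmeasurable3 phi : schwartz phi ->
  cmeasurable (fun p : (tupleR R k * tupleR R s) * tupleR R s =>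
    pf_kernel phi (rV_of p.1.1) (rV_of p.1.2) p.2).
Proof.
move=> sf; apply: cmeasurableM.
- have mp : measurable_fun setT (fun p : (tupleR R k * tupleR R s) * tupleR R s =>
      (p.1.1, p.2)).
    apply: measurable_fun_pair; last exact: measurable_snd.
    exact: (measurableT_comp measurable_fst measurable_fst).
  exact: (cmeasurable_comp (schwartz_row_cmeasurable sf) mp).
- apply: cmeasurable_cexpi; apply: measurableT_comp => //.
  have mp : measurable_fun setT (fun p : (tupleR R k * tupleR R s) * tupleR R s =>
      (p.2, p.1.2)).
    apply: measurable_fun_pair; first exact: measurable_snd.
    exact: (measurableT_comp measurable_snd measurable_fst).
  exact: (measurableT_comp (@measurable_dotr R s) mp).
Qed.

Lemma pf_kernel_cmeasurable phi x theta : schwartz phi ->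
  cmeasurable (pf_kernel phi x theta).
Proof.
move=> sf; have := cmeasurable_comp (pf_kernel_cmeasurable3 sf)
  (pair1_measurable (tuple_of_rV x, tuple_of_rV theta)).
by under eq_fun do rewrite /= !rV_of_surj.
Qed.

Lemma norm1c_mul_cexpi (w : R[i]) (a : R) : norm1c (w * cexpi a) <= norm1c w * 2.
Proof.
apply: le_trans (norm1cM _ _) _; apply: ler_wpM2l; first exact: norm1c_ge0.
exact: norm1c_cexpi.
Qed.

(** The bound is uniform in [theta], and for [N = 0] also in [x], so it dominates derivatives of the
    kernel along whole lines. *)
Lemma pf_kernel_dom phi N : schwartz phi -> exists2 C, 0 <= C &
  forall x theta t, norm1c (pf_kernel phi x theta t) <=
    C / jb x ^+ N * (jb (rV_of t) ^+ s)^-1.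
Proof.
move=> /(schwartz_decay_row N s)[C C0 HC]; exists (C * 2); first by rewrite mulr_ge0.
move=> x theta t; apply: le_trans (norm1c_mul_cexpi _ _) _.
by rewrite [C * 2]mulrC -!mulrA mulrC ler_wpM2l// mulrA; exact: HC.
Qed.

Lemma integrable_jb_scale (C : R) :
  lebs.-integrable setT (EFin \o (fun t => C * (jb (rV_of t) ^+ s)^-1)).
Proof. exact: (integrableZl measurableT C (@integrable_jb R s s (leqnn s))). Qed.

Lemma pf_kernel_integrable phi x theta : schwartz phi ->
  cintegrable lebs setT (pf_kernel phi x theta).
Proof.
move=> sf; have [C C0 HC] := pf_kernel_dom 0 sf.
apply: (cintegrable_dom (pf_kernel_cmeasurable x theta sf) (integrable_jb_scale _)).
exact: HC.
Qed.

Definition pf_const : R[i] := ((2 * pi) `^ (- (s%:R / 2)) : R)%:C.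

Lemma partial_fourierE phi x theta : partial_fourier phi x theta =
  pf_const * cintegral lebs setT (pf_kernel phi x theta).
Proof. by []. Qed.

Lemma partial_fourierD phi psi x theta : schwartz phi -> schwartz psi ->
  partial_fourier (fun v => phi v + psi v) x theta =
  partial_fourier phi x theta + partial_fourier psi x theta.
Proof.
move=> sf sg; rewrite !partial_fourierE -mulrDr -cintegralD//;
  try exact: pf_kernel_integrable.
by congr (_ * _); congr cintegral; apply/funext => t; rewrite /pf_kernel mulrDl.
Qed.

Lemma partial_fourierZ (c : R[i]) phi x theta : schwartz phi ->
  partial_fourier (fun v => c * phi v) x theta = c * partial_fourier phi x theta.
Proof.
move=> sf; rewrite !partial_fourierE mulrCA -[X in _ = _ * X]cintegralZ; last exact: pf_kernel_integrable.
by congr (_ * _); congr cintegral; apply/funext => t; rewrite /pf_kernel mulrA.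
Qed.

Lemma partial_fourier0 x theta :
  partial_fourier ((fun=> 0) : V -> R[i]) x theta = 0.
Proof.
rewrite partial_fourierE (_ : pf_kernel _ _ _ = fun=> 0) ?cintegral0 ?mulr0//.
by apply/funext => t; rewrite /pf_kernel mul0r.
Qed.

Lemma partial_fourier_sum (I : Type) (r : seq I) (F : I -> V -> R[i]) x theta :
  (forall i, schwartz (F i)) ->
  partial_fourier (fun v => \sum_(i <- r) F i v) x theta =
  \sum_(i <- r) partial_fourier (F i) x theta.
Proof.
move=> sF; elim: r => [|i r IH].
  under [X in partial_fourier X]eq_fun do rewrite big_nil.
  by rewrite big_nil; exact: partial_fourier0.
under [X in partial_fourier X]eq_fun do rewrite big_cons.
rewrite big_cons -IH partial_fourierD//; exact: schwartz_sum.
Qed.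

Lemma partial_fourier_cmulX phi x theta i : schwartz phi ->
  partial_fourier (cmulX (lshift s i) phi) x theta =
  (x 0 i)%:C * partial_fourier phi x theta.
Proof.
move=> sf; rewrite !partial_fourierE mulrCA -[X in _ = _ * X]cintegralZ; last exact: pf_kernel_integrable.
congr (_ * _); congr cintegral; apply/funext => t.
by rewrite /pf_kernel /cmulX row_mxEl mulrA.
Qed.

Lemma partial_fourier_bounded phi N : schwartz phi -> exists2 C, 0 <= C &
  forall x theta, norm1c (partial_fourier phi x theta) <= C / jb x ^+ N.
Proof.
move=> sf; have [C C0 HC] := pf_kernel_dom N sf.
pose J := \int[lebs]_t (jb (rV_of t) ^+ s)^-1.
have J0 : 0 <= J.
  by apply: Rintegral_ge0 => t _; rewrite invr_ge0 exprn_ge0// ltW// jb_gt0.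
exists (norm1c pf_const * (C * J)); first by rewrite !mulr_ge0// norm1c_ge0.
move=> x theta; rewrite partial_fourierE; apply: le_trans (norm1cM _ _) _.
rewrite -!mulrA ler_wpM2l ?norm1c_ge0//.
apply: le_trans (norm1c_cintegral (pf_kernel_cmeasurable x theta sf)
  (integrable_jb_scale _) (HC x theta)) _.
by rewrite RintegralZl ?mulrA 1?mulrAC//; exact: integrable_jb.
Qed.

Lemma is_cderive_line (m : nat) (f : 'rV[R]_m -> R[i]) (i : 'I_m) : schwartz f ->
  forall (x : 'rV[R]_m) (u : R), is_cderive (fun u => f (x + u *: delta_mx 0 i)) u
    (cpartial i f (x + u *: delta_mx 0 i)).
Proof.
move=> sf x u; split.
- have := (is_derive_line (fun y => Re (f y)) (fun y => Re (cpartial i f y))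
    (delta_mx 0 i)).1 (fun y => (schwartz_is_cpartial i y sf).1) x u.
  exact.
- have := (is_derive_line (fun y => Im (f y)) (fun y => Im (cpartial i f y))
    (delta_mx 0 i)).1 (fun y => (schwartz_is_cpartial i y sf).2) x u.
  exact.
Qed.

Lemma partial_fourier_is_cderive_l phi x theta i (u : R) : schwartz phi ->
  is_cderive (fun u => partial_fourier phi (x + u *: delta_mx 0 i) theta) u
    (partial_fourier (cpartial (lshift s i) phi) (x + u *: delta_mx 0 i) theta).
Proof.
move=> sf; have sp := schwartz_cpartial (lshift s i) sf.
have [C C0 HC] := pf_kernel_dom 0 sp.
apply: (is_cderive_eq (is_cderiveM (is_cderive_cst pf_const u) _)); last first.
  by rewrite mul0r add0r.
apply: (is_cderive_cintegral (f := fun u => pf_kernel phi (x + u *: delta_mx 0 i) theta)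
  (df := fun u => pf_kernel (cpartial (lshift s i) phi) (x + u *: delta_mx 0 i) theta)
  _ _ _ (integrable_jb_scale _)).
- by move=> y; exact: pf_kernel_integrable.
- move=> y t; rewrite /pf_kernel.
  apply: (is_cderive_eq (is_cderiveM _ (is_cderive_cst _ y))); last first.
    by rewrite mulr0 addr0.
  rewrite row_mx_line_l; under eq_fun do rewrite row_mx_line_l.
  exact: is_cderive_line.
- move=> y t; apply: le_trans (HC _ _ _) _.
  by rewrite expr0 divr1.
Qed.

Lemma dotrZr (m : nat) (a b : 'rV[R]_m) (u : R) : dotr a (u *: b) = u * dotr a b.
Proof.
by rewrite /dotr mulr_sumr; apply: eq_bigr => i _; rewrite mxE mulrCA.
Qed.

(** Differentiating the exponential in [r] brings down [-i] times the sum of the [omega_j z_j]. The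
    sum is kept outside, with the [omega_j] as coefficients: they become the weights of [radial]. *)
Lemma partial_fourier_is_cderive_r phi x (omega : 'rV[R]_s) (r : R) : schwartz phi ->
  is_cderive (fun r => partial_fourier phi x (r *: omega)) r
    (\sum_j (omega 0 j)%:C *
      partial_fourier (fun v => - 'i%C * cmulX (rshift k j) phi v) x (r *: omega)).
Proof.
move=> sf.
have sX j := schwartz_cmulX (rshift k j) sf.
have sp : schwartz (fun v => \sum_j (- 'i%C * (omega 0 j)%:C) * cmulX (rshift k j) phi v).
  by apply: (@schwartz_sum _ _ _ _ (fun j v => (- 'i%C * (omega 0 j)%:C) *
    cmulX (rshift k j) phi v)) => j; exact: schwartzZ.
have [C C0 HC] := pf_kernel_dom 0 sp.
apply: (is_cderive_eq (is_cderiveM (is_cderive_cst pf_const r) (_ : is_cderive _ r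
  (cintegral lebs setT (pf_kernel
    (fun v => \sum_j (- 'i%C * (omega 0 j)%:C) * cmulX (rshift k j) phi v) x (r *: omega)))))); last first.
  rewrite mul0r add0r -partial_fourierE partial_fourier_sum; last first.
    by move=> j; exact: schwartzZ.
  apply: eq_bigr => j _; rewrite !partial_fourierZ//; ring.
apply: (is_cderive_cintegral (f := fun r => pf_kernel phi x (r *: omega))
  (df := fun r => pf_kernel (fun v => \sum_j (- 'i%C * (omega 0 j)%:C) *
     cmulX (rshift k j) phi v) x (r *: omega))
  _ _ _ (integrable_jb_scale _)).
- by move=> y; exact: pf_kernel_integrable.
- move=> y t; rewrite /pf_kernel.
  under eq_fun do rewrite dotrZr -mulrN.
  apply: (is_cderive_eq (is_cderiveM (is_cderive_cst _ y) (is_cderive_cexpi_linear _ y))).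
  rewrite mul0r add0r dotrZr -mulrN mulrA; congr (_ * _).
  rewrite /cmulX; under eq_bigr do rewrite row_mxEr.
  rewrite /dotr rmorphN mulrN -mulNr mulrA rmorph_sum mulr_sumr.
  by apply: eq_bigr => j _; rewrite rmorphM /=; ring.
- by move=> y t; apply: le_trans (HC _ _ _) _; rewrite expr0 divr1.
Qed.

End partial_fourier_schwartz.

(** * Decay of the partial Fourier transform in the dual variable *)

Section partial_fourier_decay.
Variables (R : realType) (k s : nat).
Local Notation Re := complex.Re.
Local Notation Im := complex.Im.
Local Notation V := 'rV[R]_(k + s).
Local Notation lebs := (lebesgue_tuple R s).
Implicit Types (phi psi : V -> R[i]) (x : 'rV[R]_k) (z theta : 'rV[R]_s).

Lemma is_cderive_continuous (f df : R -> R[i]) :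
  (forall u : R, is_cderive f u (df u)) ->
  continuous (fun u => Re (f u)) /\ continuous (fun u => Im (f u)).
Proof.
move=> H; split.
- by apply: (@derive_continuous R _ (fun u => Re (df u))) => u; have [] := H u.
- by apply: (@derive_continuous R _ (fun u => Im (df u))) => u; have [] := H u.
Qed.

Lemma rV_of_tset m (t : tupleR R m) j (y : R) :
  rV_of (tset t j y) = rV_of (tset t j 0) + y *: delta_mx 0 j.
Proof.
apply/rowP => i; rewrite !mxE !tnth_mktuple eqxx /=.
by case: eqVneq => _; rewrite ?mulr1 ?add0r ?mulr0 ?addr0.
Qed.

Lemma dotr_line_l (m : nat) (a b : 'rV[R]_m) j (y : R) :
  dotr (a + y *: delta_mx 0 j) b = dotr a b + y * b 0 j.
Proof.
rewrite /dotr [in RHS](bigD1 j)//= [LHS](bigD1 j)//= !mxE !eqxx mulr1 mulrDl.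
rewrite -!addrA; congr (_ + _); rewrite addrC; congr (_ + _).
by apply: eq_bigr => i ij; rewrite !mxE eqxx (negPf ij) mulr0 addr0.
Qed.

Lemma pf_kernel_tset_is_cderive phi x theta t j (y : R) : schwartz phi ->
  is_cderive (fun y => pf_kernel phi x theta (tset t j y)) y
    (pf_kernel (fun v => cpartial (rshift k j) phi v - 'i%C * (theta 0 j)%:C * phi v)
       x theta (tset t j y)).
Proof.
move=> sf; rewrite /pf_kernel.
under eq_fun do rewrite rV_of_tset row_mx_line_r dotr_line_l opprD -mulrN.
have H : is_derive y (1 : R) (fun u : R => - dotr (rV_of (tset t j 0)) theta + u * - theta 0 j)
  (- theta 0 j) by exact: is_derive_affine.
apply: (is_cderive_eq (is_cderiveM (is_cderive_line (rshift k j) sf _ y)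
  (is_cderive_cexpi H))).
rewrite !(rV_of_tset t j y) row_mx_line_r dotr_line_l opprD -[- (y * _)]mulrN rmorphN.
by rewrite /=; ring.
Qed.

(** The kernel of [psi] below is the derivative in [z_j] of the kernel of [phi], so its integral is
    zero. *)
Lemma partial_fourier_cpartial_r phi x theta j : schwartz phi ->
  partial_fourier (cpartial (rshift k j) phi) x theta =
  'i%C * (theta 0 j)%:C * partial_fourier phi x theta.
Proof.
move=> sf; have sp := schwartz_cpartial (rshift k j) sf.
pose psi v := cpartial (rshift k j) phi v - 'i%C * (theta 0 j)%:C * phi v.
have psiE : psi = (fun v => cpartial (rshift k j) phi v + (- ('i%C * (theta 0 j)%:C)) * phi v).
  by apply/funext => v; rewrite /psi mulNr.
have spsi : schwartz psi by rewrite psiE; apply: schwartzD => //; exact: schwartzZ.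
suff psi0 : partial_fourier psi x theta = 0.
  move: psi0; rewrite psiE partial_fourierD//; last exact: schwartzZ.
  by rewrite partial_fourierZ// mulNr => /eqP; rewrite subr_eq0 => /eqP.
rewrite partial_fourierE (_ : cintegral _ _ _ = 0) ?mulr0//.
have [C1 C10 H1] := pf_kernel_dom 0 sf.
have [C2 C20 H2] := pf_kernel_dom 0 spsi.
(* [Rintegral_partial_derive] takes one constant for the function and its derivative, hence the sum
   [C1 + C2]. *)
have W1 t : norm1c (pf_kernel phi x theta t) <= (C1 + C2) * weight t.
  apply: le_trans (H1 _ _ _) _; rewrite expr0 divr1.
  by rewrite ler_pM ?invr_ge0 ?exprn_ge0 ?(ltW (jb_gt0 _)) ?lerDl ?jb_weight.
have W2 t : norm1c (pf_kernel psi x theta t) <= (C1 + C2) * weight t.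
  apply: le_trans (H2 _ _ _) _; rewrite expr0 divr1.
  by rewrite ler_pM ?invr_ge0 ?exprn_ge0 ?(ltW (jb_gt0 _)) ?lerDr ?jb_weight.
have [m1 m2] := pf_kernel_cmeasurable x theta spsi.
have D t y := pf_kernel_tset_is_cderive x theta t j y sf.
have cD t := is_cderive_continuous (fun y => pf_kernel_tset_is_cderive x theta t j y spsi).
apply: complex_ext => /=.
- apply: (Rintegral_partial_derive (F := fun t => Re (pf_kernel phi x theta t)) m1
    (fun t y => (D t y).1) (fun t => (cD t).1) (C := C1 + C2)) => t.
  + by apply: le_trans (W1 t); exact: Re_le_norm1c.
  + by apply: le_trans (W2 t); exact: Re_le_norm1c.
- apply: (Rintegral_partial_derive (F := fun t => Im (pf_kernel phi x theta t)) m2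
    (fun t y => (D t y).2) (fun t => (cD t).2) (C := C1 + C2)) => t.
  + by apply: le_trans (W1 t); exact: Im_le_norm1c.
  + by apply: le_trans (W2 t); exact: Im_le_norm1c.
Qed.

(** Applying [1 - Laplacian] in z a total of N times to [phi] multiplies the transform by
    [jb theta ^+ N]; the minus sign comes from [i^2]. Boundedness of the new transform is then decay
    of the old one. *)
Lemma partial_fourier_jb phi N : schwartz phi -> exists2 psi, schwartz psi &
  forall x theta, partial_fourier psi x theta =
    (jb theta ^+ N)%:C * partial_fourier phi x theta.
Proof.
move=> sf; elim: N => [|N [psi spsi IH]].
  by exists phi => // x theta; rewrite expr0 mul1r.
have sd j := schwartz_cpartial (rshift k j) (schwartz_cpartial (rshift k j) spsi).
exists (fun v => psi v + \sum_(j < s) (-1) * cpartial (rshift k j) (cpartial (rshift k j) psi) v).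
  apply: schwartzD => //.
  apply: (@schwartz_sum _ _ _ _ (fun j v => -1 *
    cpartial (rshift k j) (cpartial (rshift k j) psi) v)) => j.
  exact: schwartzZ.
move=> x theta; rewrite partial_fourierD//; last first.
  apply: (@schwartz_sum _ _ _ _ (fun j v => -1 *
    cpartial (rshift k j) (cpartial (rshift k j) psi) v)) => j.
  exact: schwartzZ.
rewrite partial_fourier_sum; last by move=> j; exact: schwartzZ.
rewrite exprS realC_M -mulrA -IH /jb realC_D mulrDl mul1r; congr (_ + _).
rewrite /dotr rmorph_sum mulr_suml; apply: eq_bigr => j _.
rewrite partial_fourierZ// !partial_fourier_cpartial_r//; last exact: schwartz_cpartial.
rewrite rmorphM /=; move: (partial_fourier psi x theta) (theta 0 j)%:C => u c.
have -> : 'i%C * c * ('i%C * c * u) = 'i%C ^+ 2 * (c * c * u) by ring.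
by rewrite sqr_i !mulN1r opprK.
Qed.

Lemma partial_fourier_decay phi N M : schwartz phi -> exists2 C, 0 <= C &
  forall x theta, norm1c (partial_fourier phi x theta) <= C / jb x ^+ N / jb theta ^+ M.
Proof.
move=> sf; have [psi spsi E] := partial_fourier_jb M sf.
have [C C0 HC] := partial_fourier_bounded N spsi.
exists C => // x theta; rewrite ler_pdivlMr ?exprn_gt0 ?jb_gt0// mulrC.
have h : 0 <= jb theta ^+ M by rewrite exprn_ge0// ltW// jb_gt0.
by have := HC x theta; rewrite E norm1cZ (ger0_norm h).
Qed.

Lemma partial_fourier_cmeasurable phi : schwartz phi ->
  cmeasurable (fun p : tupleR R k * tupleR R s =>
    partial_fourier phi (rV_of p.1) (rV_of p.2)).
Proof.
move=> sf; apply: cmeasurableM; first exact: cmeasurable_cst.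
exact: (cmeasurable_cintegral lebs (pf_kernel_cmeasurable3 sf)).
Qed.

End partial_fourier_decay.

(** * The full Fourier transform *)

Section fourier_decay.
Variables (R : realType) (m : nat).

(** With [k = 0] no variable is left untransformed, so decay and measurability of the full transform
    are special cases of the partial ones. *)
Lemma fourier_partial_fourier (f : 'rV[R]_m -> R[i]) theta :
  fourier f theta = partial_fourier (f : 'rV[R]_(0 + m) -> R[i]) 0 theta.
Proof.
congr (fourier _ theta); apply/funext => z.
by rewrite row_thin_mx.
Qed.

Lemma fourier_decay (f : 'rV[R]_m -> R[i]) N : schwartz f -> exists2 C, 0 <= C &
  forall theta, norm1c (fourier f theta) <= C / jb theta ^+ N.
Proof.
move=> sf; have [C C0 HC] := @partial_fourier_decay R 0 m f 0 N sf.
exists C => // theta; rewrite fourier_partial_fourier.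
by apply: le_trans (HC _ _) _; rewrite expr0 divr1.
Qed.

Lemma fourier_cmeasurable (f : 'rV[R]_m -> R[i]) : schwartz f ->
  cmeasurable (fun t : tupleR R m => fourier f (rV_of t)).
Proof.
move=> sf.
have := cmeasurable_comp (@partial_fourier_cmeasurable R 0 m f sf)
  (pair1_measurable (tuple_of_rV (0 : 'rV[R]_0))).
by under eq_fun do rewrite /= rV_of_surj -fourier_partial_fourier.
Qed.

End fourier_decay.

Section fourier_split.
Variables (R : realType) (k s : nat).
Implicit Types (phi : 'rV[R]_(k + s) -> R[i]).

Lemma powR_pi_split : ((2 * pi) `^ (- ((k + s)%:R / 2)) : R) =
  (2 * pi) `^ (- (k%:R / 2)) * (2 * pi) `^ (- (s%:R / 2)).
Proof.
rewrite -powRD; last by apply/implyP => _; rewrite mulf_neq0// gt_eqF// pi_gt0.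
by congr (_ `^ _); rewrite natrD; lra.
Qed.

(** Fubini, together with two additivities: of the scalar product in the phase, and of the dimension
    in the exponent of [2 pi]. *)
Lemma fourier_row phi (xi : 'rV[R]_k) (theta : 'rV[R]_s) : schwartz phi ->
  fourier phi (row_mx xi theta) = fourier (fun x => partial_fourier phi x theta) xi.
Proof.
move=> sf; rewrite /fourier powR_pi_split realC_M -mulrA; congr (_ * _).
have mI : cmeasurable (fun t : tupleR R (k + s) =>
    phi (rV_of t) * cexpi (- dotr (rV_of t) (row_mx xi theta))).
  have := @pf_kernel_cmeasurable R 0 (k + s) phi 0 (row_mx xi theta) sf.
  rewrite /pf_kernel.
  by under eq_fun do rewrite row_thin_mx.
rewrite /integral_Rn cintegral_tuple_cat//.
have [C C0 HC] := schwartz_decay_row k s sf.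
have dom (a : tupleR R k) (b : tupleR R s) :
  norm1c (phi (rV_of (cat_pair (a, b))) *
     cexpi (- dotr (rV_of (cat_pair (a, b))) (row_mx xi theta))) <=
  (C * 2 * (jb (rV_of a) ^+ k)^-1) * (jb (rV_of b) ^+ s)^-1.
  apply: le_trans (norm1c_mul_cexpi _ _) _.
  rewrite [C * 2]mulrC -!mulrA mulrC ler_wpM2l// mulrA rV_of_cat; exact: HC.
have mc := cmeasurable_comp mI (@measurable_cat_pair R k s).
have i1 := @integrable_jb_scale R k (C * 2).
have i2 := @integrable_jb R s s (leqnn s).
rewrite (cintegral_product12 mc i1 i2 dom).
rewrite -cintegralZ; last exact: (cintegrable_cintegral1 mc i1 i2 dom).
congr cintegral; apply/funext => a.
rewrite /partial_fourier /fourier /integral_Rn -!mulrA; congr (_ * _).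
rewrite mulrC -cintegralZ; last exact: (pf_kernel_integrable _ _ sf).
congr cintegral; apply/funext => b.
rewrite rV_of_cat dotr_row opprD cexpiD; ring.
Qed.
End fourier_split.

Lemma is_derive_inv (R : realType) (f : R -> R) (x df : R) : f x != 0 ->
  is_derive x (1 : R) f df ->
  is_derive x (1 : R) (fun y => (f y)^-1) (- df / f x ^+ 2).
Proof.
move=> fx H; have [d1 d2] := H; split; first exact: derivableV.
by rewrite deriveV// d2 /GRing.scale /= mulrC mulrN mulNr mulrC.
Qed.

(** * Polar coordinates *)

Section sphere_integral.
Variables (R : realType) (s : nat).
Local Notation lebs := (lebesgue_tuple R s).
Local Notation sph := (@sphere_measure R s).
Local Notation ball1 := (@punctured_ball R s).
Local Notation en t := (enorm (rV_of t)).

Lemma unit_vector_scale (t : tupleR R s) : unit_vector t = scale_tuple (en t)^-1 t.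
Proof. by apply: eq_from_tnth => i; rewrite !tnth_mktuple !mxE. Qed.

Lemma enormZ m (c : R) (x : 'rV[R]_m) : enorm (c *: x) = `|c| * enorm x.
Proof.
rewrite /enorm dotrZr (_ : dotr (c *: x) x = c * dotr x x); last first.
  by rewrite /dotr mulr_sumr; apply: eq_bigr => i _; rewrite mxE mulrA.
by rewrite mulrA -expr2 sqrtrM ?sqr_ge0// sqrtr_sqr.
Qed.

Lemma enorm_ge0 m (x : 'rV[R]_m) : 0 <= enorm x. Proof. exact: sqrtr_ge0. Qed.

Lemma enorm_unit (t : tupleR R s) : 0 < en t -> enorm (rV_of (unit_vector t)) = 1.
Proof.
move=> t0; rewrite unit_vector_scale rV_of_scale enormZ ger0_norm ?invr_ge0 ?enorm_ge0//.
by rewrite mulVf// gt_eqF.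
Qed.

(** The surface measure is [s] times the image under [unit_vector] of Lebesgue measure restricted to
    the punctured ball. *)
Lemma ge0_integral_sphere (f : tupleR R s -> R) : measurable_fun setT f ->
  (forall t, 0 <= f t) ->
  (\int[sph]_t (f t)%:E =
   \int[lebs]_t (if 0 < en t <= 1 then s%:R * f (unit_vector t) else 0)%:E)%E.
Proof.
move=> mf f0.
have mB := @measurable_punctured_ball R s.
have mu := @measurable_unit_vector R s.
pose lebB : {measure set (tupleR R s) -> \bar R} := mrestr lebs mB.
pose nu : {measure set (tupleR R s) -> \bar R} :=
  mscale (NngNum (ler0n R s)) (pushforward lebB (@unit_vector R s)).
have mEf : measurable_fun setT (EFin \o f) by exact/measurable_EFinP.
have mfu : measurable_fun setT (fun t => f (unit_vector t)).
  exact: (measurableT_comp mf mu).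
transitivity (\int[nu mu]_t (f t)%:E)%E.
  apply: eq_measure_integral => A mA _.
  by rewrite /nu /= /mscale /= /pushforward /lebB /= /mrestr /= setIC.
rewrite /nu ge0_integral_mscale//=; last by move=> x _; rewrite lee_fin.
rewrite (ge0_integral_pushforward mu)//= ?preimage_setT; last by move=> x _; rewrite lee_fin.
transitivity (s%:R%:E * \int[lebs]_(t in ball1) (f (unit_vector t))%:E)%E.
  congr (_ * _)%E.
  (* The complement of the ball is null for the restricted measure, and inside the ball the
     restriction agrees with Lebesgue measure. *)
  rewrite -[X in (\int[_]_(_ in X) _)%E](setUv ball1).
  rewrite ge0_integral_setU//; last 4 first.
  - exact: measurableC.
  - by rewrite setUv; exact/measurable_EFinP.
  - by move=> x _; rewrite lee_fin.
  - by apply/disj_setPCl.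
  rewrite [X in (_ + X)%E](_ : _ = 0%E) ?adde0.
    apply: eq_measure_integral => A mA AB.
    by rewrite /lebB /= /mrestr setIidl.
  apply: null_set_integral => //; first exact: measurableC.
  - exact/measurable_EFinP/measurable_funTS.
  - by rewrite /lebB /= /mrestr setICl measure0.
have m1 : measurable_fun ball1 (fun t => (f (unit_vector t))%:E).
  exact/measurable_EFinP/measurable_funTS.
have p1 t : ball1 t -> (0 <= (f (unit_vector t))%:E)%E by rewrite lee_fin.
rewrite -(ge0_integralZl _ mB m1 p1) ?lee_fin//.
rewrite integral_mkcond; apply: eq_integral => t _.
rewrite patchE (_ : (t \in ball1) = (0 < en t <= 1)); first by case: ifP.
by apply/idP/idP; rewrite inE.
Qed.

(** This evaluates the auxiliary radial integral at the end of [ge0_polar]; the antiderivative is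
    [- x ^- s]. *)
Lemma integral_pow_tail (a : R) : 0 < a -> (0 < s)%N ->
  (\int[@lebesgue_measure R]_(x in `[a, +oo[) (s%:R * x ^- s.+1)%:E = (a ^- s)%:E)%E.
Proof.
move=> a0 s0.
have pos (x : R) : a <= x -> 0 < x by exact: lt_le_trans.
have dF (x : R) : 0 < x -> is_derive x (1 : R) (fun x : R => - x ^- s) (s%:R * x ^- s.+1).
  move=> x0; have xn : x ^+ s != 0 by rewrite expf_neq0// gt_eqF.
  have H := @is_derive_inv R (fun y => y ^+ s) x _ xn (is_derive_exp s x).
  apply: (is_derive_eq (is_deriveN H)); rewrite mulNr opprK -mulrA; congr (_ * _).
  have xu : x != 0 by rewrite gt_eqF.
  have E : x ^+ s ^+ 2 = x ^+ s.-1 * x ^+ s.+1.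
    by rewrite -exprM -exprD muln2 -addnn; congr (x ^+ _); rewrite addnS -addSn prednK.
  by rewrite E invfM mulVKf ?expf_neq0// mulfV.
rewrite (@ge0_continuous_FTC2y R _ (fun x : R => - x ^- s) a 0).
- by rewrite sub0e -EFinN opprK.
- by move=> x /pos x0; rewrite mulr_ge0// invr_ge0 exprn_ge0// ltW.
- apply: derivable_within_continuous => x; rewrite in_itv /= andbT => /pos x0.
  have xn : x ^+ s.+1 != 0 by rewrite expf_neq0// gt_eqF.
  have H := @is_derive_inv R (fun y => y ^+ s.+1) x _ xn (is_derive_exp s.+1 x).
  by have [] := is_derive_mul (is_derive_cst (s%:R : R) x (1 : R)) H.
- rewrite -oppr0; apply: cvgN; apply/gtr0_cvgV0.
    by near=> x; rewrite exprn_gt0//; near: x; exact: nbhs_pinfty_gt.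
  apply: ger_cvgy (@cvg_id _ _).
  near=> x; have x1 : 1 <= x by near: x; exact: nbhs_pinfty_ge.
  by rewrite -[leLHS]expr1; apply: ler_weXn2l.
- by move=> x /ltW/pos/dF[].
- have [d1 _] := dF a a0; apply: cvg_at_right_filter.
  exact: (differentiable_continuous ((derivable1_diffP _ _).1 d1)).
- by move=> x; rewrite in_itv /= andbT => /ltW/pos/dF H; rewrite derive1E (@derive_val _ _ _ _ _ _ _ H).
Unshelve. all: by end_near. Qed.

(** Unfolding the surface measure turns the right-hand side into the integral of [k1] over radii and
    an auxiliary point t of the ball, which only matters through its direction. At fixed t,
    replacing r by [|t| r] gives [k2], where f is taken at [r t]. At fixed r, replacing t by [t / r]
    gives [k3], where f is taken at t with the factor [s r^(-s-1) |t|^s] on [r >= |t|]; the integral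
    of this factor over r is 1. Tonelli is used between the steps. *)
Lemma ge0_polar (f : tupleR R s -> R) : (0 < s)%N -> measurable_fun setT f ->
  (forall t, 0 <= f t) -> (forall t, en t = 0 -> f t = 0) ->
  (\int[lebs]_t (f t)%:E =
   \int[@lebesgue_measure R]_(r in `]0%R, +oo[)
     ((r ^+ s.-1)%:E * \int[sph]_t (f (scale_tuple r t))%:E))%E.
Proof.
move=> s0 mf f0 fz.
pose leb := @lebesgue_measure R.
pose k1 (p : measurableTypeR R * tupleR R s) : R :=
  if (0 < p.1 :> R) && (0 < en p.2 <= 1)
  then s%:R * p.1 ^+ s.-1 * f (scale_tuple (p.1 / en p.2) p.2) else 0.
pose k2 (p : measurableTypeR R * tupleR R s) : R :=
  if (0 < p.1 :> R) && (0 < en p.2 <= 1)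
  then s%:R * p.1 ^+ s.-1 * en p.2 ^+ s * f (scale_tuple p.1 p.2) else 0.
pose k3 (p : measurableTypeR R * tupleR R s) : R :=
  if (0 < en p.2) && (en p.2 <= p.1)
  then s%:R * p.1 ^- s.+1 * en p.2 ^+ s * f p.2 else 0.
have men : measurable_fun setT (fun p : measurableTypeR R * tupleR R s => en p.2).
  exact: (measurableT_comp (@measurable_enorm R s) measurable_snd).
have mp1 : measurable_fun setT (fun p : measurableTypeR R * tupleR R s => p.1 : R).
  exact: measurable_fst.
have minv (h : measurableTypeR R * tupleR R s -> R) : measurable_fun setT h ->
    (forall p, 0 <= h p) -> measurable_fun setT (fun p => (h p)^-1).
  move=> mh h0; rewrite (_ : (fun _ => _) = fun p => h p `^ (-1)).
    exact: (measurableT_comp (measurable_powR (-1)) mh).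
  by apply/funext => p; rewrite powR_inv1.
have mb1 : measurable_fun setT (fun p : measurableTypeR R * tupleR R s =>
    (0 < p.1 :> R) && (0 < en p.2 <= 1)).
  apply: measurable_and; first exact: measurable_fun_ltr.
  by apply: measurable_and; [exact: measurable_fun_ltr|exact: measurable_fun_ler].
have msc (h : measurableTypeR R * tupleR R s -> R) : measurable_fun setT h ->
    measurable_fun setT (fun p => f (scale_tuple (h p) p.2)).
  move=> mh; apply: (measurableT_comp mf).
  have mp : measurable_fun setT (fun p : measurableTypeR R * tupleR R s =>
      (h p : measurableTypeR R, p.2)).
    by apply: measurable_fun_pair => //; exact: measurable_snd.
  exact: (measurableT_comp (@measurable_scale_tuple R s) mp).
have mk1 : measurable_fun setT k1.
  apply: measurable_fun_ifT => //; apply: measurable_funM.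
    by apply: measurable_funM => //; apply: measurable_funX.
  apply: msc; apply: measurable_funM => //; apply: minv => // p.
  exact: enorm_ge0.
have mk2 : measurable_fun setT k2.
  apply: measurable_fun_ifT => //; apply: measurable_funM; last exact: msc.
  apply: measurable_funM; last exact: measurable_funX.
  by apply: measurable_funM => //; apply: measurable_funX.
have mk3 : measurable_fun setT k3.
  (* On the support of [k3] the radius r equals [|t| + |r - |t||], an expression nonnegative
     everywhere, as [minv] requires. *)
  rewrite (_ : k3 = (fun p : measurableTypeR R * tupleR R s =>
      if (0 < en p.2) && (en p.2 <= p.1)
      then s%:R * ((en p.2 + `|p.1 - en p.2|) ^+ s.+1)^-1 * en p.2 ^+ s * f p.2 else 0)).
    apply: measurable_fun_ifT => //.
    - by apply: measurable_and; [exact: measurable_fun_ltr|exact: measurable_fun_ler].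
    - apply: measurable_funM; last exact: (measurableT_comp mf measurable_snd).
      apply: measurable_funM; last exact: measurable_funX.
      apply: measurable_funM => //; apply: minv.
        apply: measurable_funX; apply: measurable_funD => //.
        by apply: measurableT_comp => //; apply: measurable_funB.
      by move=> p; rewrite exprn_ge0// addr_ge0// enorm_ge0.
  apply/funext => p; rewrite /k3; case: ifP => // /andP[_ h].
  by rewrite [`|_|]ger0_norm ?subr_ge0// subrKC.
have k10 p : 0 <= k1 p.
  rewrite /k1; case: ifP => // /andP[p0 _].
  by rewrite !mulr_ge0// exprn_ge0// ltW.
have k20 p : 0 <= k2 p.
  rewrite /k2; case: ifP => // /andP[p0 _].
  by rewrite !mulr_ge0// exprn_ge0// ?enorm_ge0// ltW.
have k30 p : 0 <= k3 p.
  rewrite /k3; case: ifP => // /andP[p0 p1].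
  by rewrite !mulr_ge0// ?invr_ge0 exprn_ge0// ?enorm_ge0// (le_trans _ p1)// enorm_ge0.
have E1 (k : measurableTypeR R * tupleR R s -> R) : measurable_fun setT k -> measurable_fun setT (fun p : measurableTypeR R * tupleR R s => (k p)%:E).
  by move=> ?; exact/measurable_EFinP.
rewrite [RHS]integral_mkcond.
transitivity (\int[leb]_r \int[lebs]_t (k1 (r, t))%:E)%E; last first.
  apply: eq_integral => r _; rewrite patchE mem_setE in_itv /= andbT.
  case: ifP => r0; last first.
    by rewrite integral0_eq// => t _; rewrite /k1 /= r0.
  rewrite ge0_integral_sphere//; last first.
    exact: (measurableT_comp mf (@measurable_scale_tuple_cst R s r)).
  have mS : measurable_fun setT (fun t : tupleR R s =>
      (if 0 < en t <= 1 then s%:R * f (scale_tuple r (unit_vector t)) else 0)%:E).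
    apply/measurable_EFinP; apply: measurable_fun_ifT => //.
    - apply: (measurable_fun_bool true); rewrite setTI.
      exact: (@measurable_punctured_ball R s).
    - apply: measurable_funM => //; apply: (measurableT_comp mf).
      exact: (measurableT_comp (@measurable_scale_tuple_cst R s r) (@measurable_unit_vector R s)).
  have pS t : setT t -> (0 <= (if 0 < en t <= 1 then
      s%:R * f (scale_tuple r (unit_vector t)) else 0)%:E)%E.
    by move=> _; rewrite lee_fin; case: ifP => // _; rewrite mulr_ge0.
  rewrite -(ge0_integralZl _ measurableT mS pS); last by rewrite lee_fin exprn_ge0// ltW.
  apply: eq_integral => t _; rewrite -EFinM; congr EFin.
  rewrite /k1 /= r0 /=; case: ifP => _; last by rewrite mulr0.
  rewrite mulrCA mulrA; congr (_ * f _).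
  rewrite unit_vector_scale; apply: eq_from_tnth => i.
  by rewrite !tnth_mktuple mulrA.
rewrite (fubini_tonelli (fun p => (k1 p)%:E))//; last exact: E1.
transitivity (\int[lebs]_t \int[leb]_r (k2 (r, t))%:E)%E; last first.
  apply: eq_integral => t _.
  have [t1|t1] := boolP (0 < en t <= 1); last first.
    by rewrite !integral0_eq// => r _; rewrite ?/k1 ?/k2 /= (negPf t1) andbF.
  have /andP[t0 _] := t1.
  have m1 : measurable_fun setT (fun r : measurableTypeR R => (k1 (r, t))%:E).
    exact: (measurableT_comp (E1 _ mk1) (pair2_measurable t)).
  rewrite (ge0_integral_scale t0 m1); last by move=> r; rewrite lee_fin.
  have m2 : measurable_fun setT (fun r : measurableTypeR R => (k1 (en t * r, t))%:E).
    apply: (measurableT_comp m1).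
    by apply: continuous_measurable_fun; exact: mulrl_continuous.
  rewrite -(ge0_integralZl _ measurableT m2); last 2 first.
  - by move=> r _; rewrite lee_fin.
  - by rewrite lee_fin ltW.
  apply: eq_integral => r _; rewrite -EFinM; congr EFin.
  rewrite /k1 /k2 /= pmulr_rgt0// t1.
  case: ifP => _; last by rewrite mulr0.
  rewrite [en t * r / en t]mulrAC mulfV ?gt_eqF// mul1r.
  have -> : en t ^+ s = en t * en t ^+ s.-1 by rewrite -exprS prednK.
  by rewrite exprMn; ring.
rewrite -(fubini_tonelli (fun p => (k2 p)%:E))//; last exact: E1.
transitivity (\int[leb]_r \int[lebs]_t (k3 (r, t))%:E)%E; last first.
  apply: eq_integral => r _.
  have [r0|r0] := ltP 0 (r : R); last first.
    transitivity (0%E : \bar R); [|apply/esym]; apply: integral0_eq => t _.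
      rewrite /k3 /=; case: ifP => // /andP[t0 t1].
      by have := lt_le_trans t0 (le_trans t1 r0); rewrite ltxx.
    by rewrite /k2 /= ltNge r0.
  have m1 : measurable_fun setT (fun t => (k3 (r, t))%:E).
    exact: (measurableT_comp (E1 _ mk3) (pair1_measurable r)).
  rewrite (ge0_integral_tuple_scale r0 m1); last by move=> t; rewrite lee_fin.
  have m2 : measurable_fun setT (fun t => (k3 (r, scale_tuple r t))%:E).
    exact: (measurableT_comp m1 (@measurable_scale_tuple_cst R s r)).
  rewrite -(ge0_integralZl _ measurableT m2); last 2 first.
  - by move=> t _; rewrite lee_fin.
  - by rewrite lee_fin exprn_ge0// ltW.
  apply: eq_integral => t _; rewrite -EFinM; congr EFin.
  rewrite /k3 /k2 /= rV_of_scale enormZ gtr0_norm// pmulr_rgt0// r0 /=.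
  rewrite ger_pMr//; case: ifP => _; last by rewrite mulr0.
  have E : r ^+ s * r ^- s.+1 * r ^+ s = r ^+ s.-1.
    have rn : r != 0 by rewrite gt_eqF.
    have -> : r ^+ s = r * r ^+ s.-1 by rewrite -exprS prednK.
    have -> : r ^- s.+1 = r^-1 * r^-1 * (r ^+ s.-1)^-1.
      by rewrite -!invfM -mulrA -!exprS prednK.
    have pn : r ^+ s.-1 != 0 by rewrite expf_neq0.
    by field; rewrite pn rn.
  by rewrite exprMn -E; ring.
rewrite (fubini_tonelli (fun p => (k3 p)%:E))//; last exact: E1.
apply: eq_integral => t _.
have [t0|t0] := ltP 0 (en t); last first.
  have t0' : en t = 0 by apply/eqP; rewrite eq_le t0 enorm_ge0.
  rewrite fz// integral0_eq// => r _; by rewrite /k3 /= t0' ltxx.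
transitivity (\int[leb]_(r in `[en t, +oo[) (s%:R * (r : R) ^- s.+1 * (en t ^+ s * f t))%:E)%E.
  have mpow : measurable_fun `[en t, +oo[ (fun r : R => (s%:R * r ^- s.+1)%:E).
    apply/measurable_EFinP.
    apply: (@eq_measurable_fun _ _ _ _ _ (fun r : R => s%:R * (r `^ (-1)) ^+ s.+1)).
      move=> r; rewrite inE /= in_itv /= andbT => tr.
      by rewrite powR_inv1 ?exprVn// (le_trans _ tr)// enorm_ge0.
    apply: measurable_funTS; apply: measurable_funM => //.
    by apply: measurable_funX; exact: measurable_powR.
  under eq_integral do rewrite EFinM.
  rewrite ge0_integralZr//.
  - by rewrite integral_pow_tail// -EFinM mulrA mulVf ?mul1r// expf_neq0// gt_eqF.
  - move=> x; rewrite /= in_itv /= andbT => ex.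
    by rewrite lee_fin mulr_ge0// invr_ge0 exprn_ge0// (le_trans _ ex)// enorm_ge0.
  - by rewrite lee_fin mulr_ge0// exprn_ge0// enorm_ge0.
rewrite [LHS]integral_mkcond; apply: eq_integral => r _.
rewrite patchE mem_setE in_itv /= andbT /k3 /= t0 /=.
by case: ifP => // _; rewrite !mulrA.
Qed.

End sphere_integral.

(** * Polar coordinates for signed and complex functions *)

Section complex_polar.
Variables (R : realType) (s : nat).
Local Notation leb := (@lebesgue_measure R).
Local Notation lebs := (lebesgue_tuple R s).
Local Notation sph := (@sphere_measure R s).
Local Notation en t := (enorm (rV_of t)).

Lemma enorm_sqr m (x : 'rV[R]_m) : enorm x ^+ 2 = dotr x x.
Proof. by rewrite /enorm sqr_sqrtr// dotr_ge0. Qed.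

Lemma jb_enorm m (x : 'rV[R]_m) : jb x = 1 + enorm x ^+ 2.
Proof. by rewrite enorm_sqr. Qed.

Lemma measurable_in_ball : measurable_fun setT (fun t : tupleR R s => 0 < en t <= 1).
Proof.
apply: (measurable_fun_bool true); rewrite setTI.
exact: (@measurable_punctured_ball R s).
Qed.

Lemma integrable_ball (C : R) : 0 <= C ->
  lebs.-integrable setT (EFin \o (fun t => if 0 < en t <= 1 then C else 0)).
Proof.
move=> C0.
(* On the ball [jb] is at most 2, which accounts for the factor [2 ^+ s]. *)
apply: (@integrable_dom R _ _ lebs _ (fun t => (C * 2 ^+ s) * (jb (rV_of t) ^+ s)^-1)).
- by apply: measurable_fun_ifT => //; exact: measurable_in_ball.
- exact: integrable_jb_scale.
- move=> t; have p0 : 0 < jb (rV_of t) ^+ s by rewrite exprn_gt0// jb_gt0.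
  case: ifP => [/andP[t0 t1]|_]; last first.
    by rewrite normr0 !mulr_ge0// ?invr_ge0 ?exprn_ge0// ltW// jb_gt0.
  rewrite ger0_norm// -mulrA ler_peMr// ler_pdivlMr// mul1r.
  rewrite lerXn2r ?nnegrE ?(ltW (jb_gt0 _))// jb_enorm.
  have : en t ^+ 2 <= 1 by rewrite expr_le1// enorm_ge0.
  lra.
Qed.

Lemma sphere_integrable (f : tupleR R s -> R) (M : R) : measurable_fun setT f ->
  (forall t, `|f t| <= M) -> sph.-integrable setT (EFin \o f).
Proof.
move=> mf fM.
have M0 : 0 <= M.
  by apply: le_trans (normr_ge0 _) (fM [tuple 0 | i < s]).
apply: (@integrable_dom R _ _ sph f (fun=> M)) => //.
apply/integrableP; split; first exact/measurable_EFinP.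
under eq_integral do rewrite /= ger0_norm//.
rewrite (@ge0_integral_sphere R s (fun=> M))//.
have := integrable_fin_num measurableT (integrable_ball (mulr_ge0 (ler0n R s) M0)).
by rewrite /= fin_numElt => /andP[].
Qed.

(** The sphere has finite measure, so the nonnegative formula can be applied to [f + M] and to [M]
    and the results subtracted. *)
Lemma Rintegral_sphere (f : tupleR R s -> R) (M : R) : measurable_fun setT f ->
  (forall t, `|f t| <= M) ->
  \int[sph]_t f t =
  \int[lebs]_t (if 0 < en t <= 1 then s%:R * f (unit_vector t) else 0).
Proof.
move=> mf fM.
have M0 : 0 <= M.
  by apply: le_trans (normr_ge0 _) (fM [tuple 0 | i < s]).
have mM : measurable_fun setT (fun _ : tupleR R s => M) by [].
have pos t : 0 <= f t + M.
  by have := fM t; rewrite ler_norml => /andP[h _]; rewrite -lerBlDr sub0r.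
have iM : sph.-integrable setT (EFin \o (fun _ : tupleR R s => M)).
  by apply: (sphere_integrable (M := M)) => // t; rewrite ger0_norm.
have ifn : sph.-integrable setT (EFin \o f) by exact: (sphere_integrable mf fM).
have mu := @measurable_unit_vector R s.
have ib (g : tupleR R s -> R) : measurable_fun setT g -> (forall t, `|g t| <= M) ->
    lebs.-integrable setT (EFin \o
      (fun t => if 0 < en t <= 1 then s%:R * g (unit_vector t) else 0)).
  move=> mg gM; apply: (@integrable_dom R _ _ lebs _
    (fun t => if 0 < en t <= 1 then s%:R * M else 0)).
  - apply: measurable_fun_ifT => //; first exact: measurable_in_ball.
    by apply: measurable_funM => //; exact: (measurableT_comp mg mu).
  - by apply: integrable_ball; rewrite mulr_ge0.
  - move=> t; case: ifP => _; last by rewrite normr0.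
    by rewrite normrM ger0_norm// ler_wpM2l.
transitivity (\int[sph]_t (f t + M) - \int[sph]_t M).
  by rewrite RintegralD// addrK.
rewrite {1 2}/Rintegral (@ge0_integral_sphere R s (fun t => f t + M))//; last first.
  exact: measurable_funD.
rewrite (@ge0_integral_sphere R s (fun=> M))//.
rewrite -[X in X - _]/(\int[lebs]_t (if 0 < en t <= 1 then s%:R * (f (unit_vector t) + M) else 0)).
rewrite -[X in _ - X]/(\int[lebs]_t (if 0 < en t <= 1 then s%:R * M else 0)).
have MM (t : tupleR R s) : `|M| <= M by rewrite ger0_norm.
have iM' := ib (fun=> M) mM MM.
have if' := ib f mf fM.
rewrite (_ : (fun t => if 0 < en t <= 1 then s%:R * (f (unit_vector t) + M) else 0) =
  (fun t => (if 0 < en t <= 1 then s%:R * f (unit_vector t) else 0) +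
    (if 0 < en t <= 1 then s%:R * M else 0))).
  by rewrite RintegralD// addrK.
by apply/funext => t; case: ifP => _; rewrite ?mulrDr ?addr0.
Qed.

Lemma cintegral_sphere (f : tupleR R s -> R[i]) (M : R) : cmeasurable f ->
  (forall t, norm1c (f t) <= M) ->
  cintegral sph setT f = cintegral lebs setT
    (fun t => if 0 < en t <= 1 then s%:R%:C * f (unit_vector t) else 0).
Proof.
move=> [m1 m2] fM; apply: complex_ext => /=.
- rewrite (Rintegral_sphere m1 (M := M)); last first.
    by move=> t; apply: le_trans (fM t); exact: Re_le_norm1c.
  by apply: eq_Rintegral => t _; case: ifP => // _; rewrite cReZ.
- rewrite (Rintegral_sphere m2 (M := M)); last first.
    by move=> t; apply: le_trans (fM t); exact: Im_le_norm1c.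
  by apply: eq_Rintegral => t _; case: ifP => // _; rewrite cImZ.
Qed.

Lemma ge0_Rintegral_polar (f : tupleR R s -> R) (M : R) : (0 < s)%N ->
  measurable_fun setT f -> (forall t, 0 <= f t <= M) -> (forall t, en t = 0 -> f t = 0) ->
  lebs.-integrable setT (EFin \o f) ->
  \int[lebs]_t f t =
  \int[leb]_(r in `]0, +oo[) (r ^+ s.-1 * \int[sph]_t f (scale_tuple r t)) /\
  leb.-integrable `]0, +oo[ (EFin \o (fun r => r ^+ s.-1 * \int[sph]_t f (scale_tuple r t))).
Proof.
move=> s0 mf fM fz intf.
have f0 t : 0 <= f t by have /andP[] := fM t.
have ms r : measurable_fun setT (fun t => f (scale_tuple r t)).
  exact: (measurableT_comp mf (@measurable_scale_tuple_cst R s r)).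
have fin r : (\int[sph]_t (f (scale_tuple r t))%:E)%E =
    (\int[sph]_t f (scale_tuple r t))%:E.
  rewrite fineK//; apply: (integrable_fin_num measurableT).
  apply: (sphere_integrable (ms r) (M := M)) => t.
  by rewrite ger0_norm//; have /andP[] := fM (scale_tuple r t).
have E := ge0_polar s0 mf f0 fz.
have E' : (\int[leb]_(r in `]0%R, +oo[)
     ((r ^+ s.-1)%:E * \int[sph]_t (f (scale_tuple r t))%:E))%E =
  (\int[leb]_(r in `]0%R, +oo[)
     (r ^+ s.-1 * \int[sph]_t f (scale_tuple r t))%:E)%E.
  by apply: eq_integral => r _; rewrite fin.
split; first by rewrite {1}/Rintegral E E'.
have mI : measurable_fun setT (fun r : R => \int[sph]_t f (scale_tuple r t)).
  have -> : (fun r : R => \int[sph]_t f (scale_tuple r t)) = (fun r : R =>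
      \int[lebs]_t (if 0 < en t <= 1 then s%:R * f (scale_tuple r (unit_vector t)) else 0)).
    apply/funext => r; rewrite (Rintegral_sphere (ms r) (M := M))// => t.
    by rewrite ger0_norm//; have /andP[] := fM (scale_tuple r t).
  apply: (@measurable_Rintegral R _ _ (measurableTypeR R) _ lebs
    (fun p => if 0 < en p.2 <= 1 then s%:R * f (scale_tuple p.1 (unit_vector p.2)) else 0)).
  apply: measurable_fun_ifT => //.
    exact: (measurableT_comp measurable_in_ball measurable_snd).
  apply: measurable_funM => //; apply: (measurableT_comp mf).
  have mp : measurable_fun setT (fun p : measurableTypeR R * tupleR R s =>
      (p.1, unit_vector p.2)).
    apply: measurable_fun_pair; first exact: measurable_fst.
    exact: (measurableT_comp (@measurable_unit_vector R s) measurable_snd).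
  exact: (measurableT_comp (@measurable_scale_tuple R s) mp).
apply/integrableP; split.
  apply/measurable_EFinP; apply: measurable_funTS.
  exact: (measurable_funM (exprn_measurable s.-1) mI).
under eq_integral => r rD.
  rewrite gee0_abs; last first.
    rewrite lee_fin mulr_ge0//; last by apply: Rintegral_ge0.
    by rewrite exprn_ge0//; move: rD; rewrite inE /= in_itv /= andbT => /ltW.
  over.
rewrite -E' -E.
by have := integrable_fin_num measurableT intf; rewrite /= fin_numElt => /andP[].
Qed.

(** Constants are not integrable over R^s, so the shift is made by the integrable majorant:
    [f = (f + h) - h], where both terms are nonnegative. *)
Lemma Rintegral_polar (f h : tupleR R s -> R) (M : R) : (0 < s)%N ->
  measurable_fun setT f -> measurable_fun setT h ->
  (forall t, `|f t| <= h t) -> (forall t, h t <= M) -> (forall t, en t = 0 -> h t = 0) ->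
  lebs.-integrable setT (EFin \o h) ->
  \int[lebs]_t f t =
  \int[leb]_(r in `]0, +oo[) (r ^+ s.-1 * \int[sph]_t f (scale_tuple r t)).
Proof.
move=> s0 mf mh fh hM hz ih.
have h0 t : 0 <= h t := le_trans (normr_ge0 _) (fh t).
have fM t : `|f t| <= M := le_trans (fh t) (hM t).
have if_ := integrable_dom mf ih fh.
have fz t : en t = 0 -> f t = 0.
  by move=> /hz e; apply/eqP; rewrite -normr_le0 -e.
have [H1 I1] : \int[lebs]_t h t = \int[leb]_(r in `]0, +oo[)
    (r ^+ s.-1 * \int[sph]_t h (scale_tuple r t)) /\ _ :=
  ge0_Rintegral_polar s0 mh (fun t => introT andP (conj (h0 t) (hM t))) hz ih.
have pos t : 0 <= f t + h t <= 2 * M.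
  by move: (fh t) (hM t); rewrite ler_norml => /andP[]; lra.
have iD : lebs.-integrable setT (EFin \o (fun t => f t + h t)).
  exact: (integrableD measurableT if_ ih).
have [H2 I2] := ge0_Rintegral_polar s0 (measurable_funD mf mh) pos
  (fun t e => etrans (congr2 +%R (fz t e) (hz t e)) (addr0 0)) iD.
have ms (g : tupleR R s -> R) r : measurable_fun setT g -> measurable_fun setT (fun t => g (scale_tuple r t)).
  by move=> mg; exact: (measurableT_comp mg (@measurable_scale_tuple_cst R s r)).
transitivity (\int[lebs]_t (f t + h t) - \int[lebs]_t h t).
  by rewrite RintegralD// addrK.
rewrite H1 [X in X - _]H2 -RintegralB//.
apply: eq_Rintegral => r _; rewrite -mulrBr; congr (_ * _).
rewrite RintegralD ?addrK//.
- by apply: (sphere_integrable (M := M) (ms _ r mf)) => t; exact: fM.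
- by apply: (sphere_integrable (M := M) (ms _ r mh)) => t; rewrite ger0_norm.
Qed.

Lemma cintegral_polar (f : tupleR R s -> R[i]) (h : tupleR R s -> R) (M : R) : (0 < s)%N ->
  cmeasurable f -> measurable_fun setT h ->
  (forall t, norm1c (f t) <= h t) -> (forall t, h t <= M) -> (forall t, en t = 0 -> h t = 0) ->
  lebs.-integrable setT (EFin \o h) ->
  cintegral lebs setT f =
  integral_pos (fun r => (r ^+ s.-1)%:C * cintegral sph setT (fun t => f (scale_tuple r t))).
Proof.
move=> s0 [m1 m2] mh fh hM hz ih; apply: complex_ext => /=.
- rewrite (Rintegral_polar s0 m1 mh _ hM hz ih); last first.
    by move=> t; apply: le_trans (fh t); exact: Re_le_norm1c.
  by apply: eq_Rintegral => r _; rewrite /= ?mul0r ?subr0.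
- rewrite (Rintegral_polar s0 m2 mh _ hM hz ih); last first.
    by move=> t; apply: le_trans (fh t); exact: Im_le_norm1c.
  by apply: eq_Rintegral => r _; rewrite /= ?mul0r ?addr0.
Qed.

Lemma measurable_enormV : measurable_fun setT (fun t : tupleR R s => (en t)^-1).
Proof.
rewrite (_ : (fun _ => _) = fun t : tupleR R s => (en t) `^ (-1)).
  exact: (measurableT_comp (measurable_powR (-1)) (@measurable_enorm R s)).
by apply/funext => t; rewrite powR_inv1// enorm_ge0.
Qed.

(** This controls the factor [1 / |theta|] of the symbol. In polar coordinates the Jacobian leaves
    [r^(s-2)], bounded at the origin because [s >= 2], and
    [r^(s-2) (1 + r^2)^(-s) <= (1 + r^2)^(-1)] at infinity. *)
Lemma integrable_enormV_jb : (2 <= s)%N ->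
  lebs.-integrable setT (EFin \o (fun t => (en t)^-1 * (jb (rV_of t) ^+ s)^-1)).
Proof.
move=> s2; have s0 : (0 < s)%N by exact: leq_trans s2.
have mf : measurable_fun setT (fun t : tupleR R s => (en t)^-1 * (jb (rV_of t) ^+ s)^-1).
  by apply: measurable_funM; [exact: measurable_enormV|exact: measurable_jbV].
have f0 (t : tupleR R s) : 0 <= (en t)^-1 * (jb (rV_of t) ^+ s)^-1.
  by rewrite mulr_ge0// invr_ge0 ?enorm_ge0// exprn_ge0// ltW// jb_gt0.
apply/integrableP; split; first exact/measurable_EFinP.
under eq_integral do rewrite /= (ger0_norm (f0 _)).
rewrite (ge0_polar s0 mf f0); last by move=> t ->; rewrite invr0 mul0r.
pose J := \int[lebs]_t (if 0 < en t <= 1 then s%:R else 0 : R).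
have JE : (\int[lebs]_t (if 0 < en t <= 1 then s%:R else 0 : R)%:E)%E = J%:E.
  rewrite /J /Rintegral fineK//.
  exact: (integrable_fin_num measurableT (integrable_ball (ler0n R s))).
have J0 : 0 <= J by apply: Rintegral_ge0 => t _; case: ifP.
have mB : measurable_fun setT (fun t : tupleR R s => (if 0 < en t <= 1 then s%:R else 0 : R)%:E).
  by apply/measurable_EFinP; apply: measurable_fun_ifT => //; exact: measurable_in_ball.
have inner (r : R) : 0 < r -> (\int[sph]_t ((en (scale_tuple r t))^-1 *
    (jb (rV_of (scale_tuple r t)) ^+ s)^-1)%:E = (J * (r^-1 * (oneDsqr r ^+ s)^-1))%:E)%E.
  move=> r0.
  have ms : measurable_fun setT (fun t : tupleR R s => (en (scale_tuple r t))^-1 *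
      (jb (rV_of (scale_tuple r t)) ^+ s)^-1).
    exact: (measurableT_comp mf (@measurable_scale_tuple_cst R s r)).
  rewrite (ge0_integral_sphere ms)//.
  have -> : (fun t : tupleR R s => (if 0 < en t <= 1 then s%:R *
       ((en (scale_tuple r (unit_vector t)))^-1 *
        (jb (rV_of (scale_tuple r (unit_vector t))) ^+ s)^-1) else 0)%:E) =
     (fun t => ((r^-1 * (oneDsqr r ^+ s)^-1)%:E * (if 0 < en t <= 1 then s%:R else 0 : R)%:E)%E).
    apply/funext => t; rewrite -EFinM; congr EFin; case: ifP => [/andP[t0 _]|_]; last by rewrite mulr0.
    by rewrite mulrC rV_of_scale jb_enorm enormZ enorm_unit// mulr1 gtr0_norm.
  rewrite (ge0_integralZl _ measurableT mB); first by rewrite JE -EFinM mulrC.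
  - by move=> t _; rewrite lee_fin; case: ifP.
  - by rewrite lee_fin mulr_ge0// invr_ge0 ?exprn_ge0// ?(le_trans ler01 (oneDsqr_ge1 _))// ltW.
have iJ : leb.-integrable `]0, +oo[ (EFin \o (fun r : R => J * (oneDsqr r)^-1)).
  apply: (integrableS measurableT) => //.
  exact: (integrableZl measurableT J (@integrable_oneDsqrV R)).
apply: le_lt_trans (_ : (\int[leb]_(r in `]0%R, +oo[) (J * (oneDsqr r)^-1)%:E < +oo)%E); last first.
  have mI : @measurable _ (measurableTypeR R) `]0, +oo[ by exact: measurable_itv.
  by have := integrable_fin_num mI iJ; rewrite /= fin_numElt => /andP[].
have E0 : (\int[leb]_(r in `]0%R, +oo[) ((r ^+ s.-1)%:E *
    \int[sph]_t ((en (scale_tuple r t))^-1 * (jb (rV_of (scale_tuple r t)) ^+ s)^-1)%:E) =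
  \int[leb]_(r in `]0%R, +oo[) (r ^+ s.-1 * (J * (r `^ (-1) * (oneDsqr r ^+ s) `^ (-1))))%:E)%E.
  apply: eq_integral => r; rewrite inE /= in_itv /= andbT => r0.
  have o0 : 0 < oneDsqr r := lt_le_trans ltr01 (oneDsqr_ge1 r).
  by rewrite inner// -EFinM !powR_inv1 ?exprn_ge0 ?(ltW r0) ?(ltW o0).
rewrite E0; apply: ge0_le_integral => //.
- move=> r; rewrite /= in_itv /= andbT => r0.
  by rewrite lee_fin mulr_ge0 ?exprn_ge0 ?(ltW r0)// mulr_ge0// mulr_ge0// powR_ge0.
- apply/measurable_EFinP; apply: measurable_funTS.
  have mO := measurable_funX s (continuous_measurable_fun (@continuous_oneDsqr R)).
  have mO' := measurableT_comp (measurable_powR (-1)) mO.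
  have mr : measurable_fun setT (fun r : R => r `^ (-1)) by exact: measurable_powR.
  have mJ : measurable_fun setT (fun r : R => J) by exact: measurable_cst.
  exact: (measurable_funM (exprn_measurable s.-1) (measurable_funM mJ (measurable_funM mr mO'))).
- exact: (measurable_int leb iJ).
- move=> r; rewrite /= in_itv /= andbT => r0; rewrite lee_fin.
  have o1 := oneDsqr_ge1 r; have o0 : 0 < oneDsqr r := lt_le_trans ltr01 o1.
  rewrite !powR_inv1 ?exprn_ge0 ?(ltW r0) ?(ltW o0)// mulrCA ler_wpM2l//.
  have -> : r ^+ s.-1 = r * r ^+ s.-2 by case: (s) s2 => [|[|k]] // _; rewrite exprS.
  rewrite mulrA [r * _ * r^-1]mulrAC mulfV ?gt_eqF// mul1r.
  rewrite ler_pdivrMr ?exprn_gt0//.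
  have -> : oneDsqr r ^+ s = oneDsqr r * (oneDsqr r ^+ s.-2 * oneDsqr r).
    by case: (s) s2 => [|[|k]] // _; rewrite -exprSr -exprS.
  rewrite mulKf ?gt_eqF//.
  rewrite -[leLHS]mulr1; apply: ler_pM => //; first by rewrite exprn_ge0// ltW.
  rewrite lerXn2r ?nnegrE ?(ltW r0) ?(ltW o0)//.
  by have := sqr_ge0 (r - 2^-1); rewrite /oneDsqr; nra.
Qed.

End complex_polar.

(** * The oscillatory integral over the second variable *)

Section quadratic_form.
Variables (R : realType) (n : nat).
Local Notation V := 'rV[R]_(n + n).

Definition signP (i : 'I_(n + n)) : R := if (i < n)%N then 1 else -1.

Lemma PformE (x : V) : Pform x = \sum_i signP i * (x 0 i * x 0 i).
Proof.
rewrite /Pform big_split_ord sumrB /= -sumrN; congr (_ + _); apply: eq_bigr => i _.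
- by rewrite /signP /= ltn_ord mul1r expr2.
- by rewrite /signP /= ltnNge leq_addr /= mulN1r expr2.
Qed.

Lemma is_derive_Pform (i : 'I_(n + n)) (x : V) :
  is_derive x (delta_mx 0 i) (@Pform R n) (2 * signP i * x 0 i).
Proof.
have E : @Pform R n = \sum_j (fun y : V => signP j * (y 0 j * y 0 j)).
  by apply/funext => y; rewrite PformE fct_sumE.
rewrite E.
have H j : is_derive x (delta_mx 0 i) (fun y : V => signP j * (y 0 j * y 0 j))
    (signP j * (2 * (j == i)%:R * x 0 j)).
  have := is_deriveM (is_derive_coord i j x) (is_derive_coord i j x).
  move/(is_deriveZ (signP j)) => H; apply: (is_derive_eq H).
  by rewrite /GRing.scale /=; ring.
have <- : \sum_j signP j * (2 * (j == i)%:R * x 0 j) = 2 * signP i * x 0 i.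
  rewrite (bigD1 i)//= big1 ?addr0; first by rewrite eqxx mulr1 mulrCA mulrA.
  by move=> j /negPf ji; rewrite ji mulr0 mul0r mulr0.
exact: is_derive_sum.
Qed.

Lemma schwartz_Pform (f : V -> R[i]) m : schwartz f ->
  schwartz (fun x => (Pform x ^+ m)%:C * f x).
Proof.
move=> sf; elim: m => [|m IH].
  by under eq_fun do rewrite expr0 mul1r.
rewrite (_ : (fun _ => _) = fun x => \sum_i (signP i)%:C *
    cmulX i (cmulX i (fun x => (Pform x ^+ m)%:C * f x)) x).
  apply: (@schwartz_sum _ _ _ _ (fun i x => (signP i)%:C *
    cmulX i (cmulX i (fun x => (Pform x ^+ m)%:C * f x)) x)) => i.
  by apply: schwartzZ; apply: schwartz_cmulX; exact: schwartz_cmulX.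
apply/funext => x; rewrite exprS realC_M -mulrA {1}PformE rmorph_sum mulr_suml.
by apply: eq_bigr => i _; rewrite /cmulX !rmorphM /= !mulrA.
Qed.

Lemma measurable_Pform : measurable_fun setT (fun t : tupleR R (n + n) => Pform (rV_of t)).
Proof.
rewrite (_ : (fun _ => _) = fun t : tupleR R (n + n) =>
    \sum_i signP i * ((tnth t i : R) * tnth t i)); last first.
  by apply/funext => t; rewrite PformE; apply: eq_bigr => i _; rewrite !rV_ofE.
apply: measurable_sum => i; apply: measurable_funM => //.
by apply: measurable_funM; exact: measurable_tnth.
Qed.

End quadratic_form.

(** * Smoothness and decay in the first variable *)

Section oscillatory_integral.
Variables (R : realType) (n s : nat) (lam : R).
Local Notation V := 'rV[R]_(n + n).
Local Notation lebs := (lebesgue_tuple R s).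
Local Notation en t := (enorm (rV_of t)).
Implicit Types (phi : 'rV[R]_(n + n + s) -> R[i]) (x : V) (t : tupleR R s).

(** For [lam = coth t / 4] and [j = n - 1] the integral of this kernel is chi_t. The exponent [j] is
    left free because differentiating the phase in [x] raises it by one. *)
Definition osc_kernel (j : nat) phi x t : R[i] :=
  (en t ^+ j)%:C * (partial_fourier phi x (rV_of t) * cexpi (- (lam * en t * Pform x))).

Definition osc (j : nat) phi x : R[i] := cintegral lebs setT (osc_kernel j phi x).

Lemma enorm_le_jb m (x : 'rV[R]_m) : enorm x <= jb x.
Proof. by rewrite jb_enorm; have := sqr_ge0 (enorm x - 2^-1); nra. Qed.

Lemma osc_kernel_dom j phi N : schwartz phi -> exists2 C, 0 <= C &
  forall x t, norm1c (osc_kernel j phi x t) <= C / jb x ^+ N * (jb (rV_of t) ^+ s)^-1.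
Proof.
(* Of the [j + s] powers of decay in [theta], [j] absorb [|theta|^j] and [s] ensure
   integrability. *)
move=> /(partial_fourier_decay N (j + s))[C C0 HC]; exists (C * 2); first by rewrite mulr_ge0.
move=> x t; rewrite norm1cZ ger0_norm ?exprn_ge0 ?enorm_ge0//.
have q0 : 0 < jb (rV_of t) := jb_gt0 _.
apply: (@le_trans _ _ (jb (rV_of t) ^+ j * (C / jb x ^+ N / jb (rV_of t) ^+ (j + s) * 2))).
  apply: ler_pM; rewrite ?exprn_ge0 ?enorm_ge0 ?norm1c_ge0//.
    by rewrite lerXn2r ?nnegrE ?enorm_ge0 ?(ltW q0)// enorm_le_jb.
  apply: le_trans (norm1c_mul_cexpi _ _) _.
  by rewrite ler_wpM2r.
rewrite exprD invfM le_eqVlt; apply/orP; left; apply/eqP.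
have q1 : jb (rV_of t) ^+ j != 0 by rewrite expf_neq0// gt_eqF.
have q2 : jb (rV_of t) ^+ s != 0 by rewrite expf_neq0// gt_eqF.
have q3 : jb x ^+ N != 0 by rewrite expf_neq0// gt_eqF// jb_gt0.
by field; rewrite q1 q2 q3.
Qed.

Lemma osc_kernel_cmeasurable2 j phi : schwartz phi ->
  cmeasurable (fun p : tupleR R (n + n) * tupleR R s => osc_kernel j phi (rV_of p.1) p.2).
Proof.
move=> sf.
have men : measurable_fun setT (fun p : tupleR R (n + n) * tupleR R s => en p.2).
  exact: (measurableT_comp (@measurable_enorm R s) measurable_snd).
apply: cmeasurableM; first by apply: cmeasurable_real; exact: measurable_funX.
apply: cmeasurableM; first exact: partial_fourier_cmeasurable.
apply: cmeasurable_cexpi; apply: measurableT_comp => //; apply: measurable_funM.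
  by apply: measurable_funM.
exact: (measurableT_comp (@measurable_Pform R n) measurable_fst).
Qed.

Lemma osc_kernel_cmeasurable j phi x : schwartz phi -> cmeasurable (osc_kernel j phi x).
Proof.
move=> sf; have := cmeasurable_comp (osc_kernel_cmeasurable2 j sf)
  (pair1_measurable (tuple_of_rV x)).
by under eq_fun do rewrite /= rV_of_surj.
Qed.

Lemma osc_kernel_integrable j phi x : schwartz phi ->
  cintegrable lebs setT (osc_kernel j phi x).
Proof.
move=> sf; have [C C0 HC] := osc_kernel_dom j 0 sf.
exact: cintegrable_dom (osc_kernel_cmeasurable j x sf) (integrable_jb_scale _ _) (HC x).
Qed.

Lemma osc_bounded j phi N : schwartz phi -> exists2 C, 0 <= C &
  forall x, norm1c (osc j phi x) <= C / jb x ^+ N.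
Proof.
move=> sf; have [C C0 HC] := osc_kernel_dom j N sf.
pose J := \int[lebs]_t (jb (rV_of t) ^+ s)^-1.
have J0 : 0 <= J.
  by apply: Rintegral_ge0 => t _; rewrite invr_ge0 exprn_ge0// ltW// jb_gt0.
exists (C * J); first by rewrite mulr_ge0.
move=> x; apply: le_trans (norm1c_cintegral (osc_kernel_cmeasurable j x sf)
  (integrable_jb_scale _ _) (HC x)) _.
by rewrite RintegralZl 1?mulrAC//; exact: integrable_jb.
Qed.

Lemma osc_cmulX j phi i : schwartz phi ->
  cmulX i (osc j phi) = osc j (cmulX (lshift s i) phi).
Proof.
move=> sf; apply/funext => x.
rewrite /cmulX -[LHS]cintegralZ; last exact: osc_kernel_integrable.
congr cintegral; apply/funext => t; rewrite /osc_kernel partial_fourier_cmulX//; ring.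
Qed.

(** The derivative falls on the transform or on the phase. In the second case the new factor
    [|theta|] is counted in [j.+1], and the new factor [x_i] is moved into [phi]. *)
Definition osc_partial (j : nat) phi (i : 'I_(n + n)) x : R[i] :=
  osc j (cpartial (lshift s i) phi) x +
  osc j.+1 (fun v => - 'i%C * (lam * (2 * signP R i))%:C * cmulX (lshift s i) phi v) x.

Lemma osc_is_cpartial j phi i x : schwartz phi ->
  is_cpartial i (osc j phi) x (osc_partial j phi i x).
Proof.
move=> sf.
have s1 := schwartz_cpartial (lshift s i) sf.
have s2 : schwartz (fun v => - 'i%C * (lam * (2 * signP R i))%:C * cmulX (lshift s i) phi v).
  by apply: schwartzZ; exact: schwartz_cmulX.
suff H y (u : R) : is_cderive (fun u => osc j phi (y + u *: delta_mx 0 i)) u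
    (osc_partial j phi i (y + u *: delta_mx 0 i)).
  split; move: x.
  - apply: (is_derive_line _ (fun x => complex.Re (osc_partial j phi i x)) _).2 => y u.
    by have [] := H y u.
  - apply: (is_derive_line _ (fun x => complex.Im (osc_partial j phi i x)) _).2 => y u.
    by have [] := H y u.
have [C1 C10 H1] := osc_kernel_dom j 0 s1.
have [C2 C20 H2] := osc_kernel_dom j.+1 0 s2.
rewrite /osc_partial -cintegralD; try exact: osc_kernel_integrable.
apply: (is_cderive_cintegral (f := fun u => osc_kernel j phi (y + u *: delta_mx 0 i))
  (df := fun u t => osc_kernel j (cpartial (lshift s i) phi) (y + u *: delta_mx 0 i) t +
    osc_kernel j.+1 (fun v => - 'i%C * (lam * (2 * signP R i))%:C * cmulX (lshift s i) phi v)
      (y + u *: delta_mx 0 i) t) _ _ _ (integrable_jb_scale _ (C1 + C2))).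
- by move=> z; exact: osc_kernel_integrable.
- move=> z t; rewrite /osc_kernel.
  have HP : is_derive z (1 : R) (fun u : R => - (lam * en t * Pform (y + u *: delta_mx 0 i)))
      (- (lam * en t * (2 * signP R i * (y + z *: delta_mx 0 i) 0 i))).
    have L := (is_derive_line (@Pform R n) _ (delta_mx 0 i)).1 (is_derive_Pform i) y z.
    exact: (is_deriveN (is_deriveZ (lam * en t) L)).
  apply: (is_cderive_eq (is_cderiveM (is_cderive_cst _ z) (is_cderiveM
    (partial_fourier_is_cderive_l y (rV_of t) i z sf) (is_cderive_cexpi HP)))).
  rewrite mul0r add0r mulrDr; congr (_ + _).
  rewrite partial_fourierZ ?partial_fourier_cmulX//; last exact: schwartz_cmulX.
  rewrite exprS rmorphN !rmorphM /=; ring.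
- move=> z t; apply: le_trans (norm1cD _ _) _; rewrite [leRHS]mulrDl; apply: lerD.
  + by apply: le_trans (H1 _ _) _; rewrite expr0 divr1.
  + by apply: le_trans (H2 _ _) _; rewrite expr0 divr1.
Qed.

Inductive osc_span : (V -> R[i]) -> Prop :=
| osc_span_base j phi : schwartz phi -> osc_span (osc j phi)
| osc_span_add f g : osc_span f -> osc_span g -> osc_span (fun x => f x + g x).

Lemma osc_span_class : cschwartz_class osc_span.
Proof.
move=> f; elim=> [j phi sf|f1 f2 S1 [[M1 b1] d1 m1] S2 [[M2 b2] d2 m2]]; split.
- have [C _ HC] := osc_bounded j 0 sf; exists C => x.
  by apply: le_trans (HC x) _; rewrite expr0 divr1.
- move=> i; exists (osc_partial j phi i).
    apply: osc_span_add; apply: osc_span_base; first exact: schwartz_cpartial.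
    by apply: schwartzZ; exact: schwartz_cmulX.
  by move=> x; exact: osc_is_cpartial.
- by move=> i; rewrite osc_cmulX//; apply: osc_span_base; exact: schwartz_cmulX.
- by exists (M1 + M2) => x; apply: le_trans (norm1cD _ _) _; exact: lerD.
- move=> i; have [p1 Sp1 H1] := d1 i; have [p2 Sp2 H2] := d2 i.
  exists (fun x => p1 x + p2 x); first exact: osc_span_add.
  move=> x; have [a1 a2] := H1 x; have [c1 c2] := H2 x; split.
  + by under eq_fun do rewrite cReD; rewrite cReD; exact: (is_deriveD a1 c1).
  + by under eq_fun do rewrite cImD; rewrite cImD; exact: (is_deriveD a2 c2).
- move=> i; rewrite (_ : cmulX i _ = fun x => cmulX i f1 x + cmulX i f2 x).
    exact: osc_span_add.
  by apply/funext => x; rewrite /cmulX mulrDr.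
Qed.

Lemma schwartz_osc j phi : schwartz phi -> schwartz (osc j phi).
Proof.
by move=> sf; apply: (cschwartz_class_schwartz osc_span_class); exact: osc_span_base.
Qed.

End oscillatory_integral.

Lemma cmeasurable_if (R : realType) d (T : measurableType d) (b : T -> bool)
  (f g : T -> R[i]) : measurable_fun setT b -> cmeasurable f -> cmeasurable g ->
  cmeasurable (fun x => if b x then f x else g x).
Proof.
move=> mb [fr fi] [gr gi]; split.
- rewrite (_ : (fun _ => _) = fun x => if b x then complex.Re (f x) else complex.Re (g x)).
    exact: measurable_fun_ifT.
  by apply/funext => x; case: ifP.
- rewrite (_ : (fun _ => _) = fun x => if b x then complex.Im (f x) else complex.Im (g x)).
    exact: measurable_fun_ifT.
  by apply/funext => x; case: ifP.
Qed.

(** * Radial integration by parts *)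

Section radial.
Variables (R : realType) (k s : nat) (x : 'rV[R]_k).
Local Notation V := 'rV[R]_(k + s).
Local Notation leb := (@lebesgue_measure R).
Local Notation lebs := (lebesgue_tuple R s).
Local Notation en t := (enorm (rV_of t)).
Implicit Types (phi : V -> R[i]) (t : tupleR R s) (b : tupleR R s -> R) (r : R).

(* The surface measure is an integral over the punctured ball, on which unit_vector is the
   direction; b stands for a bounded function of the direction. *)
Definition radial_kernel b phi r t : R[i] :=
  if 0 < en t <= 1 then (b t)%:C * partial_fourier phi x (r *: rV_of (unit_vector t)) else 0.

Definition radial b phi r : R[i] := cintegral lebs setT (radial_kernel b phi r).

Definition direction (j : 'I_s) t : R := rV_of (unit_vector t) 0 j.

Lemma measurable_direction j : measurable_fun setT (direction j).
Proof.
rewrite (_ : direction j = (fun t => tnth t j) \o @unit_vector R s); last first.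
  by apply/funext => t; rewrite /direction rV_ofE.
by apply: measurableT_comp (@measurable_unit_vector R s); exact: measurable_tnth.
Qed.

Lemma direction_le1 j t : 0 < en t -> `|direction j t| <= 1.
Proof.
move=> t0; have : direction j t ^+ 2 <= 1.
  rewrite -[leRHS](expr1n _ 2) -(enorm_unit t0) enorm_sqr /dotr (bigD1 j)//= -expr2.
  by rewrite lerDl sumr_ge0// => i _; rewrite -expr2 sqr_ge0.
by rewrite -real_normK ?num_real// => H; rewrite -(@expr_le1 _ 2).
Qed.

Lemma sum_direction t : 0 < en t -> \sum_j direction j t * direction j t = 1.
Proof.
by move=> t0; rewrite -[RHS](expr1n _ 2) -(enorm_unit t0) enorm_sqr.
Qed.

Lemma radial_kernel_cmeasurable b phi r : schwartz phi -> measurable_fun setT b ->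
  cmeasurable (radial_kernel b phi r).
Proof.
move=> sf mb; apply: (@cmeasurable_if R _ _ (fun t => 0 < en t <= 1) (fun t => (b t)%:C *
  partial_fourier phi x (r *: rV_of (unit_vector t))) (fun=> 0));
  [exact: measurable_in_ball| |exact: cmeasurable_cst].
apply: cmeasurableM; first exact: cmeasurable_real.
have := cmeasurable_comp (partial_fourier_cmeasurable sf) (pair1_measurable (tuple_of_rV x)).
under eq_fun do rewrite /= rV_of_surj.
move=> H; have := cmeasurable_comp H (measurableT_comp (@measurable_scale_tuple_cst R s r)
  (@measurable_unit_vector R s)).
by under eq_fun do rewrite /= rV_of_scale.
Qed.

Lemma radial_kernel_dom b phi M : schwartz phi ->
  (forall t, 0 < en t -> `|b t| <= M) -> exists2 C, 0 <= C &
  forall r t, norm1c (radial_kernel b phi r t) <= if 0 < en t <= 1 then C else 0.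
Proof.
move=> sf bM; have [C C0 HC] := partial_fourier_bounded 0 sf.
exists (`|M| * C); first by rewrite mulr_ge0.
move=> r t; rewrite /radial_kernel; case: ifPn => [/andP[t0 _]|_]; last by rewrite norm1c0.
rewrite norm1cZ ler_pM ?norm1c_ge0//; first by rewrite (le_trans (bM t t0))// ler_norm.
by apply: le_trans (HC _ _) _; rewrite expr0 divr1.
Qed.

Definition bounded_weight b := measurable_fun setT b /\
  exists M, forall t, 0 < en t -> `|b t| <= M.

Lemma radial_kernel_integrable b phi r : schwartz phi -> bounded_weight b ->
  cintegrable lebs setT (radial_kernel b phi r).
Proof.
move=> sf [mb [M bM]]; have [C C0 HC] := radial_kernel_dom sf bM.
exact: cintegrable_dom (radial_kernel_cmeasurable r sf mb) (integrable_ball _ C0) (HC r).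
Qed.

Lemma radial_bounded b phi : schwartz phi -> bounded_weight b ->
  exists C, forall r, norm1c (radial b phi r) <= C.
Proof.
move=> sf [mb [M bM]]; have [C C0 HC] := radial_kernel_dom sf bM.
exists (\int[lebs]_t (if 0 < en t <= 1 then C else 0)) => r.
exact: norm1c_cintegral (radial_kernel_cmeasurable r sf mb) (integrable_ball _ C0) (HC r).
Qed.

Lemma bounded_weight_direction b j : bounded_weight b ->
  bounded_weight (fun t => b t * direction j t).
Proof.
move=> [mb [M bM]]; split; first by apply: measurable_funM => //; exact: measurable_direction.
exists M => t t0; rewrite normrM -[leRHS]mulr1 ler_pM//; first exact: bM.
exact: direction_le1.
Qed.

Lemma radial_is_cderive b phi r : schwartz phi -> bounded_weight b ->
  is_cderive (radial b phi) r (\sum_j radial (fun t => b t * direction j t)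
    (fun v => - 'i%C * cmulX (rshift k j) phi v) r).
Proof.
move=> sf wb.
have sj j : schwartz (fun v => - 'i%C * cmulX (rshift k j) phi v).
  by apply: schwartzZ; exact: schwartz_cmulX.
have wj j := bounded_weight_direction j wb.
have dom j : exists C : R, forall r t,
    norm1c (radial_kernel (fun t => b t * direction j t)
      (fun v => - 'i%C * cmulX (rshift k j) phi v) r t) <= if 0 < en t <= 1 then `|C| else 0.
  have [mj [M jM]] := wj j.
  by have [C C0 HC] := radial_kernel_dom (sj j) jM; exists C; rewrite ger0_norm.
have [C HC] := choice dom.
have ik j : cintegrable lebs setT (radial_kernel (fun t => b t * direction j t)
    (fun v => - 'i%C * cmulX (rshift k j) phi v) r) by exact: radial_kernel_integrable.
rewrite -(cintegral_sum _ ik).1.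
apply: (is_cderive_cintegral (f := radial_kernel b phi)
  (df := fun r t => \sum_j radial_kernel (fun t => b t * direction j t)
      (fun v => - 'i%C * cmulX (rshift k j) phi v) r t) _ _ _
  (@integrable_ball R s (\sum_j `|C j|) (sumr_ge0 _ (fun _ _ => normr_ge0 _)))).
- by move=> u; exact: radial_kernel_integrable.
- move=> u t; rewrite /radial_kernel; case: (0 < en t <= 1); last first.
    by rewrite big1//; exact: is_cderive_cst.
  apply: (is_cderive_eq (is_cderiveM (is_cderive_cst _ u)
    (partial_fourier_is_cderive_r x (rV_of (unit_vector t)) u sf))).
  rewrite mul0r add0r mulr_sumr; apply: eq_bigr => j _.
  by rewrite realC_M mulrA.
- move=> u t; apply: (@le_trans _ _ (\sum_j if 0 < en t <= 1 then `|C j| else 0)).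
    elim/big_rec2 : _ => [|j v w _ H]; first by rewrite norm1c0.
    by apply: le_trans (norm1cD _ _) _; exact: lerD.
  by case: ifPn => // _; rewrite big1.
Qed.

Lemma radial_mulr b phi r : schwartz phi -> bounded_weight b ->
  r%:C * radial b phi r = \sum_j radial (fun t => b t * direction j t)
    (fun v => - 'i%C * cpartial (rshift k j) phi v) r.
Proof.
move=> sf wb.
have sj j : schwartz (fun v => - 'i%C * cpartial (rshift k j) phi v).
  by apply: schwartzZ; exact: schwartz_cpartial.
have ik j : cintegrable lebs setT (radial_kernel (fun t => b t * direction j t)
    (fun v => - 'i%C * cpartial (rshift k j) phi v) r).
  by apply: radial_kernel_integrable => //; exact: bounded_weight_direction.
rewrite -(cintegral_sum _ ik).1.
rewrite -cintegralZ; last exact: radial_kernel_integrable.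
congr cintegral; apply/funext => t; rewrite /radial_kernel.
case: ifPn => [/andP[t0 _]|_]; last by rewrite mulr0 big1.
under eq_bigr => j _.
  rewrite partial_fourierZ; last exact: schwartz_cpartial.
  rewrite partial_fourier_cpartial_r// mxE -/(direction j t).
  rewrite (_ : _ * _ = (direction j t * direction j t)%:C *
    (r%:C * ((b t)%:C * partial_fourier phi x (r *: rV_of (unit_vector t))))); last first.
    move: (partial_fourier _ _ _) => u; rewrite !rmorphM /=.
    have i2 : 'i%C * 'i%C = -1 :> R[i] by rewrite -expr2 sqr_i.
    transitivity (- ('i%C * 'i%C) * ((b t)%:C * (direction j t)%:C * (r%:C * (direction j t)%:C) * u)); first ring.
    by rewrite i2 opprK; ring.
  over.
by rewrite -mulr_suml -rmorph_sum sum_direction// mul1r.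
Qed.

(* Closed under d/dr and under multiplication by r, hence made of functions of rapid
   decay: on the sphere r = sum_j omega_j (r omega_j), and r omega_j T[phi] is the transform
   of a derivative of phi. *)
Inductive radial_span : (R -> R[i]) -> Prop :=
| radial_span_zero : radial_span (fun=> 0)
| radial_span_base b phi : schwartz phi -> bounded_weight b -> radial_span (radial b phi)
| radial_span_add f g : radial_span f -> radial_span g -> radial_span (fun r => f r + g r).

Lemma radial_span_sum (I : Type) (l : seq I) (F : I -> R -> R[i]) :
  (forall i, radial_span (F i)) -> radial_span (fun r => \sum_(i <- l) F i r).
Proof.
move=> H; elim: l => [|i l IH].
  by under eq_fun do rewrite big_nil; exact: radial_span_zero.
by under eq_fun do rewrite big_cons; exact: radial_span_add.
Qed.

Lemma radial_span_natmul h m : radial_span h -> radial_span (fun r => h r *+ m).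
Proof.
move=> Sh; elim: m => [|m IH].
  by under eq_fun do rewrite mulr0n; exact: radial_span_zero.
by under eq_fun do rewrite mulrS; exact: radial_span_add.
Qed.

Lemma radial_span_bounded h : radial_span h -> exists C, forall r, norm1c (h r) <= C.
Proof.
elim=> [|b phi sf wb|f g _ [M1 H1] _ [M2 H2]].
- by exists 0 => r; rewrite norm1c0.
- exact: radial_bounded.
- by exists (M1 + M2) => r; apply: le_trans (norm1cD _ _) _; exact: lerD.
Qed.

Lemma radial_span_derive h : radial_span h ->
  exists2 h', radial_span h' & forall r, is_cderive h r (h' r).
Proof.
elim=> [|b phi sf wb|f g _ [f' Sf Hf] _ [g' Sg Hg]].
- by exists (fun=> 0) => [|r]; [exact: radial_span_zero|exact: is_cderive_cst].
- exists (fun r => \sum_j radial (fun t => b t * direction j t)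
    (fun v => - 'i%C * cmulX (rshift k j) phi v) r); last by move=> r; exact: radial_is_cderive.
  apply: radial_span_sum => j; apply: radial_span_base; last exact: bounded_weight_direction.
  by apply: schwartzZ; exact: schwartz_cmulX.
- by exists (fun r => f' r + g' r) => [|r]; [exact: radial_span_add|exact: is_cderiveD].
Qed.

Lemma radial_span_mulr h : radial_span h -> radial_span (fun r => r%:C * h r).
Proof.
elim=> [|b phi sf wb|f g _ Sf _ Sg].
- by under eq_fun do rewrite mulr0; exact: radial_span_zero.
- under eq_fun do rewrite radial_mulr//.
  apply: radial_span_sum => j; apply: radial_span_base; last exact: bounded_weight_direction.
  by apply: schwartzZ; exact: schwartz_cpartial.
- by under eq_fun do rewrite mulrDr; exact: radial_span_add.
Qed.

Lemma radial_span_expr h m : radial_span h -> radial_span (fun r => (r ^+ m)%:C * h r).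
Proof.
move=> Sh; elim: m => [|m IH].
  by under eq_fun do rewrite expr0 mul1r.
by under eq_fun do rewrite exprS realC_M -mulrA; exact: radial_span_mulr.
Qed.

Lemma radial_span_decay h : radial_span h ->
  exists C, forall r, norm1c (h r) <= C / oneDsqr r.
Proof.
move=> Sh; have [C1 H1] := radial_span_bounded Sh.
have [C2 H2] := radial_span_bounded (radial_span_expr 2 Sh).
exists (C1 + C2) => r; rewrite ler_pdivlMr; last by rewrite ltr_pwDl ?sqr_ge0.
rewrite /oneDsqr mulrDr mulr1; apply: lerD; first exact: H1.
by have := H2 r; rewrite norm1cZ ger0_norm ?sqr_ge0// mulrC.
Qed.

End radial.

(** * Integration by parts on the half-line *)

Section radial_by_parts.
Variable R : realType.
Local Notation leb := (@lebesgue_measure R).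
Local Notation Re := complex.Re.
Local Notation Im := complex.Im.
Implicit Types (f g h : R -> R[i]) (r p : R).

Lemma cderive1nS g dg m : (forall r, is_cderive g r (dg r)) ->
  cderive1n m.+1 g = cderive1n m dg.
Proof.
move=> H; apply/funext => r; rewrite /cderive1n !derive1Sn.
rewrite (_ : derive1 (fun u => Re (g u)) = fun u => Re (dg u)); last first.
  by apply/funext => u; have [d1 _] := H u; rewrite derive1E derive_val.
rewrite (_ : derive1 (fun u => Im (g u)) = fun u => Im (dg u))//.
by apply/funext => u; have [_ d2] := H u; rewrite derive1E derive_val.
Qed.

(** Strong enough for integrability and for vanishing at infinity, and stable under multiplication
    by the phase. *)
Definition cdecay f := cmeasurable (f : measurableTypeR R -> R[i]) /\
  exists C, forall r, norm1c (f r) <= C / oneDsqr r.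

Lemma oneDsqrV_ge0 r : 0 <= (oneDsqr r)^-1.
Proof. by rewrite invr_ge0 (le_trans ler01 (oneDsqr_ge1 _)). Qed.

Lemma cdecay_cexpi f p : cdecay f -> cdecay (fun r => f r * cexpi (- (r * p))).
Proof.
move=> [mf [C HC]]; split.
  apply: cmeasurableM mf _; apply: cmeasurable_cexpi; apply: measurableT_comp => //.
  exact: measurable_funM.
exists (C * 2) => r; apply: le_trans (norm1c_mul_cexpi _ _) _.
by rewrite mulrAC ler_wpM2r.
Qed.

Lemma cdecayZ (c : R[i]) f : cdecay f -> cdecay (fun r => c * f r).
Proof.
move=> [mf [C HC]]; split; first by apply: cmeasurableM => //; exact: cmeasurable_cst.
exists (norm1c c * C) => r; apply: le_trans (norm1cM _ _) _; rewrite -mulrA.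
by rewrite ler_wpM2l// norm1c_ge0.
Qed.

Lemma cdecayD f g : cdecay f -> cdecay g -> cdecay (fun r => f r + g r).
Proof.
move=> [mf [C HC]] [mg [D HD]]; split; first exact: cmeasurableD.
by exists (C + D) => r; apply: le_trans (norm1cD _ _) _; rewrite mulrDl; exact: lerD.
Qed.

Lemma cdecay_integrable f : cdecay f ->
  cintegrable leb setT (fun r => if r \in `]0%R, +oo[%classic then f r else 0).
Proof.
move=> [mf [C HC]].
have ih : leb.-integrable setT (EFin \o (fun r => C * (oneDsqr r)^-1)).
  exact: (integrableZl measurableT C (@integrable_oneDsqrV R)).
have C0 r : 0 <= C / oneDsqr r by apply: le_trans (HC r); exact: norm1c_ge0.
apply: (cintegrable_dom _ ih) => [|r]; last by case: ifPn => // _; rewrite norm1c0.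
apply: (@cmeasurable_if R _ _ (fun r : measurableTypeR R => r \in `]0%R, +oo[%classic) f
  (fun=> 0)) => //.
apply: (measurable_fun_bool true); rewrite setTI (_ : _ @^-1` _ = `]0%R, +oo[%classic)//.
by apply/seteqP; split => r rA; [exact: set_mem|exact: mem_set].
Qed.

Lemma integral_posD f g : cdecay f -> cdecay g ->
  integral_pos (fun r => f r + g r) = integral_pos f + integral_pos g.
Proof.
move=> /cdecay_integrable If /cdecay_integrable Ig.
rewrite /integral_pos !(cintegral_mkcond leb `]0%R, +oo[%classic) -cintegralD//.
by congr cintegral; apply/funext => r; case: ifP => // _; rewrite addr0.
Qed.

Lemma integral_posZ c f : cdecay f ->
  integral_pos (fun r => c * f r) = c * integral_pos f.
Proof.
move=> /cdecay_integrable If.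
rewrite /integral_pos !(cintegral_mkcond leb `]0%R, +oo[%classic) -cintegralZ//.
by congr cintegral; apply/funext => r; case: ifP => // _; rewrite mulr0.
Qed.

Lemma eq_integral_pos f g : (forall r, 0 < r -> f r = g r) ->
  integral_pos f = integral_pos g.
Proof.
move=> fg; rewrite /integral_pos !(cintegral_mkcond leb `]0%R, +oo[%classic).
congr cintegral; apply/funext => r; case: ifPn => // /set_mem /=.
by rewrite in_itv /= andbT => /fg.
Qed.

Lemma integral_pos_derive f df : (forall r, is_cderive f r (df r)) ->
  continuous (fun r => Re (df r)) -> continuous (fun r => Im (df r)) ->
  cdecay f -> cdecay df -> integral_pos df = - f 0.
Proof.
move=> H cr ci [_ [C1 H1]] [_ [C2 H2]].
have b1 r : C1 / oneDsqr r <= Num.max C1 C2 / oneDsqr r.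
  by rewrite ler_wpM2r ?oneDsqrV_ge0// le_max lexx.
have b2 r : C2 / oneDsqr r <= Num.max C1 C2 / oneDsqr r.
  by rewrite ler_wpM2r ?oneDsqrV_ge0// le_max lexx orbT.
apply: complex_ext; rewrite ?cReN ?cImN.
- apply: (@Rintegral_derive_pos R (fun r => Re (f r)) _ (Num.max C1 C2)) => // r.
  + by have [] := H r.
  + by apply: le_trans (b1 r); apply: le_trans (H1 r); exact: Re_le_norm1c.
  + by apply: le_trans (b2 r); apply: le_trans (H2 r); exact: Re_le_norm1c.
- apply: (@Rintegral_derive_pos R (fun r => Im (f r)) _ (Num.max C1 C2)) => // r.
  + by have [] := H r.
  + by apply: le_trans (b1 r); apply: le_trans (H1 r); exact: Im_le_norm1c.
  + by apply: le_trans (b2 r); apply: le_trans (H2 r); exact: Im_le_norm1c.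
Qed.

Variables (k s : nat) (x : 'rV[R]_k).
Local Notation radial_span := (@radial_span R k s x).

Lemma radial_span_cdecay h : radial_span h -> cdecay h.
Proof.
move=> Sh; split; last exact: (radial_span_decay Sh).
have [h' _ Hh] := radial_span_derive Sh.
have [c1 c2] := is_cderive_continuous Hh.
by split; exact: continuous_measurable_fun.
Qed.

(** The derivative of [u^(m+1) h] is [u^m h1] with [h1 = (m+1) h + u h'], again in the span, so the
    induction hypothesis disposes of the other m derivatives. One integration by parts remains; its
    boundary term vanishes because of the factor [r^(m+1)] at 0. *)
Lemma radial_by_parts m p h : radial_span h ->
  integral_pos (fun r => cderive1n m (fun u => (u ^+ m)%:C * h u) r * cexpi (- (r * p))) =
  ('i%C * p%:C) ^+ m * integral_pos (fun r => (r ^+ m)%:C * h r * cexpi (- (r * p))).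
Proof.
elim: m h => [|m IH] h Sh.
  rewrite expr0 mul1r; congr integral_pos; apply/funext => r; rewrite /cderive1n /=.
  by rewrite !expr0 !mul1r; case: (h r).
have [h' Sh' Hh] := radial_span_derive Sh.
pose h1 r := h r *+ m.+1 + r%:C * h' r.
have Sh1 : radial_span h1.
  apply: radial_span_add; first exact: radial_span_natmul.
  exact: radial_span_mulr.
have D r : is_cderive (fun u => (u ^+ m.+1)%:C * h u) r ((r ^+ m)%:C * h1 r).
  have H := is_cderive_real (is_derive_exp m.+1 r).
  apply: (is_cderive_eq (is_cderiveM H (Hh r))).
  rewrite /h1 exprS !rmorphM /= rmorph_nat -mulr_natr.
  ring.
rewrite (cderive1nS _ D) (IH _ Sh1) [_ ^+ m.+1]exprSr -mulrA; congr (_ * _).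
have S0 := radial_span_expr m.+1 Sh; have S1 := radial_span_expr m Sh1.
have d0 := cdecay_cexpi p (radial_span_cdecay S0).
have d1 := cdecay_cexpi p (radial_span_cdecay S1).
apply/eqP; rewrite -subr_eq0 -mulNr -integral_posZ// -integral_posD//; last exact: cdecayZ.
pose F r := (r ^+ m.+1)%:C * h r * cexpi (- (r * p)).
pose dF r := (r ^+ m)%:C * h1 r * cexpi (- (r * p)) + - ('i%C * p%:C) * F r.
have E r : is_cderive (fun r => cexpi (- (r * p))) r ('i%C * (- p)%:C * cexpi (- (r * p))).
  have := is_cderive_cexpi_linear (- p) r; rewrite mulrN.
  by under [X in is_cderive X]eq_fun do rewrite mulrN.
have DF r : is_cderive F r (dF r).
  apply: (is_cderive_eq (is_cderiveM (D r) (E r))).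
  by rewrite /dF /F rmorphN /=; ring.
(* A second derivative is taken in order to know that [dF] is continuous, as the fundamental theorem
   of calculus requires. *)
have [v _ Hv] := radial_span_derive S1.
have DdF r : is_cderive dF r (v r * cexpi (- (r * p)) +
    (r ^+ m)%:C * h1 r * ('i%C * (- p)%:C * cexpi (- (r * p))) +
    (0 * F r + - ('i%C * p%:C) * dF r)).
  apply: is_cderiveD (is_cderiveM (Hv r) (E r)) _.
  exact: is_cderiveM (is_cderive_cst _ r) (DF r).
have [c1 c2] := is_cderive_continuous DdF.
rewrite (@integral_pos_derive F dF)//; first by rewrite /F expr0n !mul0r oppr0.
exact: cdecayD d1 (cdecayZ _ d0).
Qed.

End radial_by_parts.

(** * The functions phi_t *)

Section polar_osc.
Variables (R : realType) (n s : nat).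
Hypothesis s_gt0 : (0 < s)%N.
Local Notation V := 'rV[R]_(n + n).
Local Notation lebs := (lebesgue_tuple R s).
Local Notation sph := (@sphere_measure R s).
Local Notation en t := (enorm (rV_of t)).
Implicit Types (phi : 'rV[R]_(n + n + s) -> R[i]) (x : V).

Let weight_s : bounded_weight (fun=> s%:R : R) (s := s).
Proof. by split; [exact: measurable_cst|exists s%:R => t _; rewrite ger0_norm]. Qed.

Lemma sphere_mean_radial phi x r : schwartz phi ->
  sphere_mean phi x r = radial x (fun=> s%:R) phi r.
Proof.
move=> sf; have [C C0 HC] := partial_fourier_bounded 0 sf.
have := cmeasurable_comp (partial_fourier_cmeasurable sf) (pair1_measurable (tuple_of_rV x)).
under eq_fun do rewrite /= rV_of_surj.
move=> H; have := cmeasurable_comp H (@measurable_scale_tuple_cst R s r).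
under eq_fun do rewrite /= rV_of_scale.
move=> mf; rewrite /sphere_mean /integral_sphere (@cintegral_sphere _ _ _ C)//.
by move=> t; apply: le_trans (HC _ _) _; rewrite expr0 divr1.
Qed.

Lemma osc_kernel_sphere lam j phi x r : schwartz phi -> 0 < r ->
  cintegral sph setT (fun t => osc_kernel lam j phi x (scale_tuple r t)) =
  (r ^+ j)%:C * cexpi (- (r * (lam * Pform x))) * radial x (fun=> s%:R) phi r.
Proof.
move=> sf r0; have [C C0 HC] := osc_kernel_dom lam j 0 sf.
rewrite (@cintegral_sphere _ _ _ C).
- rewrite -cintegralZ; last exact: radial_kernel_integrable.
  congr cintegral; apply/funext => t; rewrite /radial_kernel.
  case: ifPn => [/andP[t0 _]|_]; last by rewrite mulr0.
  rewrite /osc_kernel rV_of_scale enormZ enorm_unit// mulr1 gtr0_norm// [lam * r]mulrC.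
  by rewrite -[r * lam * _]mulrA; move: (partial_fourier _ _ _) => u; ring.
- exact: cmeasurable_comp (osc_kernel_cmeasurable lam j x sf) (@measurable_scale_tuple_cst R s r).
- move=> t; apply: le_trans (HC _ _) _; rewrite expr0 divr1 ler_piMr//.
  by rewrite invf_le1 ?exprn_ege1 ?jb_ge1// exprn_gt0// jb_gt0.
Qed.

Lemma osc_polar lam j phi x : schwartz phi -> (0 < j)%N -> osc lam j phi x =
  integral_pos (fun r => (r ^+ j)%:C * ((r ^+ s.-1)%:C * radial x (fun=> s%:R) phi r) *
    cexpi (- (r * (lam * Pform x)))).
Proof.
move=> sf j0; have mk := osc_kernel_cmeasurable lam j x sf.
have [C C0 HC] := osc_kernel_dom lam j 0 sf.
rewrite /osc (@cintegral_polar _ _ _ (fun t => norm1c (osc_kernel lam j phi x t)) C)//.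
- apply: eq_integral_pos => r r0; rewrite osc_kernel_sphere//.
  by move: (radial _ _ _ _) => u; ring.
- exact: measurable_norm1c.
- move=> t; apply: le_trans (HC _ _) _; rewrite expr0 divr1 ler_piMr//.
  by rewrite invf_le1 ?exprn_ege1 ?jb_ge1// exprn_gt0// jb_gt0.
(* Here [j > 0] enters: the kernel vanishes at the origin, the point that the punctured ball leaves
   out. *)
- by move=> t t0; rewrite /osc_kernel t0 expr0n gtn_eqF// mul0r norm1c0.
- by apply: cintegrable_norm1c; exact: osc_kernel_integrable.
Qed.

(** In [r^(n+s-2) = r^(n-1) r^(s-1)] the first factor makes the boundary terms of the [n - 1]
    integrations by parts vanish and survives as [|theta|^(n-1)]; the second is the Jacobian of
    polar coordinates. *)
Lemma phi_t_osc phi t x : schwartz phi -> (2 <= n)%N ->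
  phi_t phi t x = ('i%C * (coth t / 4 * Pform x)%:C) ^+ (n - 1) *
    osc (coth t / 4) (n - 1) phi x.
Proof.
move=> sf n2; rewrite osc_polar ?subn_gt0//.
rewrite -(@radial_by_parts R _ s x); last first.
  by apply: radial_span_expr; exact: radial_span_base.
rewrite /phi_t; congr integral_pos; apply/funext => r; congr (cderive1n _ _ _ * cexpi (- _)).
  apply/funext => u; rewrite sphere_mean_radial// mulrA -realC_M -exprD.
  by congr ((u ^+ _)%:C * _); lia.
by field.
Qed.

Lemma schwartz_phi_t phi t : schwartz phi -> (2 <= n)%N -> schwartz (phi_t phi t).
Proof.
move=> sf n2.
rewrite (_ : phi_t phi t = fun x => ('i%C * (coth t / 4)%:C) ^+ (n - 1) *
  ((Pform x ^+ (n - 1))%:C * osc (coth t / 4) (n - 1) phi x)).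
  by apply: schwartzZ; apply: schwartz_Pform; exact: schwartz_osc.
apply/funext => x; rewrite phi_t_osc// realC_M realC_X !exprMn; ring.
Qed.

End polar_osc.

(** * The regularized power of the quadratic form *)

Section complex_limits.
Variable R : realType.
Local Notation Re := complex.Re.
Local Notation Im := complex.Im.

Lemma normc_le_norm1c (z : R[i]) : `|z| <= (norm1c z)%:C.
Proof.
rewrite normc_def lecR /norm1c -[leRHS]ger0_norm ?addr_ge0// -sqrtr_sqr ler_sqrt ?sqr_ge0//.
rewrite sqrrD !real_normK ?num_real// lerD2r lerDl mulrn_wge0// mulr_ge0//.
Qed.

Lemma cvg_complex (T : Type) (F : set_system T) (FF : Filter F) (f : T -> R[i]^o) (l : R[i]) :
  (fun t => Re (f t)) @ F --> Re l -> (fun t => Im (f t)) @ F --> Im l ->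
  f @ F --> (l : R[i]^o).
Proof.
move=> H1 H2; apply/cvgrPdist_lt => e; rewrite ltcE /= => /andP[/eqP e1 e0].
have e2 : 0 < Re e / 2 by rewrite divr_gt0.
move/cvgrPdist_lt : H1 => /(_ _ e2) H1; move/cvgrPdist_lt : H2 => /(_ _ e2) H2.
near=> t; apply: le_lt_trans (normc_le_norm1c _) _.
rewrite ltcE /= e1 eqxx /= /norm1c cReD cImD cReN cImN [ltRHS](splitr (Re e)).
by apply: ltrD; near: t.
Unshelve. all: by end_near. Qed.

Lemma ccvg_cst (l : R[i]) : ccvg (fun=> l) l.
Proof. by split; exact: cvg_cst. Qed.

Lemma ccvgM (u v : nat -> R[i]) (k l : R[i]) : ccvg u k -> ccvg v l ->
  ccvg (fun n => u n * v n) (k * l).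
Proof.
move=> [u1 u2] [v1 v2]; split.
- rewrite cReM; under eq_fun do rewrite cReM.
  by apply: cvgB; exact: cvgM.
- rewrite cImM; under eq_fun do rewrite cImM.
  by apply: cvgD; exact: cvgM.
Qed.

Lemma ccvgX (u : nat -> R[i]) (l : R[i]) m : ccvg u l -> ccvg (fun n => u n ^+ m) (l ^+ m).
Proof.
move=> ul; elim: m => [|m IH]; first by rewrite expr0; under eq_fun do rewrite expr0; exact: ccvg_cst.
by rewrite exprS; under eq_fun do rewrite exprS; exact: ccvgM.
Qed.

Lemma real_div_sub_i (a e : R) : e != 0 ->
  a%:C / (a%:C - 'i%C * e%:C) = (a ^+ 2 / (a ^+ 2 + e ^+ 2)) +i* (a * e / (a ^+ 2 + e ^+ 2)).
Proof.
move=> e0; have d0 : a ^+ 2 + e ^+ 2 != 0.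
  by rewrite gt_eqF// ltr_wpDl ?sqr_ge0// exprn_even_gt0.
have z0 : a%:C - 'i%C * e%:C != 0.
  apply/negP => /eqP /(congr1 (@complex.Im R)); rewrite cImD cImN cImM /= => H.
  by move/eqP: e0; apply; move: H; lra.
apply: (mulIf z0); rewrite divfK//; apply: complex_ext.
- by rewrite cReM cReD cImD cReN cImN cReM cImM /=; field.
- by rewrite cImM cReD cImD cReN cImN cReM cImM /=; field.
Qed.

(** The bound is uniform in [e], which is what dominated convergence asks for when the
    regularization is removed. *)
Lemma norm1c_real_div_sub_i (a e : R) : e != 0 -> norm1c (a%:C / (a%:C - 'i%C * e%:C)) <= 2.
Proof.
move=> e0; have d0 : 0 < a ^+ 2 + e ^+ 2.
  by rewrite ltr_wpDl ?sqr_ge0// exprn_even_gt0.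
rewrite real_div_sub_i// /norm1c /= !normrM normfV (gtr0_norm d0) -mulrDl ler_pdivrMr//.
rewrite -normrM [`|a ^+ 2|]ger0_norm ?sqr_ge0//.
have : `|a * e| <= a ^+ 2 + e ^+ 2.
  have := sqr_ge0 (a + e); have := sqr_ge0 (a - e); have := sqr_ge0 a; have := sqr_ge0 e.
  by rewrite ler_norml sqrrB sqrrD => *; apply/andP; split; nra.
by rewrite normrM; have := sqr_ge0 e; lra.
Qed.

Lemma ccvg_real_div_sub_i (a : R) (e : nat -> R) : a != 0 -> (forall n, e n != 0) ->
  e n @[n --> \oo] --> (0 : R) -> ccvg (fun n => a%:C / (a%:C - 'i%C * (e n)%:C)) 1.
Proof.
move=> a0 en0 e0.
have a2 : a ^+ 2 != 0 by rewrite expf_neq0.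
have D : (a ^+ 2 + e n ^+ 2)^-1 @[n --> \oo] --> (a ^+ 2)^-1.
  have S : a ^+ 2 + e n ^+ 2 @[n --> \oo] --> a ^+ 2 + 0 * 0.
    apply: cvgD; first exact: cvg_cst.
    by under eq_fun do rewrite expr2; exact: cvgM.
  by rewrite mulr0 addr0 in S; exact: cvgV.
split.
- under eq_fun do rewrite real_div_sub_i//=.
  by rewrite /= -(divff a2); apply: cvgM => //; exact: cvg_cst.
- under eq_fun do rewrite real_div_sub_i//=.
  have S : a * e n / (a ^+ 2 + e n ^+ 2) @[n --> \oo] --> a * 0 / a ^+ 2.
    by apply: cvgM => //; apply: cvgM => //; exact: cvg_cst.
  by rewrite mulr0 mul0r in S.
Qed.

End complex_limits.

Lemma measurable_Pform0 (R : realType) n :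
  measurable [set t : tupleR R (n + n) | Pform (rV_of t) = 0].
Proof.
rewrite (_ : [set t | _] = (fun t => Pform (rV_of t)) @^-1` [set 0]); last first.
  by apply/seteqP; split.
by rewrite -[X in measurable X]setTI; exact: measurable_Pform.
Qed.

(** With all coordinates but the first fixed, the equation reads [x ^+ 2 = - c] and has at most two
    solutions. *)
Lemma Pform_null (R : realType) n : (0 < n)%N ->
  lebesgue_tuple R (n + n) [set t | Pform (rV_of t) = 0] = 0%E.
Proof.
case: n => // n _; pose A : set (tupleR R (n + n.+1).+1) := [set t | @Pform R n.+1 (rV_of t) = 0].
apply: (@null_of_finite_sections R (n + n.+1)%N A (@measurable_Pform0 R n.+1)) => t.
pose c := \sum_(i < n + n.+1) @signP R n.+1 (lift ord0 i) * ((tnth t i : R) * tnth t i).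
apply: (@sub_finite_set _ _ [set Num.sqrt (- c); - Num.sqrt (- c)]); last exact: finite_set2.
move=> x; rewrite /A /= => H.
have xc : x ^+ 2 = - c.
  apply/eqP; rewrite -addr_eq0 -[X in _ == X]H PformE big_ord_recl /c.
  rewrite {1}/signP mul1r expr2; apply/eqP; congr (_ * _ + _); rewrite ?rV_ofE//.
  apply: eq_bigr => i _; rewrite !rV_ofE; congr (_ * (_ * _)); rewrite !(tnth_nth x)//.
have := sqrtr_sqr x; rewrite xc => ->; case: (leP 0 x) => x0.
  by left; rewrite ger0_norm.
by right; rewrite ltr0_norm ?opprK.
Qed.

(** * The limit defining the regularized power *)

Section Pinv_limit.
Variables (R : realType) (n : nat).
Hypothesis n_gt0 : (0 < n)%N.
Local Notation V := 'rV[R]_(n + n).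
Local Notation leb := (lebesgue_tuple R (n + n)).
Local Notation Re := complex.Re.
Local Notation Im := complex.Im.

Lemma schwartz_cintegrable (chi : V -> R[i]) : schwartz chi ->
  cintegrable leb setT (fun t => chi (rV_of t)).
Proof.
move=> sc; have [C _ HC] := schwartz_decay (n + n) sc.
exact: cintegrable_dom (schwartz_cmeasurable sc) (integrable_jb_scale _ C) (fun t => HC _).
Qed.

(** Numerator and denominator combine into [(P / (P - i eps))^(n-1)], which is bounded uniformly in
    [eps] and tends to 1 off the null set [P = 0]. *)
Lemma Pinv_reg_cvg (chi : V -> R[i]) : schwartz chi -> forall c : R[i],
  Pinv_reg (fun x => c * ((Pform x ^+ (n - 1))%:C * chi x)) eps @[eps --> 0^'+] -->
  (c * integral_Rn chi : R[i]^o).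
Proof.
move=> sc c; pose f (x : V) := c * ((Pform x ^+ (n - 1))%:C * chi x).
rewrite -[X in Pinv_reg X]/f.
have [C C0 HC] := schwartz_decay (n + n) sc.
have mchi := schwartz_cmeasurable sc.
pose h (t : tupleR R (n + n)) := norm1c c * 2 ^+ (n - 1) * (C * (jb (rV_of t) ^+ (n + n))^-1).
pose F e (t : tupleR R (n + n)) := c * (((Pform (rV_of t))%:C /
  ((Pform (rV_of t))%:C - 'i%C * e%:C)) ^+ (n - 1) * chi (rV_of t)).
have PE e : Pinv_reg f e = cintegral leb setT (F e).
  congr cintegral; apply/funext => t; rewrite /F /f expr_div_n realC_X.
  by move: (_ ^+ _)^-1 (chi _) => u v; ring.
have mP := @measurable_Pform R n.
have mF e : e != 0 -> cmeasurable (F e).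
  move=> e0; apply: cmeasurableM; first exact: cmeasurable_cst.
  apply: cmeasurableM mchi; elim: (n - 1)%N => [|m IH].
    by under eq_fun do rewrite expr0; exact: cmeasurable_cst.
  under eq_fun do rewrite exprS; apply: cmeasurableM IH.
  under eq_fun do rewrite real_div_sub_i//.
  have mV : measurable_fun setT (fun t : tupleR R (n + n) =>
      (Pform (rV_of t) ^+ 2 + e ^+ 2)^-1).
    rewrite (_ : (fun _ => _) = fun t : tupleR R (n + n) =>
        (Pform (rV_of t) ^+ 2 + e ^+ 2) `^ (-1)).
      apply: (@measurableT_comp _ _ _ _ _ _ (fun x : R => x `^ (-1))).
        exact: measurable_powR.
      by apply: measurable_funD => //; exact: measurable_funX.
    by apply/funext => t; rewrite powR_inv1// addr_ge0 ?sqr_ge0.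
  split; apply: measurable_funM => //; first exact: measurable_funX.
  exact: measurable_funM.
have ih : leb.-integrable setT (EFin \o h).
  exact: (integrableZl measurableT _ (integrable_jb_scale _ C)).
(* Dominated convergence is about sequences; [cvg_at_rightP] reduces the one-sided limit to all
   positive sequences tending to 0. *)
have key (u : nat -> R) : (forall k, 0 < u k) -> u k @[k --> \oo] --> (0 : R) ->
    ccvg (fun k => Pinv_reg f (u k)) (c * integral_Rn chi).
  move=> u0 uc; under eq_fun do rewrite PE.
  have un0 k : u k != 0 by rewrite gt_eqF.
  rewrite /integral_Rn -cintegralZ; last exact: schwartz_cintegrable.
  apply: (dominated_ccvg (h := h)).
  - by move=> k; exact: mF.
  - by apply: cmeasurableM => //; exact: cmeasurable_cst.
  - exists [set t | Pform (rV_of t) = 0]; split => //.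
    + exact: measurable_Pform0.
    + exact: Pform_null.
    + move=> t /=; apply: contra_notP => /eqP P0.
      have W := ccvgX (n - 1) (ccvg_real_div_sub_i P0 un0 uc).
      rewrite expr1n in W.
      by have := ccvgM (ccvg_cst c) (ccvgM W (ccvg_cst (chi (rV_of t)))); rewrite mul1r.
  - exact: ih.
  - move=> k t; rewrite /F /h -mulrA.
    apply: le_trans (norm1cM _ _) _; rewrite ler_wpM2l ?norm1c_ge0//.
    apply: le_trans (norm1cM _ _) _; rewrite ler_pM ?norm1c_ge0//.
    apply: le_trans (norm1cX _ _) _; rewrite lerXn2r ?nnegrE ?norm1c_ge0//.
    exact: norm1c_real_div_sub_i.
apply: cvg_complex.
- by apply/cvg_at_rightP => u [u0 uc]; have [] := key u u0 uc.
- by apply/cvg_at_rightP => u [u0 uc]; have [] := key u u0 uc.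
Qed.

Lemma Pinv_phi_t s (phi : 'rV[R]_(n + n + s) -> R[i]) (t : R) : (0 < s)%N -> (2 <= n)%N ->
  schwartz phi ->
  cvg (Pinv_reg (phi_t phi t) eps @[eps --> 0^'+]) /\
  Pinv (phi_t phi t) = ('i%C * (coth t / 4)%:C) ^+ (n - 1) *
    integral_Rn (osc (coth t / 4) (n - 1) phi).
Proof.
move=> s0 n2 sf.
have L := @Pinv_reg_cvg _ (schwartz_osc (coth t / 4) (n - 1) sf)
  (('i%C * (coth t / 4)%:C) ^+ (n - 1)).
rewrite (_ : (fun x => _) = phi_t phi t) in L; last first.
  by apply/funext => x; rewrite phi_t_osc// [(_ * Pform x)%:C]realC_M realC_X !exprMn; ring.
split; first by apply/cvg_ex; eexists; exact: L.
exact: (cvg_lim (@norm_hausdorff _ _) L).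
Qed.

End Pinv_limit.

(** * Parseval's formula for the phase exp(iaP) *)

Section gaussian.
Variables (R : realType) (delta : R).
Hypothesis delta_gt0 : 0 < delta.
Local Notation leb := (@lebesgue_measure R).
Local Notation Re := complex.Re.
Local Notation Im := complex.Im.
Implicit Types (a x xi : R).

(** This is [exp(-c xi^2 - i x xi)] with the complex rate [c = delta - i a]. *)
Definition gaussc a x xi : R[i] :=
  (expR (- (delta * xi ^+ 2)))%:C * cexpi (a * xi ^+ 2 - xi * x).

(** Of the two factors [1 / oneDsqr xi], one pays for [xi^k] with [k <= 2] and the other for
    integrability. *)
Lemma expRN_sqr_le : exists2 C, 0 <= C &
  forall xi, expR (- (delta * xi ^+ 2)) <= C / oneDsqr xi / oneDsqr xi.
Proof.
(* For [u = delta xi^2 / 2] one has [1 + xi^2 <= (1 + 2 / delta) (1 + u)] and [1 + u <= e^u];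
   squaring gives the constant. *)
exists ((1 + 2 / delta) ^+ 2) => [|xi]; first exact: sqr_ge0.
have o0 : 0 < oneDsqr xi by rewrite (lt_le_trans ltr01)// oneDsqr_ge1.
rewrite -mulrA -invfM ler_pdivlMr ?mulr_gt0// expRN mulrC ler_pdivrMr ?expR_gt0//.
rewrite [delta * _](_ : _ = delta / 2 * xi ^+ 2 + delta / 2 * xi ^+ 2); last by field.
have C0 : 0 <= 1 + 2 / delta by rewrite addr_ge0// divr_ge0// ltW.
rewrite expRD -!expr2 -exprMn lerXn2r ?nnegrE ?(ltW o0) ?mulr_ge0 ?expR_ge0//.
apply: (@le_trans _ _ ((1 + 2 / delta) * (1 + delta / 2 * xi ^+ 2))); last first.
  by rewrite ler_wpM2l// expR_ge1Dx.
have -> : (1 + 2 / delta) * (1 + delta / 2 * xi ^+ 2) =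
    oneDsqr xi + (2 / delta + delta / 2 * xi ^+ 2).
  by rewrite /oneDsqr; field; rewrite gt_eqF.
have d0 : 0 <= delta by exact: ltW.
by rewrite lerDl addr_ge0//; [exact: divr_ge0|rewrite mulr_ge0 ?sqr_ge0// divr_ge0].
Qed.

Lemma gaussc_cmeasurable a x : cmeasurable (gaussc a x : measurableTypeR R -> R[i]).
Proof.
apply: cmeasurableM.
  apply: cmeasurable_real; apply: measurableT_comp => //; apply: measurableT_comp => //.
  by apply: measurable_funM => //; exact: measurable_funX.
apply: cmeasurable_cexpi; apply: measurable_funB; last exact: measurable_funM.
by apply: measurable_funM => //; exact: measurable_funX.
Qed.

Lemma gaussc_moment_dom : exists2 C, 0 <= C & forall a x k xi, (k <= 2)%N ->
  norm1c ((xi ^+ k)%:C * gaussc a x xi) <= C / oneDsqr xi.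
Proof.
have [C C0 HC] := expRN_sqr_le; exists (C * 2); first by rewrite mulr_ge0.
move=> a x k xi k2; rewrite norm1cZ norm1cZ.
have o0 : 0 < oneDsqr xi by rewrite (lt_le_trans ltr01)// oneDsqr_ge1.
have xk : `|xi ^+ k| <= oneDsqr xi.
  have : 0 <= (`|xi| - 1) ^+ 2 by exact: sqr_ge0.
  have := normr_ge0 xi; rewrite /oneDsqr -(real_normK (num_real xi)) normrX.
  by case: k k2 => [|[|[|//]]] _; rewrite ?expr0 ?expr1 => ? ?; nra.
apply: (@le_trans _ _ (oneDsqr xi * (C / oneDsqr xi / oneDsqr xi * 2))).
  rewrite ler_pM ?normr_ge0 ?mulr_ge0 ?norm1c_ge0//.
  by rewrite ler_pM ?norm1c_ge0 ?norm1c_cexpi// ger0_norm ?expR_ge0.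
by rewrite le_eqVlt; apply/orP; left; apply/eqP; field; rewrite gt_eqF.
Qed.

Lemma gaussc_cdecay a x k : (k <= 2)%N -> cdecay (fun xi => (xi ^+ k)%:C * gaussc a x xi).
Proof.
move=> k2; have [C _ HC] := gaussc_moment_dom; split; last by exists C => xi; exact: HC.
apply: cmeasurableM (gaussc_cmeasurable a x).
by apply: cmeasurable_real; exact: measurable_funX.
Qed.

Lemma cdecay_cintegrable (f : R -> R[i]) : cdecay f -> cintegrable leb setT f.
Proof.
move=> [mf [C HC]].
have ih : leb.-integrable setT (EFin \o (fun r => C * (oneDsqr r)^-1)).
  exact: (integrableZl measurableT C (@integrable_oneDsqrV R)).
exact: cintegrable_dom mf ih HC.
Qed.

Lemma cintegral_derive_line (f df : R -> R[i]) : (forall r, is_cderive f r (df r)) ->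
  continuous (fun r => Re (df r)) -> continuous (fun r => Im (df r)) ->
  cdecay f -> cdecay df -> cintegral leb setT df = 0.
Proof.
move=> H cr ci [_ [C1 H1]] [_ [C2 H2]].
have b1 r : C1 / oneDsqr r <= Num.max C1 C2 / oneDsqr r.
  by rewrite ler_wpM2r ?oneDsqrV_ge0// le_max lexx.
have b2 r : C2 / oneDsqr r <= Num.max C1 C2 / oneDsqr r.
  by rewrite ler_wpM2r ?oneDsqrV_ge0// le_max lexx orbT.
apply: complex_ext.
- apply: (@Rintegral_derive_line R (fun r => Re (f r)) _ (Num.max C1 C2)) => // r.
  + by have [] := H r.
  + by apply: le_trans (b1 r); apply: le_trans (H1 r); exact: Re_le_norm1c.
  + by apply: le_trans (b2 r); apply: le_trans (H2 r); exact: Re_le_norm1c.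
- apply: (@Rintegral_derive_line R (fun r => Im (f r)) _ (Num.max C1 C2)) => // r.
  + by have [] := H r.
  + by apply: le_trans (b1 r); apply: le_trans (H1 r); exact: Im_le_norm1c.
  + by apply: le_trans (b2 r); apply: le_trans (H2 r); exact: Im_le_norm1c.
Qed.

Definition gauss_moment k a x : R[i] :=
  cintegral leb setT (fun xi => (xi ^+ k)%:C * gaussc a x xi).

Local Notation c a := (delta%:C - 'i%C * a%:C).

Lemma gaussc_is_cderive a x xi :
  is_cderive (gaussc a x) xi ((- (2 * c a * xi%:C + 'i%C * x%:C)) * gaussc a x xi).
Proof.
have D : is_derive xi (1 : R) (fun y : R => y ^+ 2) (2 * xi).
  by have := is_derive_exp 2 xi; rewrite expr1.
have D1 : is_derive xi (1 : R) (fun y => expR (- (delta * y ^+ 2)))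
    (- (delta * (2 * xi)) * expR (- (delta * xi ^+ 2))).
  apply: is_derive_eq (is_derive_chain (is_derive_expR _) (is_deriveN (is_deriveZ delta D))) _.
  by rewrite mulrC.
have D2 : is_derive xi (1 : R) (fun y : R => a * y ^+ 2 - y * x) (a * (2 * xi) - x).
  apply: is_derive_eq (is_derive_sub (is_deriveZ a D)
    (is_derive_mul (is_derive_id xi (1 : R)) (is_derive_cst x xi (1 : R)))) _.
  by rewrite mulr0 addr0 mul1r.
apply: (is_cderive_eq (is_cderiveM (is_cderive_real D1) (is_cderive_cexpi D2))).
by rewrite /gaussc !(rmorphB, rmorphM, rmorphN) /= rmorph_nat; ring.
Qed.

Lemma gaussc_moment_is_cderive k a x xi :
  is_cderive (fun xi => (xi ^+ k)%:C * gaussc a x xi) xi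
    ((k%:R * xi ^+ k.-1)%:C * gaussc a x xi +
     (xi ^+ k)%:C * ((- (2 * c a * xi%:C + 'i%C * x%:C)) * gaussc a x xi)).
Proof. exact: is_cderiveM (is_cderive_real (is_derive_exp k xi)) (gaussc_is_cderive a x xi). Qed.

(** The derivative of [gaussc a x] integrates to 0. This expresses the x-derivative of the zeroth
    moment through the zeroth moment itself. *)
Lemma gauss_moment1 a x : 2 * c a * gauss_moment 1 a x = - ('i%C * x%:C * gauss_moment 0 a x).
Proof.
have d0 := gaussc_cdecay a x (isT : (0 <= 2)%N).
have d1 := gaussc_cdecay a x (isT : (1 <= 2)%N).
pose df xi := - (2 * c a) * ((xi ^+ 1)%:C * gaussc a x xi) +
  - ('i%C * x%:C) * ((xi ^+ 0)%:C * gaussc a x xi).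
have H xi : is_cderive (gaussc a x) xi (df xi).
  by apply: (is_cderive_eq (gaussc_is_cderive a x xi)); rewrite /df expr0 expr1; ring.
have [c1 c2] := is_cderive_continuous (fun xi => is_cderiveD
  (is_cderiveM (is_cderive_cst (- (2 * c a)) xi) (gaussc_moment_is_cderive 1 a x xi))
  (is_cderiveM (is_cderive_cst (- ('i%C * x%:C)) xi) (gaussc_moment_is_cderive 0 a x xi))).
have dE : cdecay (gaussc a x).
  by rewrite (_ : gaussc a x = fun xi => (xi ^+ 0)%:C * gaussc a x xi)//;
    apply/funext => xi; rewrite expr0 mul1r.
have := cintegral_derive_line H c1 c2 dE (cdecayD (cdecayZ _ d1) (cdecayZ _ d0)).
rewrite cintegralD; try by apply: cdecay_cintegrable; exact: cdecayZ.
rewrite !cintegralZ; try exact: cdecay_cintegrable.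
rewrite -!/(gauss_moment _ _ _) => /eqP; rewrite addr_eq0 mulNr eqr_opp => /eqP ->.
by rewrite mulNr.
Qed.

(** The derivative of [xi] times the Gaussian integrates to 0. This closes the differential equation
    of the zeroth moment in [a]. *)
Lemma gauss_moment2 a : 2 * c a * gauss_moment 2 a 0 = gauss_moment 0 a 0.
Proof.
have d0 := gaussc_cdecay a 0 (isT : (0 <= 2)%N).
have d1 := gaussc_cdecay a 0 (isT : (1 <= 2)%N).
have d2 := gaussc_cdecay a 0 (isT : (2 <= 2)%N).
pose df xi := 1 * ((xi ^+ 0)%:C * gaussc a 0 xi) +
  - (2 * c a) * ((xi ^+ 2)%:C * gaussc a 0 xi).
have H xi : is_cderive (fun xi => (xi ^+ 1)%:C * gaussc a 0 xi) xi (df xi).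
  apply: (is_cderive_eq (gaussc_moment_is_cderive 1 a 0 xi)).
  by rewrite /df expr0 expr1 expr2 rmorphM /= mulr1 mulr0 addr0; ring.
have [c1 c2] := is_cderive_continuous (fun xi => is_cderiveD
  (is_cderiveM (is_cderive_cst 1 xi) (gaussc_moment_is_cderive 0 a 0 xi))
  (is_cderiveM (is_cderive_cst (- (2 * c a)) xi) (gaussc_moment_is_cderive 2 a 0 xi))).
have := cintegral_derive_line H c1 c2 d1 (cdecayD (cdecayZ _ d0) (cdecayZ _ d2)).
rewrite cintegralD; try by apply: cdecay_cintegrable; exact: cdecayZ.
rewrite !cintegralZ; try exact: cdecay_cintegrable.
by rewrite -!/(gauss_moment _ _ _) mul1r => /eqP; rewrite addr_eq0 mulNr opprK => /eqP ->.
Qed.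

Lemma gauss_moment0_is_cderive_x a x :
  is_cderive (fun x => gauss_moment 0 a x) x (- 'i%C * gauss_moment 1 a x).
Proof.
have [C C0 HC] := gaussc_moment_dom.
have ih : leb.-integrable setT (EFin \o (fun r => (norm1c (- 'i%C : R[i]) * C) * (oneDsqr r)^-1)).
  exact: (integrableZl measurableT _ (@integrable_oneDsqrV R)).
have d k y (k2 : (k <= 2)%N) := cdecay_cintegrable (gaussc_cdecay a y k2).
rewrite -cintegralZ; last exact: d.
refine (@is_cderive_cintegral R _ (measurableTypeR R) leb
  (fun x xi => (xi ^+ 0)%:C * gaussc a x xi)
  (fun x xi => - 'i%C * ((xi ^+ 1)%:C * gaussc a x xi)) _ x _ _ ih _).
- by move=> y; exact: d.
- move=> y xi.
  have D : is_derive y (1 : R) (fun y : R => a * xi ^+ 2 - xi * y) (- xi).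
    apply: is_derive_eq (is_derive_sub (is_derive_cst (a * xi ^+ 2) y (1 : R))
      (is_deriveZ xi (is_derive_id y (1 : R)))) _.
    by rewrite /GRing.scale /= mulr1 sub0r.
  apply: (is_cderive_eq (is_cderiveM (is_cderive_cst _ y) (is_cderiveM (is_cderive_cst _ y)
    (is_cderive_cexpi D)))).
  by rewrite /gaussc expr0 expr1 rmorphN /=; ring.
- move=> y xi; apply: le_trans (norm1cM _ _) _.
  by rewrite -mulrA ler_wpM2l ?norm1c_ge0//; exact: HC.
Qed.

Lemma gauss_moment0_is_cderive_a a :
  is_cderive (fun a => gauss_moment 0 a 0) a ('i%C * gauss_moment 2 a 0).
Proof.
have [C C0 HC] := gaussc_moment_dom.
have ih : leb.-integrable setT (EFin \o (fun r => (norm1c ('i%C : R[i]) * C) * (oneDsqr r)^-1)).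
  exact: (integrableZl measurableT _ (@integrable_oneDsqrV R)).
have d k y (k2 : (k <= 2)%N) := cdecay_cintegrable (gaussc_cdecay y 0 k2).
rewrite -cintegralZ; last exact: d.
refine (@is_cderive_cintegral R _ (measurableTypeR R) leb
  (fun a xi => (xi ^+ 0)%:C * gaussc a 0 xi)
  (fun a xi => 'i%C * ((xi ^+ 2)%:C * gaussc a 0 xi)) _ a _ _ ih _).
- by move=> y; exact: d.
- move=> y xi.
  have D : is_derive y (1 : R) (fun y : R => y * xi ^+ 2 - xi * 0) (xi ^+ 2).
    apply: is_derive_eq (is_derive_sub (is_derive_mul (is_derive_id y (1 : R))
      (is_derive_cst (xi ^+ 2) y (1 : R))) (is_derive_cst (xi * 0) y (1 : R))) _.
    by rewrite mulr0 mul1r addr0 subr0.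
  apply: (is_cderive_eq (is_cderiveM (is_cderive_cst _ y) (is_cderiveM (is_cderive_cst _ y)
    (is_cderive_cexpi D)))).
  by rewrite /gaussc expr0; ring.
- move=> y xi; apply: le_trans (norm1cM _ _) _.
  by rewrite -mulrA ler_wpM2l ?norm1c_ge0//; exact: HC.
Qed.

Local Notation kap a := (delta ^+ 2 + a ^+ 2).

Lemma kap_gt0 a : 0 < kap a.
Proof. by rewrite ltr_pwDl ?sqr_ge0// exprn_gt0. Qed.

Lemma gauss_rateV a : c a * (delta%:C + 'i%C * a%:C) = (kap a)%:C.
Proof.
have i2 : 'i%C * 'i%C = -1 :> R[i] by rewrite -expr2 sqr_i.
rewrite rmorphD !rmorphXn /= !expr2.
transitivity (delta%:C * delta%:C - ('i%C * 'i%C) * (a%:C * a%:C)); first by ring.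
by rewrite i2 mulN1r opprK.
Qed.

Lemma gauss_rate_neq0 a : 2 * c a != 0.
Proof.
rewrite mulf_neq0 ?pnatr_eq0//; apply/eqP => c0.
have := gauss_rateV a; rewrite c0 mul0r => /(congr1 (@complex.Re R)) /= H.
by have := kap_gt0 a; rewrite -H ltxx.
Qed.

Lemma is_cderive_0_is_cst (f : R -> R[i]) (y z : R) :
  (forall r, is_cderive f r 0) -> f y = f z.
Proof.
move=> H; apply: complex_ext.
- by apply: (is_derive_0_is_cst (f := fun r => Re (f r))) => r; have [] := H r.
- by apply: (is_derive_0_is_cst (f := fun r => Im (f r))) => r; have [] := H r.
Qed.

(** With c the complex rate, the moment satisfies [M' = - x M / (2 c)]. The function [W] below is
    [exp(y^2 / (4 c))], the inverse of the expected Gaussian, so [M W] has derivative 0 and equals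
    its value at 0. *)
Lemma gauss_moment0E a x : gauss_moment 0 a x = gauss_moment 0 a 0 *
  ((expR (- (delta * x ^+ 2 / (4 * kap a))))%:C * cexpi (- (a * x ^+ 2 / (4 * kap a)))).
Proof.
pose p := delta / (4 * kap a); pose q := a / (4 * kap a).
pose W y : R[i] := (expR (p * y ^+ 2))%:C * cexpi (q * y ^+ 2).
have k0 := kap_gt0 a.
have D y : is_derive y (1 : R) (fun y : R => y ^+ 2) (2 * y).
  by have := is_derive_exp 2 y; rewrite expr1.
have DW y : is_cderive W y ((2 * (p%:C + 'i%C * q%:C) * y%:C) * W y).
  have D1 : is_derive y (1 : R) (fun y => expR (p * y ^+ 2)) (p * (2 * y) * expR (p * y ^+ 2)).
    apply: is_derive_eq (is_derive_chain (is_derive_expR _) (is_deriveZ p (D y))) _.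
    by rewrite mulrC.
  have D3 : is_derive y (1 : R) (fun y : R => q * y ^+ 2) (q * (2 * y)) := is_deriveZ q (D y).
  apply: (is_cderive_eq (is_cderiveM (is_cderive_real D1) (is_cderive_cexpi D3))).
  by rewrite /W !realC_M (rmorph_nat (real_complex R) 2); ring.
have pq : 2 * c a * (2 * (p%:C + 'i%C * q%:C)) = 1.
  have -> : p%:C + 'i%C * q%:C = (delta%:C + 'i%C * a%:C) * ((4 * kap a)^-1)%:C.
    by rewrite /p /q !realC_M; ring.
  rewrite (_ : _ * _ = 4 * (c a * (delta%:C + 'i%C * a%:C)) * ((4 * kap a)^-1)%:C); last by ring.
  rewrite gauss_rateV -(rmorph_nat (real_complex R) 4) -!realC_M divff// mulf_neq0 ?pnatr_eq0//.
  by rewrite gt_eqF.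
have i2 : 'i%C * 'i%C = -1 :> R[i] by rewrite -expr2 sqr_i.
have H y : is_cderive (fun y => gauss_moment 0 a y * W y) y 0.
  apply: (is_cderive_eq (is_cderiveM (gauss_moment0_is_cderive_x a y) (DW y))).
  apply: (mulfI (gauss_rate_neq0 a)); rewrite mulr0 mulrDr.
  rewrite (_ : 2 * c a * _ = - 'i%C * (2 * c a * gauss_moment 1 a y) * W y); last by ring.
  rewrite (_ : 2 * c a * (_ * (_ * W y)) = 2 * c a * (2 * (p%:C + 'i%C * q%:C)) * y%:C *
    gauss_moment 0 a y * W y); last by ring.
  rewrite pq gauss_moment1.
  transitivity (('i%C * 'i%C + 1) * (y%:C * gauss_moment 0 a y * W y)); first by ring.
  by rewrite i2 addNr mul0r.
have := is_cderive_0_is_cst x 0 H.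
rewrite {2}/W expr0n !mulr0 expR0 cexpi0 !mulr1 => <-.
rewrite -mulrA /W.
rewrite (_ : _ * _ * _ = (expR (p * x ^+ 2) * expR (- (delta * x ^+ 2 / (4 * kap a))))%:C *
  (cexpi (q * x ^+ 2) * cexpi (- (a * x ^+ 2 / (4 * kap a))))); last by rewrite realC_M; ring.
rewrite -expRD -cexpiD /p /q [_ * x ^+ 2]mulrAC subrr [a / _ * _]mulrAC subrr.
by rewrite expR0 cexpi0 !mulr1.
Qed.

(** The initial value at [a = 0] for the conserved quantity of [gauss_moment0_sqr_norm], obtained by
    rescaling the real Gaussian integral. *)
Lemma gauss_moment0_real : gauss_moment 0 0 0 = (Num.sqrt pi / Num.sqrt delta)%:C.
Proof.
have s0 : 0 < Num.sqrt delta by rewrite sqrtr_gt0.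
have E xi : (xi ^+ 0)%:C * gaussc 0 0 xi = (gauss_fun (Num.sqrt delta * xi))%:C.
  rewrite expr0 mul1r /gaussc mul0r mulr0 subr0 cexpi0 mulr1 /gauss_fun exprMn sqr_sqrtr//.
  exact: ltW.
rewrite /gauss_moment; under [X in cintegral _ _ X]eq_fun do rewrite E.
apply: complex_ext => /=; last by rewrite /Rintegral integral0.
apply: (mulfI (negbT (gt_eqF s0))); rewrite mulrCA divff ?mulr1 ?gt_eqF//.
have := @integralT_gauss R.
rewrite (ge0_integral_scale s0); last first.
- by move=> y; rewrite lee_fin gauss_fun_ge0.
- by apply/measurable_EFinP; exact: measurable_gauss_fun.
rewrite /Rintegral; move: (\int[leb]_x _)%E => [y||] /=.
- by rewrite -EFinM => -[].
- by rewrite gt0_muley.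
- by rewrite gt0_muleNy.
Qed.

(* With v(a) the moment, v' = i v / (2c) makes |v|^4 (delta^2 + a^2) constant in a. *)
Lemma gauss_moment0_sqr_norm a : complex.Re (gauss_moment 0 a 0) ^+ 2 +
  complex.Im (gauss_moment 0 a 0) ^+ 2 = pi / Num.sqrt (kap a).
Proof.
pose u b := Re (gauss_moment 0 b 0); pose w b := Im (gauss_moment 0 b 0).
pose N b := u b ^+ 2 + w b ^+ 2.
have M2 b : gauss_moment 2 b 0 =
    ((2 * kap b)^-1)%:C * (delta%:C + 'i%C * b%:C) * gauss_moment 0 b 0.
  apply: (mulfI (gauss_rate_neq0 b)); rewrite gauss_moment2.
  rewrite (_ : 2 * c b * _ = 2 * (c b * (delta%:C + 'i%C * b%:C)) * ((2 * kap b)^-1)%:C *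
    gauss_moment 0 b 0); last by ring.
  rewrite gauss_rateV -(rmorph_nat (real_complex R) 2) -!realC_M divff ?mul1r// mulf_neq0 ?pnatr_eq0//.
  by rewrite gt_eqF// kap_gt0.
have Du b : is_derive b (1 : R) u (- (b * u b + delta * w b) / (2 * kap b)).
  have [d _] := gauss_moment0_is_cderive_a b; apply: (is_derive_eq d).
  rewrite M2 !(cReM, cImM, cReD, cImD) -/(u b) -/(w b); move: (u b) (w b) => y z /=.
  by field; rewrite gt_eqF// kap_gt0.
have Dw b : is_derive b (1 : R) w ((delta * u b - b * w b) / (2 * kap b)).
  have [_ d] := gauss_moment0_is_cderive_a b; apply: (is_derive_eq d).
  rewrite M2 !(cReM, cImM, cReD, cImD) -/(u b) -/(w b); move: (u b) (w b) => y z /=.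
  by field; rewrite gt_eqF// kap_gt0.
have DN b : is_derive b (1 : R) (fun b => N b ^+ 2 * kap b) 0.
  have D2 (f : R -> R) (df : R) : is_derive b (1 : R) f df -> is_derive b (1 : R) (fun r => f r ^+ 2) (2 * f b * df).
    move=> Df; apply: is_derive_eq (is_derive_chain (is_derive_exp 2 _) Df) _.
    by rewrite expr1.
  apply: is_derive_eq (is_derive_mul (D2 _ _ (is_derive_add (D2 _ _ (Du b)) (D2 _ _ (Dw b))))
    (is_derive_add (is_derive_cst (delta ^+ 2) b (1 : R)) (D2 _ _ (is_derive_id b (1 : R))))) _.
  rewrite /=; field.
  by rewrite gt_eqF// kap_gt0.
have := is_derive_0_is_cst a 0 DN.
have -> : N 0 = pi / delta.
  rewrite /N /u /w gauss_moment0_real /= expr0n addr0 expr_div_n !sqr_sqrtr ?pi_ge0//.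
  exact: ltW.
rewrite expr0n addr0 expr_div_n divfK ?expf_neq0 ?gt_eqF// => H.
have k0 := kap_gt0 a.
have N0 : 0 <= N a by rewrite addr_ge0 ?sqr_ge0.
apply: (mulIf (_ : Num.sqrt (kap a) != 0)); first by rewrite gt_eqF// sqrtr_gt0.
rewrite divfK ?gt_eqF ?sqrtr_gt0// -/(N a).
apply/eqP; rewrite -(@eqrXn2 _ 2) ?mulr_ge0 ?sqrtr_ge0 ?pi_ge0//.
by rewrite exprMn sqr_sqrtr ?(ltW k0)// H.
Qed.

(** Changing the sign of [a] conjugates the moment. The product of the moments of a positive and a
    negative square of P is therefore a squared modulus, known from [gauss_moment0_sqr_norm]. *)
Lemma gauss_momentN0 a : gauss_moment 0 (- a) 0 =
  complex.Re (gauss_moment 0 a 0) +i* - complex.Im (gauss_moment 0 a 0).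
Proof.
have E xi : (xi ^+ 0)%:C * gaussc (- a) 0 xi = Re ((xi ^+ 0)%:C * gaussc a 0 xi) +i*
    - Im ((xi ^+ 0)%:C * gaussc a 0 xi).
  rewrite expr0 !mul1r /gaussc !mulr0 !subr0 mulNr.
  by apply: complex_ext; rewrite ?cReM ?cImM /= ?cosN ?sinN; ring.
rewrite /gauss_moment; under [X in cintegral _ _ X]eq_fun do rewrite E.
apply: complex_ext => //=.
have [_ i] := cdecay_cintegrable (gaussc_cdecay a 0 (isT : (0 <= 2)%N)).
rewrite -[RHS]mulN1r -RintegralZl//.
by apply: eq_Rintegral => xi _; rewrite mulN1r.
Qed.

End gaussian.

Section tuple_product.
Variable R : realType.
Local Notation leb := (@lebesgue_measure R).

Lemma cmeasurable_prod d (T : measurableType d) (I : Type) (l : seq I) (F : I -> T -> R[i]) :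
  (forall i, cmeasurable (F i)) -> cmeasurable (fun t => \prod_(i <- l) F i t).
Proof.
move=> mF; elim: l => [|i l IH].
  by under eq_fun do rewrite big_nil; exact: cmeasurable_cst.
by under eq_fun do rewrite big_cons; exact: cmeasurableM.
Qed.

Lemma cintegral_tuple_prod m (f : 'I_m -> R -> R[i]) :
  (forall i, cintegrable leb setT (f i)) ->
  cintegrable (lebesgue_tuple R m) setT (fun t => \prod_i f i (tnth t i)) /\
  cintegral (lebesgue_tuple R m) setT (fun t => \prod_i f i (tnth t i)) =
  \prod_i cintegral leb setT (f i).
Proof.
elim: m f => [|m IH] f If.
  have mc (y : R) : measurable_fun setT (fun _ : tupleR R 0 => y%:E) by exact: measurable_cst.
  have ic (y : R) : (lebesgue_tuple R 0).-integrable setT (EFin \o (fun=> y)).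
    apply/integrableP; split; first exact: mc.
    by rewrite integral_tuple0 ?ltry//; exact: measurableT_comp.
  have E : (fun t : tupleR R 0 => \prod_i f i (tnth t i)) = fun=> 1.
    by apply/funext => t; rewrite big_ord0.
  rewrite E big_ord0; split; first by split; exact: ic.
  by apply: complex_ext; rewrite /= /Rintegral integral_tuple0.
have [I1 E1] := IH (fun i => f (lift ord0 i)) (fun i => If (lift ord0 i)).
have Ef (p : measurableTypeR R * tupleR R m) :
    \prod_(i < m.+1) f i (tnth (cons_pair p) i) =
    f ord0 p.1 * \prod_i f (lift ord0 i) (tnth p.2 i).
  rewrite big_ord_recl; congr (_ * _); apply: eq_bigr => i _.
  by congr (f _ _); rewrite !(tnth_nth 0).
have mf i := cintegrable_cmeasurable (If i).
have mF : cmeasurable (fun t : tupleR R m.+1 => \prod_i f i (tnth t i)).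
  apply: (@cmeasurable_prod _ _ _ _ (fun i t => f i (tnth t i))) => i.
  exact: cmeasurable_comp (mf i) (measurable_tnth i).
have mG : cmeasurable (fun p : measurableTypeR R * tupleR R m =>
    f ord0 p.1 * \prod_i f (lift ord0 i) (tnth p.2 i)).
  apply: cmeasurableM.
    exact: cmeasurable_comp (mf ord0) measurable_fst.
  exact: cmeasurable_comp (cintegrable_cmeasurable I1) measurable_snd.
have dom (x : measurableTypeR R) (t : tupleR R m) :
    norm1c (f ord0 x * \prod_i f (lift ord0 i) (tnth t i)) <=
    norm1c (f ord0 x) * norm1c (\prod_i f (lift ord0 i) (tnth t i)).
  exact: norm1cM.
split.
  split; apply: integrable_tupleS; try exact: mF.1; try exact: mF.2.
  - apply: (integrable_product _ (cintegrable_norm1c (If ord0)) (cintegrable_norm1c I1)).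
      exact: measurableT_comp mF.1 (@measurable_cons_pair R m).
    by move=> x t; apply: le_trans (dom x t); rewrite -(Ef (x, t)) /= Re_le_norm1c.
  - apply: (integrable_product _ (cintegrable_norm1c (If ord0)) (cintegrable_norm1c I1)).
      exact: measurableT_comp mF.2 (@measurable_cons_pair R m).
    by move=> x t; apply: le_trans (dom x t); rewrite -(Ef (x, t)) /= Im_le_norm1c.
rewrite cintegral_tupleS//; under [X in cintegral _ _ X]eq_fun do rewrite Ef.
rewrite (cintegral_product12 mG (cintegrable_norm1c (If ord0)) (cintegrable_norm1c I1) dom).
under [X in cintegral _ _ X]eq_fun do rewrite /= cintegralZ// mulrC.
by rewrite cintegralZ// big_ord_recl E1 mulrC.
Qed.

End tuple_product.

(** * The damped Gaussian with phase aP *)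

Section gaussian_tuple.
Variables (R : realType) (n : nat) (delta a : R).
Hypothesis delta_gt0 : 0 < delta.
Local Notation V := 'rV[R]_(n + n).
Local Notation lebn := (lebesgue_tuple R (n + n)).
Local Notation kap := (delta ^+ 2 + a ^+ 2).

Definition gaussN (x : V) (xi : V) : R[i] :=
  (expR (- (delta * dotr xi xi)))%:C * cexpi (a * Pform xi - dotr xi x).

Lemma gaussN_prod x t : gaussN x (rV_of t) =
  \prod_i (((tnth t i : R) ^+ 0)%:C * gaussc delta (@signP R n i * a) (x 0 i) (tnth t i)).
Proof.
rewrite /gaussc; under eq_bigr do rewrite expr0 mul1r.
rewrite big_split /= -rmorph_prod -cexpi_sum -expR_sum /gaussN; congr (_ * _).
- congr (expR _)%:C; rewrite /dotr mulr_sumr -sumrN; apply: eq_bigr => i _.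
  by rewrite rV_ofE expr2.
- congr cexpi; rewrite PformE /dotr mulr_sumr -sumrB; apply: eq_bigr => i _.
  by rewrite rV_ofE; ring.
Qed.

Lemma signP_sqr i : @signP R n i * signP R i = 1.
Proof. by rewrite /signP; case: ifP => _; rewrite ?mulr1// mulrN1 opprK. Qed.

Lemma gaussN_cintegrable x : cintegrable lebn setT (fun t => gaussN x (rV_of t)).
Proof.
rewrite (_ : (fun _ => _) = fun t : tupleR R (n + n) => \prod_i (((tnth t i : R) ^+ 0)%:C *
  gaussc delta (@signP R n i * a) (x 0 i) (tnth t i))); last by apply/funext => t; rewrite gaussN_prod.
apply: (@cintegral_tuple_prod R (n + n) (fun i xi => (xi ^+ 0)%:C *
  gaussc delta (@signP R n i * a) (x 0 i) xi) _).1 => i.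
by apply: cdecay_cintegrable; exact: gaussc_cdecay.
Qed.

(** The integral is a product of one-dimensional ones. Its constant factors form n conjugate pairs,
    whence the real amplitude; in the exponents [signP] enters squared for the damping and linearly
    for the phase. *)
Lemma cintegral_gaussN x : cintegral lebn setT (fun t => gaussN x (rV_of t)) =
  ((pi / Num.sqrt kap) ^+ n)%:C * ((expR (- (delta * dotr x x / (4 * kap))))%:C *
    cexpi (- (a * Pform x / (4 * kap)))).
Proof.
under [X in cintegral _ _ X]eq_fun do rewrite gaussN_prod.
rewrite (@cintegral_tuple_prod R (n + n) (fun i xi => (xi ^+ 0)%:C *
  gaussc delta (@signP R n i * a) (x 0 i) xi) _).2; last first.
  by move=> i; apply: cdecay_cintegrable; exact: gaussc_cdecay.
rewrite -[LHS]/(\prod_i gauss_moment delta 0 (@signP R n i * a) (x 0 i)).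
under eq_bigr do rewrite gauss_moment0E//.
rewrite big_split big_split /=; congr (_ * (_ * _)).
- rewrite big_split_ord /= -(gauss_moment0_sqr_norm delta_gt0 a).
  under eq_bigr do rewrite /signP /= ltn_ord mul1r.
  under [X in _ * X]eq_bigr do rewrite /signP /= ltnNge leq_addr mulN1r gauss_momentN0//.
  rewrite !prodr_const card_ord -exprMn realC_X; congr (_ ^+ _).
  by apply: complex_ext; rewrite ?cReM ?cImM /=; ring.
- rewrite -rmorph_prod -expR_sum; congr (expR _)%:C.
  rewrite /dotr mulr_sumr mulr_suml -sumrN; apply: eq_bigr => i _.
  by rewrite exprMn [signP R i ^+ 2]expr2 signP_sqr mul1r expr2.
- rewrite -cexpi_sum; congr cexpi.
  rewrite PformE mulr_sumr mulr_suml -sumrN; apply: eq_bigr => i _.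
  by rewrite exprMn [signP R i ^+ 2]expr2 signP_sqr mul1r; congr (- (_ / _)); ring.
Qed.

End gaussian_tuple.

(** * Removing the damping *)

Section parseval.
Variables (R : realType) (n : nat) (a : R).
Hypothesis a_gt0 : 0 < a.
Local Notation V := 'rV[R]_(n + n).
Local Notation lebn := (lebesgue_tuple R (n + n)).
Variables (psi : V -> R[i]) (C D : R).
Hypothesis mpsi : cmeasurable (fun t : tupleR R (n + n) => psi (rV_of t)).
Hypothesis psiC : forall x, norm1c (psi x) <= C / jb x ^+ (n + n).
Hypothesis mF : cmeasurable (fun t : tupleR R (n + n) => fourier psi (rV_of t)).
Hypothesis FD : forall xi, norm1c (fourier psi xi) <= D / jb xi ^+ (n + n).

Let K : R[i] := ((2 * pi) `^ (- ((n + n)%:R / 2)) : R)%:C.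

Lemma norm1c_gaussN delta b (x xi : V) :
  norm1c (gaussN delta b x xi) <= norm1c (gaussN delta 0 0 xi) * 2.
Proof.
rewrite /gaussN !norm1cZ mul0r sub0r (_ : dotr xi 0 = 0) ?oppr0 ?cexpi0; last first.
  by rewrite /dotr big1// => i _; rewrite mxE mulr0.
by rewrite -mulrA ler_wpM2l// {2}/norm1c /= normr0 normr1 addr0 mul1r norm1c_cexpi.
Qed.

Let damped delta : R[i] := cintegral lebn setT (fun t =>
  (expR (- (delta * dotr (rV_of t) (rV_of t))))%:C *
  (cexpi (a * Pform (rV_of t)) * fourier psi (rV_of t))).

Let damped_value delta (x : V) : R[i] :=
  ((pi / Num.sqrt (delta ^+ 2 + a ^+ 2)) ^+ n)%:C *
  ((expR (- (delta * dotr x x / (4 * (delta ^+ 2 + a ^+ 2)))))%:C *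
   cexpi (- (a * Pform x / (4 * (delta ^+ 2 + a ^+ 2))))).

Let ipsi : lebn.-integrable setT (EFin \o (fun t => C * (jb (rV_of t) ^+ (n + n))^-1)).
Proof. exact: integrable_jb_scale. Qed.

(** The Gaussian makes the double integral absolutely convergent, so the transform may be unfolded
    and the [xi]-integral computed first. *)
Let dampedE delta : 0 < delta -> damped delta =
  cintegral lebn setT (fun t => K * (psi (rV_of t) * damped_value delta (rV_of t))).
Proof.
move=> d0.
pose f (p : tupleR R (n + n) * tupleR R (n + n)) :=
  K * (psi (rV_of p.2) * gaussN delta a (rV_of p.2) (rV_of p.1)).
have mf : cmeasurable f.
  apply: cmeasurableM; first exact: cmeasurable_cst.
  apply: cmeasurableM; first exact: cmeasurable_comp mpsi measurable_snd.
  have mP := measurableT_comp (@measurable_Pform R n) (measurable_fst : measurable_fun setT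
    (@fst (tupleR R (n + n)) (tupleR R (n + n)))).
  apply: cmeasurableM; last first.
    apply: cmeasurable_cexpi; apply: measurable_funB; last exact: measurable_dotr.
    exact: measurable_funM.
  apply: cmeasurable_real; apply: measurableT_comp => //; apply: measurableT_comp => //.
  apply: measurable_funM => //.
  exact: (measurableT_comp (@measurable_dotr R (n + n))
    (measurable_fun_pair measurable_fst measurable_fst)).
have i1 := cintegrable_norm1c (@gaussN_cintegrable R n delta 0 d0 0).
have i2 : lebn.-integrable setT
    (EFin \o (fun t => norm1c K * 2 * (C * (jb (rV_of t) ^+ (n + n))^-1))).
  exact: (integrableZl measurableT (norm1c K * 2) ipsi).
have fg s t : norm1c (f (s, t)) <= norm1c (gaussN delta 0 0 (rV_of s)) *
    (norm1c K * 2 * (C * (jb (rV_of t) ^+ (n + n))^-1)).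
  rewrite [leRHS](_ : _ = norm1c K * (C * (jb (rV_of t) ^+ (n + n))^-1 *
    (norm1c (gaussN delta 0 0 (rV_of s)) * 2))); last by ring.
  apply: le_trans (norm1cM _ _) _; rewrite ler_wpM2l ?norm1c_ge0//.
  apply: le_trans (norm1cM _ _) _.
  by rewrite ler_pM ?norm1c_ge0 ?norm1c_gaussN//; exact: psiC.
transitivity (cintegral lebn setT (fun s => cintegral lebn setT (fun t => f (s, t)))).
  congr cintegral; apply/funext => s; rewrite /f /=.
  have ik : cintegrable lebn setT
      (fun t => psi (rV_of t) * cexpi (- dotr (rV_of t) (rV_of s))).
    apply: (cintegrable_dom _ (integrable_jb_scale (n + n) (C * 2))) => [|t].
      apply: cmeasurableM mpsi _; apply: cmeasurable_cexpi; apply: measurableT_comp => //.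
      exact: measurableT_comp (@measurable_dotr R (n + n)) (pair2_measurable s).
    by apply: le_trans (norm1c_mul_cexpi _ _) _; rewrite mulrAC ler_wpM2r.
  rewrite /fourier /integral_Rn -/K !mulrA -cintegralZ//.
  congr cintegral; apply/funext => t.
  rewrite /gaussN cexpiD (_ : dotr (rV_of s) (rV_of t) = dotr (rV_of t) (rV_of s)); first by ring.
  by apply: eq_bigr => i _; rewrite mulrC.
rewrite (cFubini mf i1 i2 fg); congr cintegral; apply/funext => t; rewrite /f /=.
rewrite cintegralZ; last first.
  by apply: cintegrableZ; exact: gaussN_cintegrable.
by rewrite cintegralZ ?cintegral_gaussN//; exact: gaussN_cintegrable.
Qed.

Let small (k : nat) : R := k.+1%:R^-1.

Let small_gt0 k : 0 < small k. Proof. by rewrite invr_gt0. Qed.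

Let small_cvg : small k @[k --> \oo] --> (0 : R).
Proof. exact: cvg_harmonic. Qed.

Let cvg_expRN (y : R) : expR (- (small k * y)) @[k --> \oo] --> (1 : R).
Proof.
have S : - (small k * y) @[k --> \oo] --> - (0 * y).
  by apply: cvgN; apply: cvgM => //; exact: cvg_cst.
rewrite mul0r oppr0 in S; rewrite -expR0.
exact: (continuous_cvg _ (@continuous_expR R 0) S).
Qed.

Let damped_cvg : ccvg (fun k => damped (small k))
  (integral_Rn (fun xi => cexpi (a * Pform xi) * fourier psi xi)).
Proof.
have mP := @measurable_Pform R n.
have mc : cmeasurable (fun t : tupleR R (n + n) =>
    cexpi (a * Pform (rV_of t)) * fourier psi (rV_of t)).
  by apply: cmeasurableM mF; apply: cmeasurable_cexpi; exact: measurable_funM.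
have ih : lebn.-integrable setT (EFin \o (fun t => D * 2 * (jb (rV_of t) ^+ (n + n))^-1)).
  exact: integrable_jb_scale.
apply: (dominated_ccvg _ mc _ ih).
- move=> k; apply: cmeasurableM mc; apply: cmeasurable_real; apply: measurableT_comp => //.
  apply: measurableT_comp => //; apply: measurable_funM => //.
  have mp : measurable_fun setT (fun t : tupleR R (n + n) => (t, t)).
    exact: measurable_fun_pair.
  exact: (measurableT_comp (@measurable_dotr R (n + n)) mp).
- apply: aeW => t; rewrite -[X in ccvg _ X]mul1r; apply: ccvgM (ccvg_cst _).
  by split; [exact: cvg_expRN|exact: cvg_cst].
- move=> k t; rewrite norm1cZ ger0_norm ?expR_ge0//.
  apply: le_trans (_ : 1 * norm1c (cexpi (a * Pform (rV_of t)) * fourier psi (rV_of t)) <= _).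
    rewrite ler_wpM2r ?norm1c_ge0// -expR0 ler_expR oppr_le0 mulr_ge0 ?dotr_ge0// ltW//.
  rewrite mul1r [X in norm1c X]mulrC [leRHS]mulrAC; apply: le_trans (norm1c_mul_cexpi _ _) _.
  by rewrite ler_wpM2r.
Qed.

Let kap k := small k ^+ 2 + a ^+ 2.

Let kap_pos k : 0 < kap k.
Proof. by rewrite ltr_pwDl ?sqr_ge0// exprn_gt0. Qed.

Let kap_cvg : kap k @[k --> \oo] --> a ^+ 2.
Proof.
have S : small k * small k + a ^+ 2 @[k --> \oo] --> 0 * 0 + a ^+ 2.
  by apply: cvgD; [exact: cvgM|exact: cvg_cst].
by rewrite mul0r add0r in S; under eq_fun do rewrite /kap expr2.
Qed.

Let kapV_cvg (y : R) : y / (4 * kap k) @[k --> \oo] --> y / (4 * a ^+ 2).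
Proof.
apply: cvgM; first exact: cvg_cst.
apply: cvgV; first by rewrite mulf_neq0 ?pnatr_eq0// expf_neq0// gt_eqF.
by apply: cvgM => //; exact: cvg_cst.
Qed.

(** Since [a > 0], the amplitude stays bounded as the damping disappears. *)
Let sqrt_kap_ge k : a <= Num.sqrt (kap k).
Proof.
rewrite -[leLHS]ger0_norm ?(ltW a_gt0)// -sqrtr_sqr ler_sqrt ?(ltW (kap_pos k))//.
by rewrite lerDr sqr_ge0.
Qed.

Let ampl k := (pi / Num.sqrt (kap k)) ^+ n.

Let ampl_cvg : ampl k @[k --> \oo] --> (pi / a) ^+ n.
Proof.
have S : Num.sqrt (kap k) @[k --> \oo] --> a.
  rewrite -[X in _ --> X]ger0_norm ?(ltW a_gt0)// -sqrtr_sqr.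
  exact: (continuous_cvg _ (@sqrt_continuous R _) kap_cvg).
have S1 : pi / Num.sqrt (kap k) @[k --> \oo] --> pi / a.
  by apply: cvgM; [exact: cvg_cst|apply: cvgV => //; rewrite gt_eqF].
rewrite /ampl; elim: n => [|m IH]; first by under eq_fun do rewrite expr0; exact: cvg_cst.
by rewrite exprS; under eq_fun do rewrite exprS; exact: cvgM.
Qed.

Let ampl_le k : 0 <= ampl k <= (pi / a) ^+ n.
Proof.
have p0 : 0 <= pi / Num.sqrt (kap k) by rewrite divr_ge0 ?pi_ge0 ?sqrtr_ge0.
rewrite exprn_ge0//= lerXn2r ?nnegrE ?divr_ge0 ?pi_ge0 ?(ltW a_gt0)//.
by rewrite ler_wpM2l ?pi_ge0// lef_pV2 ?posrE ?sqrtr_gt0.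
Qed.

Let damped_value_cvg x : ccvg (fun k => damped_value (small k) x)
  (((pi / a) ^+ n)%:C * cexpi (- (Pform x / (4 * a)))).
Proof.
rewrite -[X in _ * X]mul1r; apply: ccvgM; first by split; [exact: ampl_cvg|exact: cvg_cst].
apply: ccvgM.
  split; last exact: cvg_cst.
  have S : - (small k * dotr x x / (4 * kap k)) @[k --> \oo] --> - (0 * dotr x x / (4 * a ^+ 2)).
    apply: cvgN; under eq_fun do rewrite -mulrA; rewrite -mulrA.
    by apply: cvgM => //; exact: kapV_cvg.
  rewrite !mul0r oppr0 in S; rewrite /= -[X in _ --> X]expR0.
  exact: (continuous_cvg _ (@continuous_expR R 0) S).
have S : - (a * Pform x / (4 * kap k)) @[k --> \oo] --> - (Pform x / (4 * a)).
  have -> : Pform x / (4 * a) = a * Pform x / (4 * a ^+ 2) by field; rewrite gt_eqF.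
  by apply: cvgN; exact: kapV_cvg.
split.
- exact: (continuous_cvg _ (@continuous_cos R _) S).
- exact: (continuous_cvg _ (@continuous_sin R _) S).
Qed.

Let damped_value_cmeasurable delta :
  cmeasurable (fun t : tupleR R (n + n) => damped_value delta (rV_of t)).
Proof.
apply: cmeasurableM; first exact: cmeasurable_cst.
apply: cmeasurableM.
- apply: cmeasurable_real; apply: measurableT_comp => //; apply: measurableT_comp => //.
  apply: measurable_funM => //; apply: measurable_funM => //.
  have mp : measurable_fun setT (fun t : tupleR R (n + n) => (t, t)).
    exact: measurable_fun_pair.
  exact: (measurableT_comp (@measurable_dotr R (n + n)) mp).
- apply: cmeasurable_cexpi; apply: measurableT_comp => //.
  apply: measurable_funM => //; apply: measurable_funM => //; exact: measurable_Pform.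
Qed.

Let damped_value_le k x : norm1c (damped_value (small k) x) <= (pi / a) ^+ n * 2.
Proof.
have [A0 A1] := andP (ampl_le k).
rewrite norm1cZ ger0_norm// ler_pM ?norm1c_ge0// norm1cZ ger0_norm ?expR_ge0//.
rewrite -[leRHS]mul1r ler_pM ?norm1c_ge0 ?expR_ge0 ?norm1c_cexpi//.
rewrite -expR0 ler_expR oppr_le0 divr_ge0//; first by rewrite mulr_ge0 ?dotr_ge0// ltW.
by rewrite mulr_ge0// ltW// kap_pos.
Qed.

Let pi_const : K * ((pi / a) ^+ n)%:C = (((2 * a) ^+ n)^-1)%:C.
Proof.
rewrite /K -realC_M; congr (_%:C).
have p0 : 0 < pi :> R := pi_gt0 R.
rewrite (_ : (n + n)%:R / 2 = n%:R :> R); last by rewrite natrD; field.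
rewrite powRN powR_mulrn ?mulr_ge0 ?(ltW p0)// expr_div_n !exprMn.
by field; rewrite !expf_neq0 ?gt_eqF.
Qed.

(** Both sides are limits of the same damped integrals along [delta = 1/(k+1)]. Dominated
    convergence rests on the decay of the transform for the left side, and on the decay of [psi]
    with the bounded amplitude for the right side. *)
Lemma fourier_Pform_phase :
  integral_Rn (fun xi => cexpi (a * Pform xi) * fourier psi xi) =
  (((2 * a) ^+ n)^-1)%:C * integral_Rn (fun x => cexpi (- (Pform x / (4 * a))) * psi x).
Proof.
have ip : cintegrable lebn setT (fun t => cexpi (- (Pform (rV_of t) / (4 * a))) * psi (rV_of t)).
  under [X in cintegrable _ _ X]eq_fun do rewrite mulrC.
  apply: (cintegrable_dom _ (integrable_jb_scale (n + n) (C * 2))) => [|t].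
    apply: cmeasurableM mpsi _; apply: cmeasurable_cexpi; apply: measurableT_comp => //.
    by apply: measurable_funM => //; exact: measurable_Pform.
  by apply: le_trans (norm1c_mul_cexpi _ _) _; rewrite mulrAC ler_wpM2r.
rewrite -pi_const /integral_Rn -cintegralZ//.
have H : ccvg (fun k => damped (small k)) (cintegral lebn setT (fun t =>
    K * ((pi / a) ^+ n)%:C * (cexpi (- (Pform (rV_of t) / (4 * a))) * psi (rV_of t)))).
  under eq_fun do rewrite dampedE//.
  have ih : lebn.-integrable setT (EFin \o (fun t =>
      norm1c K * ((pi / a) ^+ n * 2) * C * (jb (rV_of t) ^+ (n + n))^-1)).
    exact: integrable_jb_scale.
  apply: (dominated_ccvg _ _ _ ih).
  - move=> k; apply: cmeasurableM; first exact: cmeasurable_cst.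
    by apply: cmeasurableM mpsi _; exact: damped_value_cmeasurable.
  - apply: cmeasurableM; first exact: cmeasurable_cst.
    exact: cintegrable_cmeasurable ip.
  - apply: aeW => t.
    have := ccvgM (ccvg_cst K) (ccvgM (ccvg_cst (psi (rV_of t))) (damped_value_cvg (rV_of t))).
    rewrite [X in ccvg _ X -> _](_ : _ = K * ((pi / a) ^+ n)%:C *
      (cexpi (- (Pform (rV_of t) / (4 * a))) * psi (rV_of t)))//.
    by ring.
  - move=> k t; rewrite [leRHS](_ : _ = norm1c K * (C * (jb (rV_of t) ^+ (n + n))^-1 *
      ((pi / a) ^+ n * 2))); last by ring.
    apply: le_trans (norm1cM _ _) _; rewrite ler_wpM2l ?norm1c_ge0//.
    apply: le_trans (norm1cM _ _) _.
    by rewrite ler_pM ?norm1c_ge0 ?damped_value_le//; exact: psiC.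
have [d1 d2] := damped_cvg; have [h1 h2] := H.
by apply: complex_ext; [exact: (cvg_unique _ d1 h1)|exact: (cvg_unique _ d2 h2)].
Qed.

End parseval.

(** * The fundamental solution *)

Section hyperbolic_bounds.
Variable R : realType.
Implicit Types t : R.

Lemma cosh_ge1 t : 1 <= cosh t.
Proof.
have := expR_ge1Dx t; have := expR_ge1Dx (- t); rewrite /cosh => h1 h2.
by rewrite ler_pdivlMr//; lra.
Qed.

Lemma cosh_gt0 t : 0 < cosh t. Proof. exact: lt_le_trans ltr01 (cosh_ge1 t). Qed.

Lemma sinh_gt0 t : 0 < t -> 0 < sinh t.
Proof.
by move=> t0; rewrite /sinh divr_gt0// subr_gt0 ltr_expR (lt_trans _ t0)// oppr_lt0.
Qed.

(** From [4 cosh t >= 2 e^t >= 2 + t^2]; this crude rate already gives integrability in [t]. *)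
Lemma coshXV_le t n : 0 < t -> (0 < n)%N -> (cosh t ^+ n)^-1 <= 4 * (oneDsqr t)^-1.
Proof.
move=> t0 n0; have o0 : 0 < oneDsqr t by rewrite (lt_le_trans ltr01)// oneDsqr_ge1.
have c0 := cosh_gt0 t.
rewrite ler_pdivlMr// mulrC ler_pdivrMr ?exprn_gt0//.
apply: (@le_trans _ _ (4 * cosh t)); last by rewrite ler_wpM2l// ler_eXnr// cosh_ge1.
have h : 1 + t ^+ 2 / 2 <= expR t by exact: (expR_ge1Dxn 1 (ltW t0)).
by have := expR_ge0 (- t); rewrite /oneDsqr /cosh => h2; lra.
Qed.

Lemma measurable_coshXV n : measurable_fun setT (fun t : measurableTypeR R => (cosh t ^+ n)^-1).
Proof.
rewrite (_ : (fun _ => _) = fun t : measurableTypeR R => (cosh t ^+ n) `^ (-1)).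
  apply: (measurableT_comp (measurable_powR (-1))).
  apply: measurable_funX; apply: measurable_funM => //; apply: measurable_funD => //.
  by apply: measurableT_comp => //; exact: measurableT_comp.
by apply/funext => t; rewrite powR_inv1// exprn_ge0// ltW// cosh_gt0.
Qed.

Lemma measurable_tanh : measurable_fun setT (fun t : measurableTypeR R => tanh t).
Proof.
rewrite (_ : (fun _ => _) = fun t : measurableTypeR R => sinh t * (cosh t ^+ 1)^-1).
  apply: measurable_funM; last exact: measurable_coshXV.
  apply: measurable_funM => //; apply: measurable_funB => //.
  by apply: measurableT_comp => //; exact: measurableT_comp.
by apply/funext => t; rewrite expr1.
Qed.

Lemma mem_pos t : (t \in `]0%R, +oo[%classic) = (0 < t).
Proof.
apply/idP/idP => [/set_mem /=|t0]; first by rewrite in_itv/= andbT.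
by rewrite mem_set//= in_itv/= andbT.
Qed.

Lemma integral_posE (f : R -> R[i]) : integral_pos f =
  cintegral (@lebesgue_measure R) setT (fun t => if 0 < t then f t else 0).
Proof.
rewrite /integral_pos cintegral_mkcond; congr cintegral; apply/funext => t.
by rewrite mem_pos.
Qed.

End hyperbolic_bounds.

(** * Fubini for the variables t, xi and theta *)

Section triple_integral.
Variables (R : realType) (n s : nat) (phi : 'rV[R]_(n + n + s) -> R[i]).
Hypothesis (n2 : (2 <= n)%N) (s2 : (2 <= s)%N) (sphi : schwartz phi).
Local Notation leb := (@lebesgue_measure R).
Local Notation lebn := (lebesgue_tuple R (n + n)).
Local Notation lebs := (lebesgue_tuple R s).
Implicit Types (t : R) (xi : 'rV[R]_(n + n)) (th : 'rV[R]_s).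

(** Extension by zero to [t <= 0] puts all three integrals on full spaces, where the Fubini lemmas
    are stated. *)
Definition phase_kernel t xi th : R[i] := if 0 < t then
  (1 / (enorm th * cosh t ^+ n))%:C * cexpi (tanh t / enorm th * Pform xi) else 0.

Let c0 : R[i] := 'i%C / ((2 * pi) `^ (n%:R + s%:R / 2))%:C.

Definition triple_kernel t xi th : R[i] :=
  c0 * (phase_kernel t xi th * fourier phi (row_mx xi th)).

Lemma phase_kernel_le t xi th : norm1c (phase_kernel t xi th) <=
  8 * (oneDsqr t)^-1 * (enorm th)^-1.
Proof.
rewrite /phase_kernel; case: ifPn => [t0|_]; last first.
  by rewrite norm1c0 mulr_ge0 ?invr_ge0 ?enorm_ge0// mulr_ge0 ?oneDsqrV_ge0.
have ch0 : 0 <= cosh t ^+ n by rewrite exprn_ge0// ltW// cosh_gt0.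
rewrite norm1cZ div1r invfM ger0_norm ?mulr_ge0 ?invr_ge0 ?enorm_ge0//.
rewrite [leLHS](_ : _ = (cosh t ^+ n)^-1 * norm1c (cexpi (tanh t / enorm th * Pform xi)) *
  (enorm th)^-1); last by ring.
rewrite ler_wpM2r ?invr_ge0 ?enorm_ge0//.
have -> : 8 * (oneDsqr t)^-1 = 4 * (oneDsqr t)^-1 * 2 by ring.
by rewrite ler_pM ?invr_ge0 ?norm1c_ge0 ?norm1c_cexpi// coshXV_le// ltnW.
Qed.

Lemma phase_kernel_cmeasurable d (T : measurableType d) (t : T -> measurableTypeR R)
    (xi : T -> tupleR R (n + n)) (th : T -> tupleR R s) :
  measurable_fun setT t -> measurable_fun setT xi -> measurable_fun setT th ->
  cmeasurable (fun p => phase_kernel (t p) (rV_of (xi p)) (rV_of (th p))).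
Proof.
move=> mt mxi mth.
have me := measurableT_comp (@measurable_enormV R s) mth.
apply: (@cmeasurable_if R _ _ (fun p => 0 < (t p : R)) _ (fun=> 0)) => //.
- exact: measurable_fun_ltr.
- apply: cmeasurableM.
    apply: cmeasurable_real; under eq_fun do rewrite div1r invfM.
    apply: measurable_funM; first exact: me.
    have mc := measurableT_comp (@measurable_coshXV R n) mt.
    exact: mc.
  apply: cmeasurable_cexpi; apply: measurable_funM.
    apply: measurable_funM; last exact: me.
    exact: (measurableT_comp (@measurable_tanh R) mt).
  exact: (measurableT_comp (@measurable_Pform R n) mxi).
Qed.

Lemma triple_kernel_cmeasurable d (T : measurableType d) (t : T -> measurableTypeR R)
    (xi : T -> tupleR R (n + n)) (th : T -> tupleR R s) :
  measurable_fun setT t -> measurable_fun setT xi -> measurable_fun setT th ->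
  cmeasurable (fun p => triple_kernel (t p) (rV_of (xi p)) (rV_of (th p))).
Proof.
move=> mt mxi mth; apply: cmeasurableM; first exact: cmeasurable_cst.
apply: cmeasurableM; first exact: phase_kernel_cmeasurable.
have := cmeasurable_comp (fourier_cmeasurable sphi)
  (measurableT_comp (@measurable_cat_pair R (n + n) s) (measurable_fun_pair mxi mth)).
by under eq_fun do rewrite /= rV_of_cat.
Qed.

Let h1 t := 8 * (oneDsqr t)^-1.
Let h3 xi := (jb xi ^+ (n + n))^-1.

(** A product of integrable functions of one variable each: decay of [1 / cosh^n] in [t], the
    singularity [1 / |theta|] tempered by the decay of the transform, and that decay again in
    [xi]. *)
Lemma triple_kernel_le : exists2 A, 0 <= A & forall t xi th,
  norm1c (triple_kernel t xi th) <= h1 t * (A * ((enorm th)^-1 * (jb th ^+ s)^-1)) * h3 xi.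
Proof.
have [A A0 HA] := fourier_decay (n + n + s) sphi.
exists (norm1c c0 * A) => [|t xi th]; first by rewrite mulr_ge0 ?norm1c_ge0.
have p1 : 0 < jb xi ^+ (n + n) by rewrite exprn_gt0// jb_gt0.
have p2 : 0 < jb th ^+ s by rewrite exprn_gt0// jb_gt0.
apply: le_trans (norm1cM _ _) _.
have -> : h1 t * (norm1c c0 * A * ((enorm th)^-1 * (jb th ^+ s)^-1)) * h3 xi =
    norm1c c0 * ((h1 t * (enorm th)^-1) * (A / (jb xi ^+ (n + n) * jb th ^+ s))).
  by rewrite /h3 invfM; ring.
rewrite ler_wpM2l ?norm1c_ge0//; apply: le_trans (norm1cM _ _) _.
rewrite ler_pM ?norm1c_ge0 ?phase_kernel_le//; apply: le_trans (HA _) _.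
rewrite ler_wpM2l// lef_pV2 ?posrE ?mulr_gt0 ?exprn_gt0 ?jb_gt0//.
exact: jb_row_ge.
Qed.

Let ih1 (c : R) : leb.-integrable setT (EFin \o (fun t => c * h1 t)).
Proof.
rewrite (_ : (EFin \o _) = EFin \o (fun t => (c * 8) * (oneDsqr t)^-1)).
  exact: (integrableZl measurableT _ (@integrable_oneDsqrV R)).
by apply/funext => t; rewrite /= /h1 mulrA.
Qed.

Let ih2 (c : R) : lebs.-integrable setT
  (EFin \o (fun b : tupleR R s => c * ((enorm (rV_of b))^-1 * (jb (rV_of b) ^+ s)^-1))).
Proof.
have := integrableZl measurableT c (@integrable_enormV_jb R s s2); exact.
Qed.

Let ih3 (c : R) : lebn.-integrable setT (EFin \o (fun a : tupleR R (n + n) => c * h3 (rV_of a))).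
Proof. exact: integrable_jb_scale. Qed.

Lemma qsymbol_fourier xi th : qsymbol xi th * fourier phi (row_mx xi th) =
  cintegral leb setT (fun t => triple_kernel t xi th).
Proof.
have ip : cintegrable leb setT (fun t => phase_kernel t xi th).
  have := @phase_kernel_cmeasurable _ (measurableTypeR R) id (fun=> tuple_of_rV xi)
    (fun=> tuple_of_rV th) (@measurable_id _ _ _) (@measurable_cst _ _ _ _ _ _)
    (@measurable_cst _ _ _ _ _ _).
  under eq_fun do rewrite !rV_of_surj.
  move=> mp; apply: (cintegrable_dom mp (ih1 (enorm th)^-1)) => t.
  by rewrite mulrC; exact: phase_kernel_le.
rewrite /qsymbol integral_posE -/c0 mulrAC -cintegralZ//; congr cintegral; apply/funext => t.
by rewrite -/(phase_kernel t xi th) /triple_kernel; ring.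
Qed.

(** At fixed [t] the integral over [xi] is innermost, ready for Parseval's formula at fixed
    [theta]. *)
Definition slice_integral t : R[i] := cintegral lebs setT (fun b =>
  cintegral lebn setT (fun a => triple_kernel t (rV_of a) (rV_of b))).

(** The [t]-integral is innermost in [K10]. It moves out past [xi] at fixed [theta] and then past
    [theta], each time under the product bound; this yields integrability in [t] as well. *)
Lemma K10_slice : cintegrable leb setT slice_integral /\
  K10 phi = cintegral leb setT slice_integral.
Proof.
have [A A0 HA] := triple_kernel_le.
pose g2 (b : tupleR R s) := A * ((enorm (rV_of b))^-1 * (jb (rV_of b) ^+ s)^-1).
have g20 b : 0 <= g2 b.
  by rewrite mulr_ge0// mulr_ge0 ?invr_ge0 ?enorm_ge0// exprn_ge0// ltW// jb_gt0.
pose f1 (p : (tupleR R (n + n) * tupleR R s) * measurableTypeR R) :=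
  triple_kernel p.2 (rV_of p.1.1) (rV_of p.1.2).
have mf1 : cmeasurable f1.
  apply: triple_kernel_cmeasurable; first exact: measurable_snd.
  - exact: measurableT_comp measurable_fst measurable_fst.
  - exact: measurableT_comp measurable_snd measurable_fst.
pose f2 (p : (measurableTypeR R * tupleR R s) * tupleR R (n + n)) :=
  triple_kernel p.1.1 (rV_of p.2) (rV_of p.1.2).
have mf2 : cmeasurable f2.
  apply: triple_kernel_cmeasurable; last exact: measurableT_comp measurable_snd measurable_fst.
  - exact: measurableT_comp measurable_fst measurable_fst.
  - exact: measurable_snd.
pose Q (p : tupleR R (n + n) * tupleR R s) := cintegral leb setT (fun t => f1 (p, t)).
pose S (p : measurableTypeR R * tupleR R s) := cintegral lebn setT (fun a => f2 (p, a)).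
have mQ : cmeasurable Q by exact: cmeasurable_cintegral.
have mS : cmeasurable S by exact: cmeasurable_cintegral.
pose J1 := \int[leb]_t h1 t.
pose J3 := \int[lebn]_a h3 (rV_of a).
have Q_le a b : norm1c (Q (a, b)) <= 1 * h3 (rV_of a) * (J1 * g2 b).
  rewrite (_ : 1 * _ * _ = g2 b * h3 (rV_of a) * J1); last by ring.
  rewrite -RintegralZl//; last by have := ih1 1; under eq_fun do rewrite mul1r.
  apply: (norm1c_cintegral _ (ih1 (g2 b * h3 (rV_of a)))) => [|t].
    exact: cmeasurable_comp mf1 (pair1_measurable (a, b)).
  apply: le_trans (HA _ _ _) _; rewrite le_eqVlt; apply/orP; left; apply/eqP.
  by rewrite /g2; ring.
have S_le t b : norm1c (S (t, b)) <= 1 * h1 t * (J3 * g2 b).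
  rewrite (_ : 1 * _ * _ = h1 t * g2 b * J3); last by ring.
  rewrite -RintegralZl//; last by have := ih3 1; under eq_fun do rewrite mul1r.
  apply: (norm1c_cintegral _ (ih3 (h1 t * g2 b))) => [|a]; last exact: HA.
  exact: cmeasurable_comp mf2 (pair1_measurable (t, b)).
have ig2 c : lebs.-integrable setT (EFin \o (fun b => c * g2 b)).
  by have := ih2 (c * A); under eq_fun do rewrite -mulrA.
have Qf (b : tupleR R s) : cintegral lebn setT (fun a => Q (a, b)) =
    cintegral leb setT (fun t => S (t, b)).
  pose f3 (p : tupleR R (n + n) * measurableTypeR R) := triple_kernel p.2 (rV_of p.1) (rV_of b).
  have mf3 : cmeasurable f3.
    by apply: (triple_kernel_cmeasurable (th := fun=> b)).
  apply: (cFubini (f := f3) mf3 (ih3 (g2 b)) (ih1 1)) => a t.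
  apply: le_trans (HA _ _ _) _; rewrite le_eqVlt; apply/orP; left; apply/eqP.
  by rewrite /g2; ring.
have -> : cintegral leb setT slice_integral =
    cintegral lebs setT (fun b => cintegral lebn setT (fun a => Q (a, b))).
  rewrite /slice_integral (cFubini mS (ih1 1) (ig2 J3) S_le).
  by congr cintegral; apply/funext => b; rewrite Qf.
split; first exact: (cintegrable_cintegral1 mS (ih1 1) (ig2 J3) S_le).
rewrite -(cFubini mQ (ih3 1) (ig2 J1) Q_le).
(* The integrand of [K10] is [Q] composed with the inverse of concatenation; its measurability,
   required before the integral is split, comes from this form. *)
pose split_tuple (c : tupleR R (n + n + s)) : tupleR R (n + n) * tupleR R s :=
  ([tuple tnth c (lshift s i) | i < n + n], [tuple tnth c (rshift (n + n) i) | i < s]).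
have rV_split c : row_mx (rV_of (split_tuple c).1) (rV_of (split_tuple c).2) = rV_of c.
  apply/rowP => i; have [j|j] := split_ordP i => ->.
  - by rewrite row_mxEl !rV_ofE tnth_mktuple.
  - by rewrite row_mxEr !rV_ofE tnth_mktuple.
have msplit : measurable_fun setT split_tuple.
  apply/measurable_fun_pairP; split; apply/measurable_fun_tnthP => i.
  - rewrite (_ : _ \o _ = fun c => tnth c (lshift s i)); first exact: measurable_tnth.
    by apply/funext => c; rewrite /= tnth_mktuple.
  - rewrite (_ : _ \o _ = fun c => tnth c (rshift (n + n) i)); first exact: measurable_tnth.
    by apply/funext => c; rewrite /= tnth_mktuple.
have KQ (c : tupleR R (n + n + s)) :
    qsymbol (lsubmx (rV_of c)) (rsubmx (rV_of c)) * fourier phi (rV_of c) = Q (split_tuple c).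
  by rewrite -rV_split row_mxKl row_mxKr qsymbol_fourier.
rewrite /K10 /integral_Rn (_ : (fun c => _) = fun c => Q (split_tuple c)); last first.
  by apply/funext => c; exact: KQ.
rewrite cintegral_tuple_cat; last exact: cmeasurable_comp mQ msplit.
have splitK p : split_tuple (cat_pair p) = p.
  case: p => a b; rewrite /split_tuple; congr (_, _); apply/eq_from_tnth => i;
    rewrite tnth_mktuple -[LHS]rV_ofE rV_of_cat.
  - by rewrite row_mxEl rV_ofE.
  - by rewrite row_mxEr rV_ofE.
have E : (fun p => Q (split_tuple (cat_pair p))) = Q by apply/funext => p; rewrite splitK.
by rewrite E (cintegral_product12 mQ (ih3 1) (ig2 J1) Q_le).
Qed.

End triple_integral.

(** * Closed form at fixed t *)

Section slice.
Variables (R : realType) (n s : nat) (phi : 'rV[R]_(n + n + s) -> R[i]).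
Hypothesis (n2 : (2 <= n)%N) (s2 : (2 <= s)%N) (sphi : schwartz phi).
Local Notation leb := (@lebesgue_measure R).
Local Notation lebn := (lebesgue_tuple R (n + n)).
Local Notation lebs := (lebesgue_tuple R s).
Let c0 : R[i] := 'i%C / ((2 * pi) `^ (n%:R + s%:R / 2))%:C.

(** For [w = tanh t / |theta|], Parseval's phase has [1 / (4 w) = |theta| coth t / 4], and the
    amplitudes combine as [|theta|^(-1) cosh^(-n) t (2 w)^(-n) = |theta|^(n-1) (2 sinh t)^(-n)]. *)
Lemma triple_kernel_parseval (t : R) (b : tupleR R s) : 0 < t ->
  cintegral lebn setT (fun a => triple_kernel phi t (rV_of a) (rV_of b)) =
  c0 * ((2 * sinh t) ^+ n)^-1%:C *
  cintegral lebn setT (fun a => osc_kernel (coth t / 4) (n - 1) phi (rV_of a) b).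
Proof.
move=> t0; set th := rV_of b.
have sh0 := sinh_gt0 t0; have ch0 := cosh_gt0 t.
(* At [theta = 0] both kernels vanish: the left one because the inverse of 0 is 0, the right one
   because [n - 1 > 0]. *)
have [e0|en0] := eqVneq (enorm th) 0.
  rewrite (_ : (fun a => triple_kernel _ _ _ _) = fun=> 0); last first.
    by apply/funext => a; rewrite /triple_kernel /phase_kernel t0 e0 mul0r div1r invr0 !mul0r mulr0.
  rewrite (_ : (fun a => osc_kernel _ _ _ _ _) = fun=> 0); last first.
    by apply/funext => a; rewrite /osc_kernel e0 expr0n subn_eq0 leqNgt n2 mul0r.
  by rewrite !cintegral0 mulr0.
have e0 : 0 < enorm th by rewrite lt_neqAle eq_sym en0 enorm_ge0.
pose psi (x : 'rV[R]_(n + n)) := partial_fourier phi x th.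
pose w := tanh t / enorm th.
have w0 : 0 < w by rewrite divr_gt0// divr_gt0.
have mpsi : cmeasurable (fun a : tupleR R (n + n) => psi (rV_of a)).
  exact: cmeasurable_comp (partial_fourier_cmeasurable sphi) (pair2_measurable b).
have [C C0 psiC] := partial_fourier_bounded (n + n) sphi.
have [D D0 HD] := fourier_decay (n + n) sphi.
have Frow (xi : 'rV[R]_(n + n)) : fourier phi (row_mx xi th) = fourier psi xi.
  exact: fourier_row.
have mF : cmeasurable (fun a : tupleR R (n + n) => fourier psi (rV_of a)).
  have := cmeasurable_comp (fourier_cmeasurable sphi)
    (measurableT_comp (@measurable_cat_pair R (n + n) s) (pair2_measurable b)).
  by under eq_fun do rewrite /= rV_of_cat Frow.
have FD xi : norm1c (fourier psi xi) <= D / jb xi ^+ (n + n).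
  rewrite -Frow; apply: le_trans (HD _) _.
  rewrite ler_wpM2l// lef_pV2 ?posrE ?exprn_gt0 ?jb_gt0//.
  by have := jb_row_ge xi th (n + n) 0; rewrite expr0 mulr1 addn0.
have := fourier_Pform_phase w0 mpsi (fun x => psiC x th) mF FD.
rewrite /integral_Rn => P.
have iF : cintegrable lebn setT (fun a => cexpi (w * Pform (rV_of a)) * fourier psi (rV_of a)).
  apply: (cintegrable_dom _ (integrable_jb_scale (n + n) (D * 2))) => [|a].
    by apply: cmeasurableM mF; apply: cmeasurable_cexpi; apply: measurable_funM => //; exact: measurable_Pform.
  by rewrite [X in norm1c X]mulrC; apply: le_trans (norm1c_mul_cexpi _ _) _; rewrite mulrAC ler_wpM2r.
have ip : cintegrable lebn setT (fun a => cexpi (- (Pform (rV_of a) / (4 * w))) * psi (rV_of a)).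
  apply: (cintegrable_dom _ (integrable_jb_scale (n + n) (C * 2))) => [|a].
    apply: cmeasurableM mpsi; apply: cmeasurable_cexpi; apply: measurableT_comp => //.
    by apply: measurable_funM => //; exact: measurable_Pform.
  rewrite [X in norm1c X]mulrC; apply: le_trans (norm1c_mul_cexpi _ _) _.
  by rewrite mulrAC ler_wpM2r//; exact: psiC.
rewrite (_ : (fun a => triple_kernel _ _ _ _) = fun a : tupleR R (n + n) =>
    (c0 * (1 / (enorm th * cosh t ^+ n))%:C) *
    (cexpi (w * Pform (rV_of a)) * fourier psi (rV_of a))); last first.
  by apply/funext => a; rewrite /triple_kernel /phase_kernel t0 Frow -/c0 !mulrA.
rewrite (_ : (fun a => osc_kernel _ _ _ _ _) = fun a : tupleR R (n + n) =>
    (enorm th ^+ (n - 1))%:C *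
    (cexpi (- (Pform (rV_of a) / (4 * w))) * psi (rV_of a))); last first.
  apply/funext => a; rewrite /osc_kernel -/th -/(psi _) [psi _ * _]mulrC.
  congr (_ * (cexpi (- _) * _)); rewrite /w /tanh /coth.
  by field; rewrite !gt_eqF.
rewrite !cintegralZ// P; move: (cintegral _ _ _) => I.
rewrite [LHS](_ : _ = c0 * (1 / (enorm th * cosh t ^+ n) * ((2 * w) ^+ n)^-1)%:C * I); last first.
  by rewrite [in RHS]realC_M !mulrA.
rewrite [RHS](_ : _ = c0 * (((2 * sinh t) ^+ n)^-1 * enorm th ^+ (n - 1))%:C * I); last first.
  by rewrite [in RHS]realC_M !mulrA.
congr (_ * _%:C * _).
have en : enorm th ^+ n = enorm th * enorm th ^+ (n - 1) by rewrite -exprS; congr (_ ^+ _); lia.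
rewrite /w /tanh; move: (sinh t) (cosh t) sh0 ch0 => x y x0 y0.
rewrite !exprMn !exprVn en; move: (enorm th ^+ (n - 1)) (exprn_gt0 (n - 1) e0) => z z0.
by field; rewrite ?expf_neq0 ?gt_eqF.
Qed.

(** Parseval's formula leaves the x-integral inside and [theta] outside; one more Fubini turns this
    into the integral of [osc]. *)
Lemma slice_integralE (t : R) : 0 < t -> slice_integral phi t =
  c0 * ((2 * sinh t) ^+ n)^-1%:C * integral_Rn (osc (coth t / 4) (n - 1) phi).
Proof.
move=> t0; rewrite /slice_integral.
rewrite (_ : (fun b => _) = fun b : tupleR R s => c0 * ((2 * sinh t) ^+ n)^-1%:C *
  cintegral lebn setT (fun a => osc_kernel (coth t / 4) (n - 1) phi (rV_of a) b)); last first.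
  by apply/funext => b; rewrite triple_kernel_parseval.
have mk := osc_kernel_cmeasurable2 (coth t / 4) (n - 1) sphi.
have [C C0 HC] := osc_kernel_dom (coth t / 4) (n - 1) (n + n) sphi.
have dom (b : tupleR R s) (a : tupleR R (n + n)) :
    norm1c (osc_kernel (coth t / 4) (n - 1) phi (rV_of a) b) <=
    1 * (jb (rV_of b) ^+ s)^-1 * (C * (jb (rV_of a) ^+ (n + n))^-1).
  by rewrite mul1r [leRHS]mulrC; exact: HC.
pose f (p : tupleR R s * tupleR R (n + n)) :=
  osc_kernel (coth t / 4) (n - 1) phi (rV_of p.2) p.1.
have mf : cmeasurable f.
  exact: cmeasurable_comp mk (measurable_fun_pair measurable_snd measurable_fst).
have i1 := integrable_jb_scale s (1 : R); have i2 := integrable_jb_scale (n + n) C.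
rewrite cintegralZ; last exact: (cintegrable_cintegral1 mf i1 i2 dom).
by congr (_ * _); exact: (cFubini mf i1 i2 dom).
Qed.

Lemma slice_integral0 (t : R) : ~~ (0 < t) -> slice_integral phi t = 0.
Proof.
move=> /negPf t0; rewrite /slice_integral (_ : (fun b => _) = fun=> 0) ?cintegral0//.
apply/funext => b; rewrite (_ : (fun a => _) = fun=> 0) ?cintegral0//.
by apply/funext => a; rewrite /triple_kernel /phase_kernel t0 mul0r mulr0.
Qed.

End slice.

(** Here [x] is sinh t, [y] is cosh t and [z] the power of [2 pi]. The powers of cosh cancel,
    [4^(-(n-1)) 2^(n-2) = 2^(-n)], and [i^(n-1) / i^(n-2) = i]. *)
Lemma hyperbolic_constant (R : realType) (n : nat) (x y z : R) (I : R[i]) :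
  0 < x -> 0 < y -> z != 0 -> (2 <= n)%N ->
  (2 / 'i%C) ^+ (n - 2) * (1 / z)%:C *
    ((1 / (x * y ^+ (n - 1)))%:C * (('i%C * (y / x / 4)%:C) ^+ (n - 1) * I)) =
  'i%C / z%:C * ((2 * x) ^+ n)^-1%:C * I.
Proof.
case: n => [|[|m]]// x0 y0 z0 _; rewrite !subSS !subn0.
have i0 : 'i%C != 0 :> R[i].
  by apply/eqP => /(congr1 (@complex.Im R)) /eqP /=; rewrite oner_eq0.
have E : 1 / (x * y ^+ m.+1) * (y / x / 4) ^+ m.+1 * 2 ^+ m = ((2 * x) ^+ m.+2)^-1.
  rewrite (_ : 4 = 2 * 2 :> R); last by ring.
  rewrite !exprMn !exprVn !exprMn !exprS.
  have := exprn_gt0 m x0; have := exprn_gt0 m y0; have : 0 < 2 ^+ m :> R by rewrite exprn_gt0.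
  move: (x ^+ m) (y ^+ m) (2 ^+ m) => a b c c0 b0 a0.
  by field; rewrite !gt_eqF.
rewrite -E div1r realC_V; move: (1 / (x * y ^+ m.+1)) (y / x / 4) => v w.
rewrite !realC_M !realC_X (rmorph_nat (real_complex R) 2).
have -> : 2 ^+ m = (2 / 'i%C) ^+ m * 'i%C ^+ m :> R[i] by rewrite -exprMn divfK.
by move: (2 / 'i%C) => u; rewrite exprMn !exprS; ring.
Qed.

Unset Implicit Arguments.
Set Strict Implicit.

(** Limits and integrals are total operations with default values; the first three conclusions
    certify that those in the final formula are genuine. *)
Theorem theorem7p6 (R : realType) (n s : nat) (hn : (2 <= n)%N) (hs : (2 <= s)%N)
    (phi : 'rV[R]_(n + n + s) -> R[i]) (hphi : schwartz phi) :
  [/\ forall t : R, 0 < t -> schwartz (phi_t phi t),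
      forall t : R, 0 < t -> cvg (Pinv_reg (phi_t phi t) eps @[eps --> 0^'+]),
      cintegrable (@lebesgue_measure R) `]0, +oo[
        (fun t => (1 / (sinh t * cosh t ^+ (n - 1)))%:C * Pinv (phi_t phi t)) &
      K10 phi =
        (2 / 'i%C) ^+ (n - 2) * (1 / (2 * pi) `^ (n%:R + s%:R / 2))%:C *
        integral_pos
          (fun t => (1 / (sinh t * cosh t ^+ (n - 1)))%:C * Pinv (phi_t phi t))].
Proof.
have n0 : (0 < n)%N by exact: ltnW.
have s0 : (0 < s)%N by exact: ltnW.
have [iG KG] := K10_slice hn hs hphi.
set F := fun t : R => _.
set c := _ * (1 / _)%:C.
have Z0 : (2 * pi) `^ (n%:R + s%:R / 2) != 0 :> R.
  by rewrite gt_eqF// powR_gt0// mulr_gt0// pi_gt0.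
have c_neq0 : c != 0.
  apply: mulf_neq0; last by rewrite div1r realC_V invr_neq0// fmorph_eq0.
  apply/expf_neq0/mulf_neq0; first by rewrite pnatr_eq0.
  by rewrite invr_eq0; apply/eqP => /(congr1 (@complex.Im R)) /eqP /=; rewrite oner_eq0.
(* The two integrands agree pointwise up to the nonzero constant [c]. Dividing by [c] transports the
   integrability of [slice_integral] to the integrand of the theorem. *)
have FG t : (if 0 < t then F t else 0) = c^-1 * slice_integral phi t.
  case: ifPn => [t0|/slice_integral0 ->]; last by rewrite mulr0.
  apply: (mulfI c_neq0); rewrite mulVKf// slice_integralE//.
  rewrite /F (Pinv_phi_t n0 t s0 hn hphi).2; move: (integral_Rn _) => I.
  exact: hyperbolic_constant (sinh_gt0 t0) (cosh_gt0 t) Z0 hn.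
split.
- by move=> t _; exact: schwartz_phi_t.
- by move=> t _; exact: (Pinv_phi_t n0 t s0 hn hphi).1.
- apply: cintegrable_mkcond => //.
  rewrite (_ : (fun t => _) = fun t => c^-1 * slice_integral phi t); first exact: cintegrableZ.
  by apply/funext => t; rewrite mem_pos FG.
- rewrite integral_posE; under [X in cintegral _ _ X]eq_fun do rewrite FG.
  by rewrite cintegralZ// mulVKf.
Qed.
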